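(* Let $n$ be an integer with $n\geq 4$. Let $l$, $m$ and $r$ be three nonzero complex numbers with $m=\frac1r-r$. (i) Assume that the Hecke algebras $\mathcal H(D_n)$ and $\mathcal H_{F,r^2}(n)$ are semisimple; so assume that $r^{2k}\neq 1$ for every integer $k$ with $1\leq k\leq n$ and $r^{2k}\neq -1$ for every integer $k$ with $1\leq k\leq n-1$. Then $\nu^{(n)}$ is irreducible except when $$l\in\Big\{\frac1{r^{4n-7}},\ \frac1{r^{2n-7}},\ -\frac1{r^{2n-5}},\ r^3,\ \frac1r,\ -r^3\Big\},$$ when it is reducible. (ii) For these values of the parameters (that is, $r$ as in (i) and $l$ in the set above), and for the values obtained by replacing $r$ with $-\frac1r$ (that is, $l\in\{-r^{4n-7},\,-r^{2n-7},\,r^{2n-5},\,-\frac1{r^3},\,-r,\,\frac1{r^3}\}$), the CGW algebra $\mathcal{CGW}(D_n)$ of type $D_n$ with parameters $l$ and $m$ over the field $\mathbb Q(l,m)$ is not semisimple.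
   Context: Nodes of the Dynkin diagram of type $D_n$ are numbered $1,\dots,n$ so that node $1$ is adjacent to node $3$ only and node $i$ is adjacent to node $i+1$ for $2\le i\le n-1$ (these are all adjacencies); $i\sim j$ means adjacent. $F=\mathbb Q(l,r)\subset\mathbb C$. The Artin relations of type $D_n$ are $g_ig_jg_i=g_jg_ig_j$ if $i\sim j$, $g_ig_j=g_jg_i$ if $i\ne j$ and $i\not\sim j$. The CGW algebra $\mathcal{CGW}(D_n)$ with parameters $l,m$ over a field containing $l,m$ is the unital associative algebra generated by $g_1,\dots,g_n,e_1,\dots,e_n$ subject to the Artin relations on the $g_i$, $m\,e_i=l(g_i^2+m\,g_i-1)$ and $g_ie_i=\frac1le_i$ for all $i$, and $e_ig_je_i=l\,e_i$ when $i\sim j$. $\mathcal H(D_n)$ is the $F$-algebra generated by $g_1,\dots,g_n$ with the Artin relations of type $D_n$ and $g_i^2+m\,g_i=1$. $\mathcal H_{F,r^2}(n)$ is the Iwahori--Hecke algebra of the symmetric group $\mathrm{Sym}(n)$ with parameter $r^2$ over $F$. Representation $\nu^{(n)}$: let $V_n$ be the $F$-vector space with basis $\{w_{ij},\widehat{w_{ij}}:1\le i<j\le n\}$. Let $\nu^{(n)}:\mathcal{CGW}(D_n)\to\mathrm{End}_F(V_n)$ be the representation $g_i\mapsto\nu_i$, where ($\overline{w_{s,t}}$ stands for either $w_{s,t}$ or $\widehat{w_{s,t}}$, same choice on both sides): $\nu_1$: for $3\le i<j\le n$, $\nu_1(\widehat{w_{ij}})=m r^{j-5}(\widehat{w_{1,i}}-w_{1,i})+m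 r^{j-4}(\widehat{w_{2,i}}-w_{2,i})+m r^{i-3}(\widehat{w_{1,j}}-w_{1,j})+m r^{i-2}(\widehat{w_{2,j}}-w_{2,j})+m^2(r^{i+j-8}+r^{i+j-6})(\widehat{w_{12}}-w_{12})+r\,\widehat{w_{ij}}$; for $j\ge3$: $\nu_1(\widehat{w_{1j}})=w_{2j}$, $\nu_1(\widehat{w_{2j}})=w_{1j}+m r^{j-3}w_{12}-m\,w_{2j}$, $\nu_1(w_{2j})=\widehat{w_{1j}}+m r^{j-3}\widehat{w_{12}}-m\,w_{2j}$, $\nu_1(w_{1j})=\widehat{w_{2j}}+m r^{j-4}(\widehat{w_{12}}-w_{12})+m(\widehat{w_{1j}}-w_{1j})$; $\nu_1(\widehat{w_{12}})=\frac1l\widehat{w_{12}}$; $\nu_1(\overline{w_{s,t}})=r\,\overline{w_{s,t}}$ for all other basis vectors. $\nu_k$, $2\le k\le n$: $\nu_k(\overline{w_{k-1,t}})=\overline{w_{k,t}}$ for $t\ge k+1$; $\nu_k(\overline{w_{s,k-1}})=\overline{w_{s,k}}$ for $s\le k-2$; $\nu_k(\widehat{w_{k-1,k}})=r\,\widehat{w_{k-1,k}}$; $\nu_k(w_{k-1,k})=\frac1lw_{k-1,k}$; for $t\ge k+1$: $\nu_k(\widehat{w_{k,t}})=\widehat{w_{k-1,t}}+\frac ml r^{t-k-2}w_{k-1,k}-m\,\widehat{w_{k,t}}$ and $\nu_k(w_{k,t})=w_{k-1,t}+m r^{t-k-1}w_{k-1,k}-m\,w_{k,t}$; for $s\le k-2$: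 $\nu_k(\overline{w_{s,k}})=\overline{w_{s,k-1}}+\frac{m}{l\,r^{k-s-2}}w_{k-1,k}-m\,\overline{w_{s,k}}$; $\nu_k(\overline{w_{s,t}})=r\,\overline{w_{s,t}}$ for all other basis vectors. *)

(* Defs.v *)
From HB Require Import structures.
From mathcomp Require Import all_boot all_order all_algebra.
From mathcomp Require Import boolp reals.
From mathcomp Require Import complex.
From mathcomp Require Import monalg.

Set Implicit Arguments.
Unset Strict Implicit.
Unset Printing Implicit Defensive.

Import GRing.Theory.
Local Open Scope ring_scope.
Local Open Scope quotient_scope.

(* Quotient of an algebra by the two-sided ideal generated by S. The carrier   *)
(* may be trivial, so it is given a (possibly zero) ring structure together    *)
(* with a module structure over the base field.                                *)
Section IdealQuotient.
Variables (K : fieldType) (A : lalgType K) (S : A -> Prop).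

Inductive ideal_gen : A -> Prop :=
| ideal_gen0 : ideal_gen 0
| ideal_genS a s b : S s -> ideal_gen (a * s * b)
| ideal_genD x y : ideal_gen x -> ideal_gen y -> ideal_gen (x + y).

Lemma ideal_genMl a x : ideal_gen x -> ideal_gen (a * x).
Proof.
elim=> [|b s c Ss|y z _ Hy _ Hz]; first by rewrite mulr0; apply: ideal_gen0.
- by rewrite !mulrA; apply: ideal_genS.
- by rewrite mulrDr; apply: ideal_genD.
Qed.

Lemma ideal_genMr a x : ideal_gen x -> ideal_gen (x * a).
Proof.
elim=> [|b s c Ss|y z _ Hy _ Hz]; first by rewrite mul0r; apply: ideal_gen0.
- by rewrite -mulrA; apply: ideal_genS.
- by rewrite mulrDl; apply: ideal_genD.
Qed.

Lemma ideal_genN x : ideal_gen x -> ideal_gen (- x).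
Proof. by rewrite -mulN1r; apply: ideal_genMl. Qed.

Definition ideal_rel (x y : A) : bool := `[< ideal_gen (x - y) >].

Lemma ideal_rel_equiv : equiv_class_of ideal_rel.
Proof.
split=> [x|x y|y x z /asboolP Hxy /asboolP Hyz].
- by apply/asboolP; rewrite subrr; apply: ideal_gen0.
- by apply/asboolP/asboolP => /ideal_genN; rewrite opprB.
- by apply/asboolP; rewrite -(subrK y x) -addrA; apply: ideal_genD.
Qed.

Canonical ideal_rel_equivRel := EquivRelPack ideal_rel_equiv.

Definition ideal_quotient := {eq_quot ideal_rel}.
HB.instance Definition _ := Choice.on ideal_quotient.
HB.instance Definition _ := EqQuotient.on ideal_quotient.

Local Notation Q := ideal_quotient.

Lemma ideal_quotientP (x y : A) :
  \pi_Q x = \pi_Q y <-> ideal_gen (x - y).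
Proof.
by split=> [/eqquotP /asboolP|H] //; apply/eqquotP/asboolP.
Qed.

Definition iq_opp (x : Q) : Q := \pi_Q (- repr x).
Definition iq_add (x y : Q) : Q := \pi_Q (repr x + repr y).
Definition iq_mul (x y : Q) : Q := \pi_Q (repr x * repr y).
Definition iq_scale (c : K) (x : Q) : Q := \pi_Q (c *: repr x).

Lemma ideal_quotientW (P : Q -> Prop) :
  (forall x, P (\pi_Q x)) -> forall y, P y.
Proof. by move=> HP y; rewrite -(reprK y). Qed.

Lemma iq_repr (x : A) : ideal_gen (repr (\pi_Q x) - x).
Proof. by apply/ideal_quotientP; rewrite reprK. Qed.

Lemma iq_piN (x : A) : iq_opp (\pi_Q x) = \pi_Q (- x).
Proof.
by apply/ideal_quotientP; rewrite -opprD; apply/ideal_genN/iq_repr.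
Qed.

Lemma iq_piD (x y : A) : iq_add (\pi_Q x) (\pi_Q y) = \pi_Q (x + y).
Proof.
apply/ideal_quotientP; rewrite opprD addrACA.
by apply: ideal_genD; apply: iq_repr.
Qed.

Lemma iq_piM (x y : A) : iq_mul (\pi_Q x) (\pi_Q y) = \pi_Q (x * y).
Proof.
apply/ideal_quotientP.
rewrite -(subrK (x * repr (\pi_Q y)) (_ * _)) -mulrBl -addrA -mulrBr.
by apply: ideal_genD;
  [apply/ideal_genMr/iq_repr | apply/ideal_genMl/iq_repr].
Qed.

Lemma iq_piZ c (x : A) : iq_scale c (\pi_Q x) = \pi_Q (c *: x).
Proof.
apply/ideal_quotientP.
by rewrite -scalerBr -mulr_algl; apply/ideal_genMl/iq_repr.
Qed.

Lemma iq_addA : associative iq_add.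
Proof.
by elim/ideal_quotientW=> x; elim/ideal_quotientW=> y; elim/ideal_quotientW=> z; rewrite !iq_piD addrA.
Qed.

Lemma iq_addC : commutative iq_add.
Proof. by elim/ideal_quotientW=> x; elim/ideal_quotientW=> y; rewrite !iq_piD addrC. Qed.

Lemma iq_add0 : left_id (\pi_Q 0) iq_add.
Proof. by elim/ideal_quotientW=> x; rewrite iq_piD add0r. Qed.

Lemma iq_addN : left_inverse (\pi_Q 0) iq_opp iq_add.
Proof. by elim/ideal_quotientW=> x; rewrite iq_piN iq_piD addNr. Qed.

HB.instance Definition _ :=
  GRing.isZmodule.Build Q iq_addA iq_addC iq_add0 iq_addN.

Lemma iq_mulA : associative iq_mul.
Proof.
by elim/ideal_quotientW=> x; elim/ideal_quotientW=> y; elim/ideal_quotientW=> z; rewrite !iq_piM mulrA.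
Qed.

Lemma iq_mul1 : left_id (\pi_Q 1) iq_mul.
Proof. by elim/ideal_quotientW=> x; rewrite iq_piM mul1r. Qed.

Lemma iq_mulr1 : right_id (\pi_Q 1) iq_mul.
Proof. by elim/ideal_quotientW=> x; rewrite iq_piM mulr1. Qed.

Lemma iq_mulDl : left_distributive iq_mul iq_add.
Proof.
elim/ideal_quotientW=> x; elim/ideal_quotientW=> y; elim/ideal_quotientW=> z.
by rewrite iq_piD !iq_piM iq_piD mulrDl.
Qed.

Lemma iq_mulDr : right_distributive iq_mul iq_add.
Proof.
elim/ideal_quotientW=> x; elim/ideal_quotientW=> y; elim/ideal_quotientW=> z.
by rewrite iq_piD !iq_piM iq_piD mulrDr.
Qed.

HB.instance Definition _ := GRing.Zmodule_isPzRing.Build Q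
  iq_mulA iq_mul1 iq_mulr1 iq_mulDl iq_mulDr.

Lemma iq_scaleA a b x : iq_scale a (iq_scale b x) = iq_scale (a * b) x.
Proof. by elim/ideal_quotientW: x => x; rewrite !iq_piZ scalerA. Qed.

Lemma iq_scale1 : left_id 1 iq_scale.
Proof. by elim/ideal_quotientW=> x; rewrite iq_piZ scale1r. Qed.

Lemma iq_scaleDr : right_distributive iq_scale +%R.
Proof.
move=> c; elim/ideal_quotientW=> x; elim/ideal_quotientW=> y.
have addE u v : \pi_Q u + \pi_Q v = \pi_Q (u + v) by exact: iq_piD.
by rewrite addE !iq_piZ addE scalerDr.
Qed.

Lemma iq_scaleDl x : {morph iq_scale^~ x : a b / a + b}.
Proof.
elim/ideal_quotientW: x => x a b /=.
by rewrite !iq_piZ [RHS]iq_piD scalerDl.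
Qed.

HB.instance Definition _ := GRing.Zmodule_isLmodule.Build K Q
  iq_scaleA iq_scale1 iq_scaleDr iq_scaleDl.

Definition iq_pi (x : A) : Q := \pi_Q x.

Lemma iq_pi_eq0 x : S x -> iq_pi x = 0.
Proof.
move=> Sx; apply/ideal_quotientP; rewrite subr0 -[x]mulr1 -[x]mul1r.
exact: ideal_genS.
Qed.

Lemma iq_pi_is_linear : linear iq_pi.
Proof. by move=> c x y; apply/esym; rewrite /iq_pi -iq_piD -iq_piZ. Qed.
HB.instance Definition _ := GRing.isLinear.Build K A Q _ iq_pi iq_pi_is_linear.

Lemma iq_pi_is_monoid_morphism : monoid_morphism iq_pi.
Proof. by split=> // x y; apply/esym; apply: iq_piM. Qed.
HB.instance Definition _ :=
  GRing.isMonoidMorphism.Build A Q iq_pi iq_pi_is_monoid_morphism.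

End IdealQuotient.

Section FreeAlgebra.
Variables (K : fieldType) (X : choiceType).

Definition free_algebra := {malg K[{fmonom X}]}.

Definition free_gen (x : X) : free_algebra := << fmu x >>.

End FreeAlgebra.

Inductive artin_relator (A : pzRingType) (I : eqType) (adj : rel I)
    (g : I -> A) : A -> Prop :=
| artin_braid i j : adj i j ->
    artin_relator adj g (g i * g j * g i - g j * g i * g j)
| artin_comm i j : i != j -> ~~ adj i j ->
    artin_relator adj g (g i * g j - g j * g i).

Definition D_edge (a b : nat) : bool :=
  ((a == 1) && (b == 3) || (2 <= a) && (b == a.+1))%N.

(* An element i of 'I_n stands for the node numbered i.+1.                     *)
Definition D_adj n : rel 'I_n :=
  fun i j => D_edge i.+1 j.+1 || D_edge j.+1 i.+1.

Definition A_adj n : rel 'I_n := fun i j => (i.+1 == j) || (j.+1 == i).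

Section CGWAlgebra.
Variables (K : fieldType) (n : nat) (l m : K).

(* inl i is the generator g_(i.+1) and inr i is the generator e_(i.+1).        *)
Let Fr := free_algebra K ('I_n + 'I_n)%type.
Let g (i : 'I_n) : Fr := free_gen K (inl i).
Let e (i : 'I_n) : Fr := free_gen K (inr i).

Inductive cgw_relator : Fr -> Prop :=
| cgw_rel_artin x : artin_relator (@D_adj n) g x -> cgw_relator x
| cgw_rel_quad i : cgw_relator (m *: e i - l *: (g i ^+ 2 + m *: g i - 1))
| cgw_rel_ge i : cgw_relator (g i * e i - l^-1 *: e i)
| cgw_rel_ege i j : D_adj i j -> cgw_relator (e i * g j * e i - l *: e i).

Definition cgw := ideal_quotient cgw_relator.

Definition cgw_g (i : 'I_n) : cgw := iq_pi cgw_relator (g i).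
Definition cgw_e (i : 'I_n) : cgw := iq_pi cgw_relator (e i).

End CGWAlgebra.

Section HeckeAlgebras.
Variable K : fieldType.

Section TypeD.
Variables (n : nat) (m : K).
Let Fr := free_algebra K 'I_n.
Let g (i : 'I_n) : Fr := free_gen K i.

Inductive heckeD_relator : Fr -> Prop :=
| heckeD_rel_artin x : artin_relator (@D_adj n) g x -> heckeD_relator x
| heckeD_rel_quad i : heckeD_relator (g i ^+ 2 + m *: g i - 1).

Definition heckeD := ideal_quotient heckeD_relator.
End TypeD.

(* Iwahori-Hecke algebra of Sym(n), normalized by (T_i - q)(T_i + 1) = 0.      *)
Section TypeA.
Variables (n : nat) (q : K).
Let Fr := free_algebra K 'I_n.-1.
Let T (i : 'I_n.-1) : Fr := free_gen K i.

Inductive heckeSym_relator : Fr -> Prop :=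
| heckeSym_rel_artin x : artin_relator (@A_adj n.-1) T x -> heckeSym_relator x
| heckeSym_rel_quad i : heckeSym_relator ((T i - q *: 1) * (T i + 1)).

Definition heckeSym := ideal_quotient heckeSym_relator.
End TypeA.

End HeckeAlgebras.

Section Semisimplicity.
Variable A : pzRingType.
Implicit Types I J : A -> Prop.

Definition left_ideal I :=
  [/\ I 0, forall x y, I x -> I y -> I (x + y) & forall a x, I x -> I (a * x)].

Definition minimal_left_ideal I :=
  [/\ left_ideal I, exists2 x, I x & x != 0
    & forall J, left_ideal J -> (forall x, J x -> I x) ->
        (exists2 x, J x & x != 0) -> forall x, I x -> J x].

(* The regular left module is a direct sum of simple submodules. Finitely many *)
(* summands are enough, because A has a unit.                                  *)
Definition semisimple :=
  exists k (I : 'I_k -> A -> Prop),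
    (forall i, minimal_left_ideal (I i)) /\
    (forall a, exists! x : {ffun 'I_k -> A},
       (forall i, I i (x i)) /\ a = \sum_i x i).

End Semisimplicity.

Section Representations.
Variables (K : fieldType) (A : lalgType K) (S : A -> Prop) (V : vectType K).
Local Notation Q := (ideal_quotient S).
Implicit Type rho : {linear Q -> 'End(V)}.

Definition is_representation rho :=
  rho 1 = \1%VF /\ forall a b, rho (a * b) = (rho a \o rho b)%VF.

Definition invariant rho (U : {vspace V}) :=
  forall a, (rho a @: U <= U)%VS.

Definition irreducible_rep rho :=
  fullv != 0%VS :> {vspace V} /\
  forall U, invariant rho U -> U = 0%VS \/ U = fullv.

Definition reducible_rep rho :=
  exists U, [/\ invariant rho U, U <> 0%VS & U <> fullv].

End Representations.

Section GeneratedSubfield.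
Variables (C : fieldType) (a b : C).

(* The subfield generated by a and b: in characteristic 0, this is Q(a, b).    *)
Definition subfield_gen : {pred C} :=
  fun x => `[< forall S : {pred C}, GRing.divring_closed S ->
                 a \in S -> b \in S -> x \in S >].

Lemma subfield_gen_closed : GRing.divring_closed subfield_gen.
Proof.
split=> [|x y /asboolP Hx /asboolP Hy|x y /asboolP Hx /asboolP Hy].
- by apply/asboolP=> S [].
- apply/asboolP=> S Sc Sa Sb; case: (Sc) => _ SB _.
  by apply: SB; [apply: Hx | apply: Hy].
- apply/asboolP=> S Sc Sa Sb; case: (Sc) => _ _ SV.
  by apply: SV; [apply: Hx | apply: Hy].
Qed.

HB.instance Definition _ :=
  GRing.isDivringClosed.Build C subfield_gen subfield_gen_closed.

Record Qadj := MkQadj { Qadj_val : C; Qadj_mem : Qadj_val \in subfield_gen }.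
HB.instance Definition _ := [isSub for Qadj_val].
HB.instance Definition _ := [Choice of Qadj by <:].
HB.instance Definition _ := [SubChoice_isSubIntegralDomain of Qadj by <:].
HB.instance Definition _ := [SubIntegralDomain_isSubField of Qadj by <:].

Lemma subfield_gen1 : a \in subfield_gen.
Proof. by apply/asboolP. Qed.

Lemma subfield_gen2 : b \in subfield_gen.
Proof. by apply/asboolP. Qed.

Definition Qgen1 : Qadj := MkQadj subfield_gen1.
Definition Qgen2 : Qadj := MkQadj subfield_gen2.

End GeneratedSubfield.

Section Nu.
Variables (F : fieldType) (n : nat) (l r : F).
Let m : F := r^-1 - r.

(* Basis labels: a pair i < j, and a flag that is true for the hatted vectors. *)
Definition nu_label := ({p : 'I_n * 'I_n | (p.1 < p.2)%N} * bool)%type.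

Definition nu_space := {ffun nu_label -> F^o}.

(* wvec h i j, with 1 <= i < j <= n, is w_ij (h = false) or its hatted version *)
(* (h = true). Outside that range it is 0 and it is never used.                *)
Definition wvec (h : bool) (i j : nat) : nu_space :=
  [ffun b : nu_label =>
     [&& b.2 == h, (val b.1).1.+1 == i & (val b.1).2.+1 == j]%:R].

Local Notation w := (wvec false).
Local Notation wh := (wvec true).

Definition nu1_img (h : bool) (i j : nat) : nu_space :=
  if (3 <= i)%N then
    if h then
      (m * r ^ (j%:Z - 5)) *: (wh 1 i - w 1 i)
      + (m * r ^ (j%:Z - 4)) *: (wh 2 i - w 2 i)
      + (m * r ^ (i%:Z - 3)) *: (wh 1 j - w 1 j)
      + (m * r ^ (i%:Z - 2)) *: (wh 2 j - w 2 j)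
      + (m ^+ 2 * (r ^ (i%:Z + j%:Z - 8) + r ^ (i%:Z + j%:Z - 6)))
          *: (wh 1 2 - w 1 2)
      + r *: wh i j
    else r *: w i j
  else if i == 2 then
    if h then w 1 j + (m * r ^ (j%:Z - 3)) *: w 1 2 - m *: w 2 j
    else wh 1 j + (m * r ^ (j%:Z - 3)) *: wh 1 2 - m *: w 2 j
  else if (3 <= j)%N then
    if h then w 2 j
    else wh 2 j + (m * r ^ (j%:Z - 4)) *: (wh 1 2 - w 1 2)
         + m *: (wh 1 j - w 1 j)
  else if h then l^-1 *: wh 1 2 else r *: w 1 2.

Definition nuk_img (k : nat) (h : bool) (s t : nat) : nu_space :=
  if (s == k.-1) && (t == k) then
    if h then r *: wh s t else l^-1 *: w s t
  else if s == k.-1 then wvec h k t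
  else if t == k.-1 then wvec h s k
  else if s == k then
    if h then
      wh k.-1 t + (m / l * r ^ (t%:Z - k%:Z - 2)) *: w k.-1 k - m *: wh k t
    else
      w k.-1 t + (m * r ^ (t%:Z - k%:Z - 1)) *: w k.-1 k - m *: w k t
  else if t == k then
    wvec h s k.-1 + (m / (l * r ^ (k%:Z - s%:Z - 2))) *: w k.-1 k
    - m *: wvec h s k
  else r *: wvec h s t.

Definition nu_img (k : nat) : bool -> nat -> nat -> nu_space :=
  if k == 1 then nu1_img else nuk_img k.

(* The representation g_k |-> nu_k, determined by the action on the basis.     *)
Definition is_nu (rho : {linear cgw n l m -> 'End(nu_space)}) : Prop :=
  is_representation rho /\
  forall (k : 'I_n) (h : bool) (i j : nat), (1 <= i < j)%N -> (j <= n)%N ->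
    rho (cgw_g l m k) (wvec h i j) = nu_img k.+1 h i j.

End Nu.

Definition special_values (C : fieldType) (n : nat) (r : C) : seq C :=
  [:: r ^- (4 * n - 7); r ^- (2 * n - 7); - r ^- (2 * n - 5);
      r ^+ 3; r^-1; - r ^+ 3].

(* Main.v *)
(** Let [V] be the space of [nu] and let [root k] be the basis vector on which
    [g k] acts as [1/l]. The operator [quad k = g k ^ 2 + m g k - 1] has rank one,
    its image is the line of [root k], and any two roots are conjugate. Hence a
    stable subspace is either [V] or killed by all the [quad k]. On such a proper
    subspace [g k] has eigenvalues [r] and [- 1/r] only, so that products like
    [(g 2 - r) (g 4 - r)] have an image supported on few coordinates. One by one,
    the equations [quad k = 0] force these products, then [g n - r], then all
    vectors to vanish, unless [l] is one of the six special values.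

    Each special value has an explicit proper stable subspace: the common kernel
    of functionals permuted by the action ([r^3], [- r^3], [1/r]), a line fixed up
    to the scalar [r] ([r^(7-4n)]), or [n] vectors spanning a quotient of a
    reflection representation ([r^(7-2n)], [- r^(5-2n)]).

    For part (ii), let [A] be the algebra over [Q(l, m)]. As [Q(l, r)] equals
    [Q(l, m) + r Q(l, m)] and [g 2] acts as [r] on [w = root 1], the module [V]
    over [Q(l, r)] is [A w]. Let [P] be a proper stable subspace and suppose that
    [A] is semisimple: the left ideal [I] of those [a] with [a w] in [P] has a
    complement [J]. The multiple [b] of [e_1 g_3] that fixes [w] kills [P]. Writing
    [1 = i + j] with [i] in [I] and [j] in [J], the element [c = b j] of [J] fixes
    [w]. For [a] in [I] this gives [a c] in [I] and in [J], so [a c = 0] and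
    [a w = a c w = 0]. Hence [P = 0]. *)
Require Import Defs.
From HB Require Import structures.
From mathcomp Require Import all_boot all_order all_algebra.
From mathcomp Require Import boolp reals complex monalg.
From mathcomp Require Import zify ring.

Set Implicit Arguments.
Unset Strict Implicit.
Unset Printing Implicit Defensive.
Import GRing.Theory.
Local Open Scope ring_scope.

(** The special values are the zeros of three determinants. On a proper stable subspace each
    [quad k u = 0] amounts to one linear equation in the coordinates of [u], read at the root. Nodes
    2 and 4 commute and are both adjacent to node 3; a vector in the image of [(g 2 - r) (g 4 - r)]
    has two free coordinates, and the equations of node 3 have determinant
    [(l + r^3)^2 (l - 1/r) (l - r^3)] up to a unit. In the image of [g n - r] two coordinates
    survive again, with determinant [(l + r^3) (l r^(2n-6) - r) (l r^(2n-6) + 1/r)]. A vector scaled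
    by [r] at every node has one, with factor [l r^(4n-7) - 1]. The stable line and the last
    reflection vector solve the last two systems where they degenerate.

    In (ii) the obstacle is that [r] may lie outside [Q(l, m)]: [V] is a space over [Q(l, r)] on
    which an algebra over the smaller field acts. So words in the generators are evaluated through a
    ring morphism of scalars, and the scalar [r] has to be produced by an element of the algebra. *)

(** * Linear maps on [V] and its coordinates *)

Section LinearExtension.
Variables (F : fieldType) (n : nat).
Local Notation V := (nu_space F n).

Section Ext.
Variable W : lmodType F.
Implicit Type f : bool -> nat -> nat -> W.

(** Handing the labels to [f] as natural numbers from 1 on keeps ordinals out of all later index
    arithmetic. *)
Definition lin_ext f (u : V) : W :=
  \sum_(b : nu_label n) (u b : F) *: f b.2 (val b.1).1.+1 (val b.1).2.+1.

Lemma lin_ext_is_linear f : linear (lin_ext f).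
Proof.
move=> c u v; rewrite /lin_ext scaler_sumr -big_split /=.
by apply: eq_bigr => b _; rewrite !ffunE scalerDl scalerA.
Qed.
HB.instance Definition _ f :=
  GRing.isLinear.Build F V W _ (lin_ext f) (lin_ext_is_linear f).

Lemma lin_ext_wvec f h i j : (0 < i < j)%N -> (j <= n)%N ->
  lin_ext f (wvec F n h i j) = f h i j.
Proof.
case: i => [|i] //; case: j => [|j] //; rewrite ltnS => /andP[_ ij] jn.
have i_n : (i < n)%N by apply: leq_trans jn; apply: ltnW.
pose p : {p : 'I_n * 'I_n | (p.1 < p.2)%N} :=
  exist _ (Ordinal i_n, Ordinal jn) ij.
rewrite /lin_ext (bigD1 (p, h)) //= ffunE /= !eqxx scale1r big1 ?addr0 //.
case=> -[[a c] /= ac] h' /= neq; rewrite ffunE /=.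
case: eqP => [eh|]; last by rewrite scale0r.
case: eqP => [[ea]|]; last by rewrite scale0r.
case: eqP => [[ec]|]; last by rewrite scale0r.
case/eqP: neq; rewrite -eh; congr (_, _); apply: val_inj => /=.
by congr (_, _); apply: val_inj.
Qed.
End Ext.

Lemma nu_space_ind (P : V -> Prop) :
  P 0 -> (forall u v, P u -> P v -> P (u + v)) ->
  (forall c u, P u -> P (c *: u)) ->
  (forall h i j, (0 < i < j)%N -> (j <= n)%N -> P (wvec F n h i j)) ->
  forall u, P u.
Proof.
move=> P0 PD PZ Pw u.
have -> : u = \sum_(b : nu_label n)
    (u b : F) *: wvec F n b.2 (val b.1).1.+1 (val b.1).2.+1.
  apply/ffunP=> b; rewrite sum_ffunE (bigD1 b) //= !ffunE !eqxx /=.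
  rewrite /GRing.scale /= mulr1 big1 ?addr0 // => c neq.
  rewrite !ffunE /GRing.scale /=; case: eqP => [eh|]; last by rewrite mulr0.
  case: eqP => [[ea]|]; last by rewrite mulr0.
  case: eqP => [[ec]|]; last by rewrite mulr0.
  case/eqP: neq; case: b c eh ea ec => [[[b1 b2] b12] hb] [[[c1 c2] c12] hc] /=.
  move=> -> ea ec; congr (_, _); apply: val_inj => /=.
  by congr (_, _); apply: val_inj.
by elim/big_rec: _ => // b v _ Pv; apply/PD/Pv/PZ/Pw => //=; case: b => -[].
Qed.

Lemma lfun_nuP (W : vectType F) (f g : 'Hom(V, W)) :
  (forall h i j, (0 < i < j)%N -> (j <= n)%N ->
     f (wvec F n h i j) = g (wvec F n h i j)) -> f = g.
Proof.
move=> fg; apply/lfunP; apply: nu_space_ind; rewrite ?linear0 //.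
- by move=> u v fu fv; rewrite !linearD /= fu fv.
- by move=> c u fgu; rewrite !linearZ /= fgu.
Qed.

(** A coordinate as a linear functional: unlike evaluation at a label it makes sense for all natural
    indices, and it is 0 off the range. *)
Definition nucoef (u : V) (h : bool) (i j : nat) : F :=
  lin_ext (W := F^o)
    (fun h' i' j' => ([&& h' == h, i' == i & j' == j])%:R) u.

Lemma nucoefD u v h i j : nucoef (u + v) h i j = nucoef u h i j + nucoef v h i j.
Proof. exact: (linearD (lin_ext (W := F^o) _)). Qed.
Lemma nucoefB u v h i j : nucoef (u - v) h i j = nucoef u h i j - nucoef v h i j.
Proof. exact: (linearB (lin_ext (W := F^o) _)). Qed.
Lemma nucoefZ c u h i j : nucoef (c *: u) h i j = c * nucoef u h i j.
Proof. by rewrite /nucoef linearZ. Qed.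
Lemma nucoef0 h i j : nucoef 0 h i j = 0.
Proof. exact: (linear0 (lin_ext (W := F^o) _)). Qed.

Lemma nucoef_wvec h' i' j' h i j : (0 < i' < j')%N -> (j' <= n)%N ->
  nucoef (wvec F n h' i' j') h i j = ([&& h' == h, i' == i & j' == j])%:R.
Proof. by move=> ? ?; rewrite /nucoef lin_ext_wvec. Qed.

Lemma nucoefE u (b : nu_label n) :
  nucoef u b.2 (val b.1).1.+1 (val b.1).2.+1 = u b.
Proof.
elim/nu_space_ind: u => [|u v Hu Hv|c u Hu|h i j ij jn].
- by rewrite nucoef0 ffunE.
- by rewrite nucoefD ffunE Hu Hv.
- by rewrite nucoefZ ffunE Hu.
rewrite nucoef_wvec // ffunE [h == _]eq_sym [i == _]eq_sym [j == _]eq_sym.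
by [].
Qed.

Lemma nucoefP u v :
  (forall h i j, (0 < i < j)%N -> (j <= n)%N ->
     nucoef u h i j = nucoef v h i j) -> u = v.
Proof.
move=> uv; apply/ffunP=> b; rewrite -!nucoefE uv //=.
by case: b => -[].
Qed.

End LinearExtension.

Opaque nucoef.

(** * The action of the generators *)

Section NuAction.
Variables (F : fieldType) (n : nat) (l r : F).
Hypotheses (n4 : (4 <= n)%N) (l0 : l != 0) (r0 : r != 0).
Local Notation V := (nu_space F n).
Local Notation m := (r^-1 - r).
Local Notation wvec := (wvec F n).
Local Notation w := (wvec false).
Local Notation wh := (wvec true).

Definition nuop (k : nat) : 'End(V) := linfun (lin_ext (nu_img n l r k)).

Lemma nuop_wvec k h i j : (0 < i < j)%N -> (j <= n)%N ->
  nuop k (wvec h i j) = nu_img n l r k h i j.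
Proof. by move=> ij jn; rewrite lfunE /= lin_ext_wvec. Qed.

Let rX i : r ^+ i != 0. Proof. exact: expf_neq0. Qed.

(** Integer exponents become quotients of natural powers, a form that [field] can treat. *)
Lemma exprz_pn (i j : nat) : r ^ (i%:Z - j%:Z) = r ^+ i / r ^+ j.
Proof. by rewrite expfzDr // -exprnP exprnN. Qed.

Section TypeANodes.
Variable k : nat.
Hypothesis k0 : (0 < k)%N.
Local Notation G := (nuop k.+1).

Lemma nuS_simple h : (k < n)%N ->
  G (wvec h k k.+1) = (if h then r else l^-1) *: wvec h k k.+1.
Proof.
move=> kn; rewrite nuop_wvec ?k0 ?ltnSn // /nu_img eqSS (gtn_eqF k0).
by rewrite /nuk_img /= !eqxx /=; case: h.
Qed.

Lemma nuS_left h t : (k.+1 < t)%N -> (t <= n)%N ->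
  G (wvec h k t) = wvec h k.+1 t.
Proof.
move=> kt tn; rewrite nuop_wvec ?k0 //; last by apply: ltnW.
by rewrite /nu_img eqSS (gtn_eqF k0) /nuk_img /= eqxx (gtn_eqF kt).
Qed.

Lemma nuS_right h s : (0 < s < k)%N -> (k < n)%N ->
  G (wvec h s k) = wvec h s k.+1.
Proof.
move=> /andP[s0 sk] kn; rewrite nuop_wvec ?s0 //; last by apply: ltnW.
rewrite /nu_img eqSS (gtn_eqF k0) /nuk_img /= eqxx (ltn_eqF sk) /=.
by [].
Qed.

Lemma nuS_leftV h t : (k.+1 < t)%N -> (t <= n)%N ->
  G (wvec h k.+1 t) = wvec h k t
    + ((if h then m / l / r ^+ 3 else m / r ^+ 2) * (r ^+ t / r ^+ k)) *: w k k.+1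
    - m *: wvec h k.+1 t.
Proof.
move=> kt tn; rewrite nuop_wvec //.
rewrite /nu_img eqSS (gtn_eqF k0) /nuk_img /= (gtn_eqF (ltnSn k)) /=.
rewrite (gtn_eqF (ltnW kt)) eqxx.
have -> : t%:Z - k.+1%:Z - 2 = t%:Z - (k + 3)%:Z by lia.
have -> : t%:Z - k.+1%:Z - 1 = t%:Z - (k + 2)%:Z by lia.
rewrite !exprz_pn !exprD; case: h; do 2 congr (_ + _); congr (_ *: _); field.
  by rewrite ?rX ?l0 ?r0.
by rewrite ?rX ?l0 ?r0.
Qed.

Lemma nuS_rightV h s : (0 < s < k)%N -> (k < n)%N ->
  G (wvec h s k.+1) = wvec h s k
    + (m / l * r * (r ^+ s / r ^+ k)) *: w k k.+1
    - m *: wvec h s k.+1.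
Proof.
move=> /andP[s0 sk] kn; rewrite nuop_wvec; try lia.
rewrite /nu_img eqSS (gtn_eqF k0) /nuk_img /= (ltn_eqF sk) /=.
rewrite (gtn_eqF (ltnSn k)) (ltn_eqF (ltnW sk : (s < k.+1)%N)) eqxx.
have -> : k.+1%:Z - s%:Z - 2 = k.+1%:Z - (s + 2)%:Z by lia.
rewrite !exprz_pn !exprD exprS; do 2 congr (_ + _); congr (_ *: _); field.
by rewrite ?rX ?l0 ?r0.
Qed.

Lemma nuS_other h s t : (0 < s < t)%N -> (t <= n)%N ->
  s != k -> s != k.+1 -> t != k -> t != k.+1 ->
  G (wvec h s t) = r *: wvec h s t.
Proof.
move=> st tn sk sk1 tk tk1; rewrite nuop_wvec //.
rewrite /nu_img eqSS (gtn_eqF k0) /nuk_img /=.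
by rewrite (negPf sk) (negPf sk1) (negPf tk) (negPf tk1).
Qed.

End TypeANodes.

Section ForkNode.
Local Notation G := (nuop 1).

Lemma nu1_h12 : G (wh 1 2) = l^-1 *: wh 1 2.
Proof. by rewrite nuop_wvec //; lia. Qed.

Lemma nu1_w12 : G (w 1 2) = r *: w 1 2.
Proof. by rewrite nuop_wvec //; lia. Qed.

Lemma nu1_h1 j : (2 < j)%N -> (j <= n)%N -> G (wh 1 j) = w 2 j.
Proof. by move=> j2 jn; rewrite nuop_wvec ?(ltnW j2) // /nu_img /nu1_img /= j2. Qed.

Lemma nu1_w1 j : (2 < j)%N -> (j <= n)%N ->
  G (w 1 j) = wh 2 j + (m / r ^+ 4 * r ^+ j) *: (wh 1 2 - w 1 2)
              + m *: (wh 1 j - w 1 j).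
Proof.
move=> j2 jn; rewrite nuop_wvec ?(ltnW j2) // /nu_img /nu1_img /= j2.
by rewrite exprz_pn [in RHS]mulrAC mulrA.
Qed.

Lemma nu1_h2 j : (2 < j)%N -> (j <= n)%N ->
  G (wh 2 j) = w 1 j + (m / r ^+ 3 * r ^+ j) *: w 1 2 - m *: w 2 j.
Proof.
move=> j2 jn; rewrite nuop_wvec // /nu_img /nu1_img /=.
by rewrite exprz_pn [in RHS]mulrAC mulrA.
Qed.

Lemma nu1_w2 j : (2 < j)%N -> (j <= n)%N ->
  G (w 2 j) = wh 1 j + (m / r ^+ 3 * r ^+ j) *: wh 1 2 - m *: w 2 j.
Proof.
move=> j2 jn; rewrite nuop_wvec // /nu_img /nu1_img /=.
by rewrite exprz_pn [in RHS]mulrAC mulrA.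
Qed.

Lemma nu1_h i j : (2 < i < j)%N -> (j <= n)%N ->
  G (wh i j) = (m / r ^+ 5 * r ^+ j) *: (wh 1 i - w 1 i)
      + (m / r ^+ 4 * r ^+ j) *: (wh 2 i - w 2 i)
      + (m / r ^+ 3 * r ^+ i) *: (wh 1 j - w 1 j)
      + (m / r ^+ 2 * r ^+ i) *: (wh 2 j - w 2 j)
      + (m ^+ 2 * (1 + r ^+ 2) / r ^+ 8 * (r ^+ i * r ^+ j)) *: (wh 1 2 - w 1 2)
      + r *: wh i j.
Proof.
move=> /andP[i2 ij] jn; rewrite nuop_wvec ?ij ?andbT //; last by apply: leq_trans i2.
rewrite /nu_img /nu1_img /= i2.
have -> : i%:Z + j%:Z - 8 = (i + j)%:Z - 8 by lia.
have -> : i%:Z + j%:Z - 6 = (i + j)%:Z - 6 by lia.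
rewrite !exprz_pn (exprD r i j).
by repeat congr (_ + _); congr (_ *: _); field; rewrite ?rX ?r0.
Qed.

Lemma nu1_w i j : (2 < i < j)%N -> (j <= n)%N -> G (w i j) = r *: w i j.
Proof.
move=> /andP[i2 ij] jn; rewrite nuop_wvec ?ij ?andbT //; last by apply: leq_trans i2.
by rewrite /nu_img /nu1_img /= i2.
Qed.

End ForkNode.
End NuAction.

(* Rewriting with the concrete operators makes unification unfold them, so the *)
(* relations are checked for opaque [g] and [w] with the same action.          *)
Record nu_action (F : fieldType) (T : finType) (n : nat) (l r : F)
    (g : nat -> {ffun T -> F^o} -> {ffun T -> F^o})
    (w : bool -> nat -> nat -> {ffun T -> F^o}) : Prop := NuAction {
  actD : forall k u v, g k (u + v) = g k u + g k v;
  actZ : forall k c u, g k (c *: u) = c *: g k u;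
  act_simple : forall k h, (0 < k)%N -> (k < n)%N ->
    g k.+1 (w h k k.+1) = (if h then r else l^-1) *: w h k k.+1;
  act_left : forall k h t, (0 < k)%N -> (k.+1 < t)%N -> (t <= n)%N ->
    g k.+1 (w h k t) = w h k.+1 t;
  act_right : forall k h s, (0 < s < k)%N -> (k < n)%N ->
    g k.+1 (w h s k) = w h s k.+1;
  act_leftV : forall k h t, (0 < k)%N -> (k.+1 < t)%N -> (t <= n)%N ->
    g k.+1 (w h k.+1 t) = w h k t
      + ((if h then (r^-1 - r) / l / r ^+ 3 else (r^-1 - r) / r ^+ 2)
         * (r ^+ t / r ^+ k)) *: w false k k.+1
      - (r^-1 - r) *: w h k.+1 t;
  act_rightV : forall k h s, (0 < s < k)%N -> (k < n)%N ->
    g k.+1 (w h s k.+1) = w h s k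
      + ((r^-1 - r) / l * r * (r ^+ s / r ^+ k)) *: w false k k.+1
      - (r^-1 - r) *: w h s k.+1;
  act_other : forall k h s t, (0 < k)%N -> (0 < s < t)%N -> (t <= n)%N ->
    s != k -> s != k.+1 -> t != k -> t != k.+1 ->
    g k.+1 (w h s t) = r *: w h s t;
  act1_h12 : g 1%N (w true 1%N 2%N) = l^-1 *: w true 1%N 2%N;
  act1_w12 : g 1%N (w false 1%N 2%N) = r *: w false 1%N 2%N;
  act1_h1 : forall j, (2 < j)%N -> (j <= n)%N -> g 1%N (w true 1%N j) = w false 2%N j;
  act1_w1 : forall j, (2 < j)%N -> (j <= n)%N ->
    g 1%N (w false 1%N j) = w true 2%N j
      + ((r^-1 - r) / r ^+ 4 * r ^+ j) *: (w true 1%N 2%N - w false 1%N 2%N)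
      + (r^-1 - r) *: (w true 1%N j - w false 1%N j);
  act1_h2 : forall j, (2 < j)%N -> (j <= n)%N ->
    g 1%N (w true 2%N j) = w false 1%N j
      + ((r^-1 - r) / r ^+ 3 * r ^+ j) *: w false 1%N 2%N - (r^-1 - r) *: w false 2%N j;
  act1_w2 : forall j, (2 < j)%N -> (j <= n)%N ->
    g 1%N (w false 2%N j) = w true 1%N j
      + ((r^-1 - r) / r ^+ 3 * r ^+ j) *: w true 1%N 2%N - (r^-1 - r) *: w false 2%N j;
  act1_h : forall i j, (2 < i < j)%N -> (j <= n)%N ->
    g 1%N (w true i j) = ((r^-1 - r) / r ^+ 5 * r ^+ j) *: (w true 1%N i - w false 1%N i)
      + ((r^-1 - r) / r ^+ 4 * r ^+ j) *: (w true 2%N i - w false 2%N i)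
      + ((r^-1 - r) / r ^+ 3 * r ^+ i) *: (w true 1%N j - w false 1%N j)
      + ((r^-1 - r) / r ^+ 2 * r ^+ i) *: (w true 2%N j - w false 2%N j)
      + ((r^-1 - r) ^+ 2 * (1 + r ^+ 2) / r ^+ 8 * (r ^+ i * r ^+ j))
          *: (w true 1%N 2%N - w false 1%N 2%N)
      + r *: w true i j;
  act1_w : forall i j, (2 < i < j)%N -> (j <= n)%N ->
    g 1%N (w false i j) = r *: w false i j }.

Lemma nuop_action (F : fieldType) n (l r : F) :
  (4 <= n)%N -> l != 0 -> r != 0 ->
  nu_action n l r (fun k u => nuop n l r k u) (@wvec F n).
Proof.
move=> n4 l0 r0; split; move=> *.
- by rewrite linearD.
- by rewrite linearZ.
- exact: nuS_simple.
- exact: nuS_left.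
- by apply: nuS_right; lia.
- exact: nuS_leftV.
- by apply: nuS_rightV => //; lia.
- exact: nuS_other.
- exact: nu1_h12.
- exact: nu1_w12.
- exact: nu1_h1.
- exact: nu1_w1.
- exact: nu1_h2.
- exact: nu1_w2.
- exact: nu1_h.
- exact: nu1_w.
Qed.

Lemma actN (F : fieldType) (T : finType) n l r g w :
  @nu_action F T n l r g w -> forall k u, g k (- u) = - g k u.
Proof. by move=> gP k u; rewrite -scaleN1r (actZ gP) scaleN1r. Qed.

Section Evaluation.
Variables (F : fieldType) (T : finType).
Implicit Types (u v : {ffun T -> F^o}) (b : T).
Definition ev b u : F := u b.
Lemma evD b u v : ev b (u + v) = ev b u + ev b v. Proof. by rewrite /ev ffunE. Qed.
Lemma evN b u : ev b (- u) = - ev b u. Proof. by rewrite /ev ffunE. Qed.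
Lemma evZ b c u : ev b (c *: u) = c * ev b u. Proof. by rewrite /ev ffunE. Qed.
Lemma ev_inj b u v : ev b u = ev b v -> u b = v b. Proof. by []. Qed.

Lemma ev_eq b u v x y : ev b u = x -> ev b v = y -> x = y -> u b = v b.
Proof. by rewrite /ev => -> ->. Qed.
Lemma evD_eq b u v x y : ev b u = x -> ev b v = y -> ev b (u + v) = x + y.
Proof. by move=> <- <-; apply: evD. Qed.
Lemma evN_eq b u x : ev b u = x -> ev b (- u) = - x.
Proof. by move=> <-; apply: evN. Qed.
Lemma evZ_eq b c u x : ev b u = x -> ev b (c *: u) = c * x.
Proof. by move=> <-; apply: evZ. Qed.
End Evaluation.

Ltac ev_expand :=
  lazymatch goal with
  | |- ev _ (_ + _) = _ => eapply evD_eq; ev_expand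
  | |- ev _ (- _) = _ => eapply evN_eq; ev_expand
  | |- ev _ (_ *: _) = _ => eapply evZ_eq; ev_expand
  | _ => reflexivity
  end.

Ltac nat_lia :=
  repeat match goal with
  | H : is_true (leq _ _) |- _ => revert H
  | H : is_true (_ && _) |- _ => revert H
  | H : is_true (negb (@eq_op _ ?x _)) |- _ =>
      lazymatch type of x with nat => revert H end
  | H : is_true (@eq_op _ ?x _) |- _ =>
      lazymatch type of x with nat => revert H end
  | H : @eq nat _ _ |- _ => revert H
  | H : @eq bool _ _ |- _ => revert H
  end; clear; intros; lia.

Ltac side := first [assumption | nat_lia].

Ltac nu_step gP :=
  lazymatch type of gP with nu_action _ _ _ ?g ?w =>
  match goal with
  | |- context [g 1%N (w true 1%N 2%N)] => rewrite (act1_h12 gP)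
  | |- context [g 1%N (w false 1%N 2%N)] => rewrite (act1_w12 gP)
  | |- context [g 1%N (w true 1%N ?t)] => rewrite (@act1_h1 _ _ _ _ _ _ _ gP t); [|side..]
  | |- context [g 1%N (w false 1%N ?t)] => rewrite (@act1_w1 _ _ _ _ _ _ _ gP t); [|side..]
  | |- context [g 1%N (w true 2%N ?t)] => rewrite (@act1_h2 _ _ _ _ _ _ _ gP t); [|side..]
  | |- context [g 1%N (w false 2%N ?t)] => rewrite (@act1_w2 _ _ _ _ _ _ _ gP t); [|side..]
  | |- context [g 1%N (w true ?s ?t)] => rewrite (@act1_h _ _ _ _ _ _ _ gP s t); [|side..]
  | |- context [g 1%N (w false ?s ?t)] => rewrite (@act1_w _ _ _ _ _ _ _ gP s t); [|side..]
  | |- context [g ?k.+1 (w ?h ?k ?k.+1)] =>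
      rewrite (@act_simple _ _ _ _ _ _ _ gP k h); [|side..]
  | |- context [g ?k.+1 (w ?h ?k ?t)] =>
      rewrite (@act_left _ _ _ _ _ _ _ gP k h t); [|side..]
  | |- context [g ?k.+1 (w ?h ?s ?k)] =>
      rewrite (@act_right _ _ _ _ _ _ _ gP k h s); [|side..]
  | |- context [g ?k.+1 (w ?h ?k.+1 ?t)] =>
      rewrite (@act_leftV _ _ _ _ _ _ _ gP k h t); [|side..]
  | |- context [g ?k.+1 (w ?h ?s ?k.+1)] =>
      rewrite (@act_rightV _ _ _ _ _ _ _ gP k h s); [|side..]
  | |- context [g ?k.+1 (w ?h ?s ?t)] =>
      rewrite (@act_other _ _ _ _ _ _ _ gP k h s t); [|side..]
  end end.

(** Once the basis vectors are generalized to arbitrary ones, an identity between linear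
    combinations is tested at a point and becomes a rational identity in the scalars. *)
Ltac nu_vec gP :=
  lazymatch type of gP with nu_action _ _ _ ?g ?w =>
  repeat match goal with |- context [w ?h ?i ?j] =>
    let v := fresh "v" in generalize (w h i j) => v end end;
  let b := fresh "b" in
  apply/ffunP => b; eapply ev_eq; [ev_expand | ev_expand |];
  rewrite ?exprS ?expr0 /=; field;
  repeat (apply/andP; split); first [done | assumption | apply: expf_neq0; assumption].

Ltac nu_act gP :=
  repeat (progress (repeat nu_step gP; rewrite ?(actD gP, actN gP, actZ gP))).

Ltac split_at x y := case: (eqVneq x y) => [?|?]; [subst x|].

Ltac nu_check gP := solve [exfalso; nat_lia | nu_act gP; nu_vec gP].

(** * Relations between the generators, checked on basis vectors *)

Section Relations.
Variables (F : fieldType) (T : finType) (n : nat) (l r : F).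
Variables (g : nat -> {ffun T -> F^o} -> {ffun T -> F^o}).
Variable (w : bool -> nat -> nat -> {ffun T -> F^o}).
Hypotheses (n4 : (4 <= n)%N) (l0 : l != 0) (r0 : r != 0).
Hypothesis gP : nu_action n l r g w.
Local Notation m := (r^-1 - r).

Lemma act_braid_wvec k h s t : (0 < k)%N -> (k.+1 < n)%N ->
  (0 < s < t)%N -> (t <= n)%N ->
  g k.+1 (g k.+2 (g k.+1 (w h s t))) = g k.+2 (g k.+1 (g k.+2 (w h s t))).
Proof.
move=> k0 kn st tn; split_at s k; try split_at s k.+1; try split_at s k.+2;
  try split_at t k; try split_at t k.+1; try split_at t k.+2;
  case: h; nu_check gP.
Qed.

Lemma act_comm_wvec k k' h s t : (0 < k)%N -> (k.+1 < k')%N -> (k' < n)%N ->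
  (0 < s < t)%N -> (t <= n)%N ->
  g k.+1 (g k'.+1 (w h s t)) = g k'.+1 (g k.+1 (w h s t)).
Proof.
move=> k0 kk' kn st tn; split_at s k; try split_at s k.+1; try split_at s k';
  try split_at s k'.+1; try split_at t k; try split_at t k.+1;
  try split_at t k'; try split_at t k'.+1; case: h; nu_check gP.
Qed.

Lemma act1_comm_wvec k h s t : k = 1%N \/ (2 < k)%N -> (k < n)%N ->
  (0 < s < t)%N -> (t <= n)%N ->
  g 1%N (g k.+1 (w h s t)) = g k.+1 (g 1%N (w h s t)).
Proof.
case=> [->|k2] kn st tn.
  by split_at s 1%N; try split_at s 2%N; try split_at t 2%N; case: h; nu_check gP.
by split_at s 1%N; try split_at s 2%N; try split_at s k; try split_at s k.+1;
  try split_at t 2%N; try split_at t k; try split_at t k.+1; case: h; nu_check gP.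
Qed.

Lemma act1_braid_wvec h s t : (0 < s < t)%N -> (t <= n)%N ->
  g 1%N (g 3%N (g 1%N (w h s t))) = g 3%N (g 1%N (g 3%N (w h s t))).
Proof.
move=> st tn; split_at s 1%N; try split_at s 2%N; try split_at s 3%N;
  try split_at t 2%N; try split_at t 3%N; case: h; nu_check gP.
Qed.

Definition act_quad k u := g k (g k u) + m *: g k u - u.

Lemma act_quadD k u v : act_quad k (u + v) = act_quad k u + act_quad k v.
Proof.
rewrite /act_quad !(actD gP) scalerDr opprD -!addrA; congr (_ + _).
by rewrite ![_ + (g k (g k v) + _)]addrCA; congr (_ + _); rewrite addrA addrACA -!addrA.
Qed.

Lemma act_quadZ k c u : act_quad k (c *: u) = c *: act_quad k u.
Proof. by rewrite /act_quad !(actZ gP) scalerBr scalerDr !scalerA mulrC. Qed.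

(** The basis matches the positive roots of type D: [w_ij] stands for [e_j - e_i] and the hatted
    vector for [e_i + e_j]. These are the simple roots, the fork giving [e_1 + e_2]. *)
Definition act_root k := if k == 1%N then w true 1%N 2%N else w false k.-1 k.

(** Modulo the root vector, [g k] satisfies the Hecke relation [(g k - r) (g k + 1/r) = 0]; the
    witness [c] is the multiple of the root that is left over. *)
Lemma act_quad_wvec k h s t : (0 < k <= n)%N -> (0 < s < t)%N -> (t <= n)%N ->
  exists c, act_quad k (w h s t) = c *: act_root k.
Proof.
case: k => // -[|k] kn st tn; rewrite /act_quad /act_root /=.
  split_at s 1%N; last split_at s 2%N; first split_at t 2%N; case: h.
  - by exists (l^-1 ^+ 2 + m * l^-1 - 1); nu_check gP.
  - by exists 0; nu_check gP.
  - by exists (m / r ^+ 3 * r ^+ t); nu_check gP.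
  - by exists (m / r ^+ 4 / l * r ^+ t); nu_check gP.
  - by exists (m / r ^+ 2 * r ^+ t); nu_check gP.
  - by exists (m / r ^+ 3 / l * r ^+ t); nu_check gP.
  - by exists (m ^+ 2 / r ^+ 8 * (r ^+ s * r ^+ t) * ((1 + r ^+ 2) / l - r - r ^+ 3)); nu_check gP.
  - by exists 0; nu_check gP.
split_at s k.+1; last split_at s k.+2.
- split_at t k.+2; case: h.
  + by exists 0; nu_check gP.
  + by exists (l^-1 ^+ 2 + m * l^-1 - 1); nu_check gP.
  + by exists (m / l / r ^+ 3 * (r ^+ t / r ^+ k.+1)); nu_check gP.
  + by exists (m / r ^+ 2 * (r ^+ t / r ^+ k.+1)); nu_check gP.
- case: h.
  + by exists (m / l ^+ 2 / r ^+ 3 * (r ^+ t / r ^+ k.+1)); nu_check gP.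
  + by exists (m / l / r ^+ 2 * (r ^+ t / r ^+ k.+1)); nu_check gP.
split_at t k.+1.
  by exists (m / l * r * (r ^+ s / r ^+ k.+1)); nu_check gP.
split_at t k.+2.
  by exists (m / l ^+ 2 * r * (r ^+ s / r ^+ k.+1)); nu_check gP.
by exists 0; nu_check gP.
Qed.

Lemma act_rootE k : (0 < k <= n)%N -> g k (act_root k) = l^-1 *: act_root k.
Proof. by case: k => // -[|k] kn; rewrite /act_root /=; nu_act gP. Qed.

(** The first identity lets adjacent roots generate each other, [m / l] being nonzero in the
    applications. The second is [e_i g_j e_i = l e_i] read on the line of the root, with
    [e_i = (l / m) quad i]. *)
Lemma act_quad_left_root k : (1 < k)%N -> (k < n)%N ->
  act_quad k (act_root k.+1) = (m / l) *: act_root k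
  /\ act_quad k (g k.+1 (act_root k)) = m *: act_root k.
Proof.
case: k => // -[|k] // k1 kn; rewrite /act_quad /act_root /=.
by split; nu_check gP.
Qed.

Lemma act_quad_right_root k : (1 < k)%N -> (k < n)%N ->
  act_quad k.+1 (act_root k) = (m / l) *: act_root k.+1
  /\ act_quad k.+1 (g k (act_root k.+1)) = m *: act_root k.+1.
Proof.
case: k => // -[|k] // k1 kn; rewrite /act_quad /act_root /=.
by split; nu_check gP.
Qed.

Lemma act_quad13_root :
  act_quad 1%N (act_root 3%N) = (m / l) *: act_root 1%N
  /\ act_quad 1%N (g 3%N (act_root 1%N)) = m *: act_root 1%N.
Proof. by rewrite /act_quad /act_root /=; split; nu_check gP. Qed.

Lemma act_quad31_root :
  act_quad 3%N (act_root 1%N) = (m / l) *: act_root 3%N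
  /\ act_quad 3%N (g 1%N (act_root 3%N)) = m *: act_root 3%N.
Proof. by rewrite /act_quad /act_root /=; split; nu_check gP. Qed.

End Relations.

(** * Coordinates of the action *)

Section Coordinates.
Variables (F : fieldType) (n : nat) (l r : F).
Local Notation V := (nu_space F n).
Variable (g : nat -> V -> V).
Hypotheses (n4 : (4 <= n)%N) (l0 : l != 0) (r0 : r != 0).
Hypothesis gP : nu_action n l r g (@wvec F n).
Local Notation m := (r^-1 - r).
Implicit Types u v : V.

Lemma nucoefN u h i j : nucoef (- u) h i j = - nucoef u h i j.
Proof. by rewrite -scaleN1r nucoefZ mulN1r. Qed.

Lemma act0 k : g k 0 = 0.
Proof. by have := actZ gP k 0 0; rewrite !scale0r. Qed.

Lemma actB k u v : g k (u - v) = g k u - g k v.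
Proof. by rewrite (actD gP) (actN gP). Qed.

(** Meant for [Q u v] expressing a coordinate of [v] linearly through coordinates of [u], so that
    each coordinate formula is a case analysis on one basis vector. *)
Lemma act_linear_ind k (Q : V -> V -> Prop) :
  Q 0 0 -> (forall u u' v v', Q u u' -> Q v v' -> Q (u + v) (u' + v')) ->
  (forall c u u', Q u u' -> Q (c *: u) (c *: u')) ->
  (forall h i j, (0 < i < j)%N -> (j <= n)%N ->
     Q (wvec F n h i j) (g k (wvec F n h i j))) ->
  forall u, Q u (g k u).
Proof.
move=> Q0 QD QZ Qw; elim/nu_space_ind => [|u v Qu Qv|c u Qu|//].
- by rewrite act0.
- by rewrite (actD gP); apply: QD.
- by rewrite (actZ gP); apply: QZ.
Qed.

Ltac bool_step :=
  match goal with |- context [@eq_op _ ?a ?b] =>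
    let T := type of a in unify T nat;
    first [ have -> : (a == b) = true by nat_lia
          | have -> : (a == b) = false by nat_lia
          | case: (eqVneq a b) => [?|?]; [subst|] ] end.

Ltac co_eval :=
  rewrite ?(nucoefD, nucoefN, nucoefZ);
  repeat match goal with |- context [nucoef (wvec ?F ?n ?h ?i ?j)] =>
    rewrite (@nucoef_wvec F n h i j); [|nat_lia|nat_lia] end;
  rewrite ?eqxx /=; repeat bool_step; rewrite ?andbF ?andbT /= ?exprS ?expr0;
  try solve [field; repeat (apply/andP; split);
    first [done | assumption | apply: expf_neq0; assumption]].

Ltac co_linear k u :=
  elim/(@act_linear_ind k): u / (g k u);
  [ rewrite !nucoef0; ring | move=> ? ? ? ?; rewrite !nucoefD => -> ->; ring
  | move=> ? ? ?; rewrite !nucoefZ => ->; ring | move=> h' s' t' st' tn' ].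

Section TypeA.
Variable k : nat.
Hypotheses (k0 : (0 < k)%N) (kn : (k < n)%N).

Lemma co_other u h s t : (0 < s < t)%N -> (t <= n)%N ->
  s != k -> s != k.+1 -> t != k -> t != k.+1 ->
  nucoef (g k.+1 u) h s t = r * nucoef u h s t.
Proof.
move=> st tn sk sk1 tk tk1.
co_linear k.+1 u.
split_at s' k; try split_at s' k.+1; try split_at t' k; try split_at t' k.+1;
  case: h' h => -[]; try (exfalso; nat_lia); nu_act gP; co_eval.
Qed.

Lemma co_leftV u h t : (k.+1 < t)%N -> (t <= n)%N ->
  nucoef (g k.+1 u) h k.+1 t = nucoef u h k t - m * nucoef u h k.+1 t.
Proof.
move=> kt tn; co_linear k.+1 u.
split_at s' k; try split_at s' k.+1; try split_at t' k; try split_at t' k.+1;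
  case: h' h => -[]; try (exfalso; nat_lia); nu_act gP; co_eval.
Qed.

Lemma co_left u h t : (k.+1 < t)%N -> (t <= n)%N ->
  nucoef (g k.+1 u) h k t = nucoef u h k.+1 t.
Proof.
move=> kt tn; co_linear k.+1 u.
split_at s' k; try split_at s' k.+1; try split_at t' k; try split_at t' k.+1;
  case: h' h => -[]; try (exfalso; nat_lia); nu_act gP; co_eval.
Qed.

Lemma co_rightV u h s : (0 < s < k)%N ->
  nucoef (g k.+1 u) h s k.+1 = nucoef u h s k - m * nucoef u h s k.+1.
Proof.
move=> sk; co_linear k.+1 u.
split_at s' k; try split_at s' k.+1; try split_at t' k; try split_at t' k.+1;
  case: h' h => -[]; try (exfalso; nat_lia); nu_act gP; co_eval.
Qed.

Lemma co_right u h s : (0 < s < k)%N ->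
  nucoef (g k.+1 u) h s k = nucoef u h s k.+1.
Proof.
move=> sk; co_linear k.+1 u.
split_at s' k; try split_at s' k.+1; try split_at t' k; try split_at t' k.+1;
  case: h' h => -[]; try (exfalso; nat_lia); nu_act gP; co_eval.
Qed.

Lemma co_simple u : nucoef (g k.+1 u) true k k.+1 = r * nucoef u true k k.+1.
Proof.
co_linear k.+1 u.
split_at s' k; try split_at s' k.+1; try split_at t' k; try split_at t' k.+1;
  case: h'; try (exfalso; nat_lia); nu_act gP; co_eval.
Qed.

(* With [c = k.+1] this is what the coordinates having exactly one index in     *)
(* [k, k.+1] contribute to the coordinate of the root of [k.+1] under          *)
(* [g k.+1]; a second application brings in [c = k].                           *)
Definition accum c u : F :=
  \sum_(k.+2 <= t < n.+1) (r ^+ t / r ^+ k)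
     * (m / l / r ^+ 3 * nucoef u true c t + m / r ^+ 2 * nucoef u false c t)
  + \sum_(1 <= s < k) m / l * r * (r ^+ s / r ^+ k)
     * (nucoef u true s c + nucoef u false s c).

Lemma accumD c u v : accum c (u + v) = accum c u + accum c v.
Proof.
rewrite /accum addrACA -!big_split /=; congr (_ + _); apply: eq_bigr => i _;
  rewrite !nucoefD; ring.
Qed.

Lemma accumZ c a u : accum c (a *: u) = a * accum c u.
Proof.
rewrite /accum mulrDr !mulr_sumr; congr (_ + _); apply: eq_bigr => i _;
  rewrite !nucoefZ; ring.
Qed.

Lemma sum_delta a b x (f : nat -> F) : (forall i, i != x -> f i = 0) ->
  \sum_(a <= i < b) f i = if (a <= x < b)%N then f x else 0.
Proof.
move=> f0; case: ifP => [xab|xab].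
  rewrite (bigD1_seq x) ?mem_index_iota ?iota_uniq //= big1 ?addr0 //.
rewrite big_nat big1 // => i iab; apply: f0; apply: contraFneq xab => <- //.
Qed.

Lemma accum_wvec c h s t : (0 < s < t)%N -> (t <= n)%N ->
  accum c (wvec F n h s t) =
    (if (s == c) && (k.+1 < t)%N then
       (if h then m / l / r ^+ 3 else m / r ^+ 2) * (r ^+ t / r ^+ k) else 0)
  + (if (t == c) && (s < k)%N then m / l * r * (r ^+ s / r ^+ k) else 0).
Proof.
move=> st tn; rewrite /accum; congr (_ + _).
  rewrite (@sum_delta _ _ t) => [|i it]; last first.
    by rewrite !nucoef_wvec // [t == i]eq_sym (negPf it) !andbF !mulr0 addr0 mulr0.
  rewrite ltnS tn andbT !nucoef_wvec // eqxx andbT; case: ifP => _; last by rewrite andbF.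
  by rewrite andbT; case: (s == c); case: h => /=; ring.
rewrite (@sum_delta _ _ s) => [|i it]; last first.
  by rewrite !nucoef_wvec // [s == i]eq_sym (negPf it) /= !andbF addr0 mulr0.
case/andP: (st) => -> _ /=; rewrite !nucoef_wvec // eqxx; case: ifP => _; last by rewrite andbF.
by rewrite andbT; case: (t == c); case: h => /=; ring.
Qed.

Lemma co_root u :
  nucoef (g k.+1 u) false k k.+1 = l^-1 * nucoef u false k k.+1 + accum k.+1 u.
Proof.
elim/(@act_linear_ind k.+1): u / (g k.+1 u) =>
    [|? ? ? ? e1 e2|? ? ? e|h' s' t' st' tn'].
- by rewrite -(scale0r 0) accumZ !nucoefZ; ring.
- by rewrite !nucoefD accumD e1 e2; ring.
- by rewrite !nucoefZ accumZ e; ring.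
rewrite accum_wvec //.
split_at s' k; try split_at s' k.+1; try split_at t' k; try split_at t' k.+1;
  case: h'; try (exfalso; nat_lia); nu_act gP;
  rewrite ?eqxx /=; repeat (case: ifP => ?; try (exfalso; nat_lia)); co_eval.
Qed.

Lemma accum_act u : accum k.+1 (g k.+1 u) = accum k u - m * accum k.+1 u.
Proof.
rewrite /accum mulrDr opprD addrACA !mulr_sumr -!sumrB.
congr (_ + _); apply: eq_big_nat => i ik.
  by rewrite !co_leftV; try nat_lia; ring.
by rewrite !co_rightV; try nat_lia; ring.
Qed.

(** The image of [quad] is the line of the root, so this single coordinate carries the whole content
    of the hypothesis. *)
Lemma act_quad_root_coef u : act_quad r g k.+1 u = 0 ->
  (l^-1 ^+ 2 + m * l^-1 - 1) * nucoef u false k k.+1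
    + l^-1 * accum k.+1 u + accum k u = 0.
Proof.
move=> /(congr1 (fun v => nucoef v false k k.+1)).
rewrite /act_quad nucoef0 nucoefB nucoefD nucoefZ !co_root accum_act => <-.
by ring.
Qed.

End TypeA.

(* Under [g 1], the hatted coordinates with indices at least 3, one of them     *)
(* [j], contribute this to the coordinates [1, j] and [2, j], up to factors.   *)
Definition tail1 j u : F :=
  \sum_(j.+1 <= t < n.+1) m / r ^+ 5 * r ^+ t * nucoef u true j t
  + \sum_(3 <= s < j) m / r ^+ 3 * r ^+ s * nucoef u true s j.

Lemma tail1D j u v : tail1 j (u + v) = tail1 j u + tail1 j v.
Proof.
by rewrite /tail1 addrACA -!big_split /=; congr (_ + _);
  apply: eq_bigr => i _; rewrite !nucoefD; ring.
Qed.

Lemma tail1Z j a u : tail1 j (a *: u) = a * tail1 j u.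
Proof.
by rewrite /tail1 mulrDr !mulr_sumr; congr (_ + _); apply: eq_bigr => i _;
  rewrite !nucoefZ; ring.
Qed.

Lemma tail1_wvec j h s t : (2 < j)%N -> (0 < s < t)%N -> (t <= n)%N ->
  tail1 j (wvec F n h s t) =
    (if h && (s == j) then m / r ^+ 5 * r ^+ t else 0)
  + (if [&& h, t == j & 2 < s]%N then m / r ^+ 3 * r ^+ s else 0).
Proof.
move=> j2 st tn; rewrite /tail1; congr (_ + _).
  rewrite (@sum_delta _ _ t) => [|i it]; last first.
    by rewrite !nucoef_wvec // [t == i]eq_sym (negPf it) !andbF !mulr0.
  rewrite ltnS tn andbT nucoef_wvec // eqxx andbT; case: h => /=; last first.
    by rewrite mulr0 if_same.
  case: eqVneq => [<-|_]; last by rewrite mulr0 if_same.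
  by case/andP: (st) => _ ->; rewrite mulr1.
rewrite (@sum_delta _ _ s) => [|i it]; last first.
  by rewrite !nucoef_wvec // [s == i]eq_sym (negPf it) /= !andbF mulr0.
rewrite nucoef_wvec // eqxx; case: h => /=; last by rewrite mulr0 if_same.
case: eqVneq => [<-|_]; last by rewrite mulr0 if_same.
by case/andP: (st) => _ ->; rewrite mulr1 andbT.
Qed.

Ltac co1_linear u :=
  elim/(@act_linear_ind 1%N): u / (g 1%N u);
  [ rewrite -(scale0r 0) ?tail1Z !nucoefZ; ring
  | move=> ? ? ? ?; rewrite !nucoefD ?tail1D => -> ->; ring
  | move=> ? ? ?; rewrite !nucoefZ ?tail1Z => ->; ring | move=> h' s' t' st' tn' ].

Lemma co1_other u h i j : (2 < i < j)%N -> (j <= n)%N ->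
  nucoef (g 1%N u) h i j = r * nucoef u h i j.
Proof.
move=> i2 jn; co1_linear u.
split_at s' 1%N; try split_at s' 2%N; try split_at t' 2%N;
  case: h' h => -[]; try (exfalso; nat_lia); nu_act gP; co_eval.
Qed.

Lemma co1_h1 u j : (2 < j)%N -> (j <= n)%N ->
  nucoef (g 1%N u) true 1 j =
    nucoef u false 2 j + m * nucoef u false 1 j + tail1 j u.
Proof.
move=> j2 jn; co1_linear u; rewrite tail1_wvec //.
split_at s' 1%N; try split_at s' 2%N; try split_at t' 2%N;
  case: h'; try (exfalso; nat_lia); nu_act gP;
  rewrite /=; repeat (case: ifP => ?; try (exfalso; nat_lia)); co_eval.
Qed.

Lemma co1_w1 u j : (2 < j)%N -> (j <= n)%N ->
  nucoef (g 1%N u) false 1 j =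
    nucoef u true 2 j - m * nucoef u false 1 j - tail1 j u.
Proof.
move=> j2 jn; co1_linear u; rewrite tail1_wvec //.
split_at s' 1%N; try split_at s' 2%N; try split_at t' 2%N;
  case: h'; try (exfalso; nat_lia); nu_act gP;
  rewrite /=; repeat (case: ifP => ?; try (exfalso; nat_lia)); co_eval.
Qed.

Lemma co1_h2 u j : (2 < j)%N -> (j <= n)%N ->
  nucoef (g 1%N u) true 2 j = nucoef u false 1 j + r * tail1 j u.
Proof.
move=> j2 jn; co1_linear u; rewrite tail1_wvec //.
split_at s' 1%N; try split_at s' 2%N; try split_at t' 2%N;
  case: h'; try (exfalso; nat_lia); nu_act gP;
  rewrite /=; repeat (case: ifP => ?; try (exfalso; nat_lia)); co_eval.
Qed.

Lemma co1_w2 u j : (2 < j)%N -> (j <= n)%N ->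
  nucoef (g 1%N u) false 2 j =
    nucoef u true 1 j - m * nucoef u false 2 j - m * nucoef u true 2 j
    - r * tail1 j u.
Proof.
move=> j2 jn; co1_linear u; rewrite tail1_wvec //.
split_at s' 1%N; try split_at s' 2%N; try split_at t' 2%N;
  case: h'; try (exfalso; nat_lia); nu_act gP;
  rewrite /=; repeat (case: ifP => ?; try (exfalso; nat_lia)); co_eval.
Qed.

End Coordinates.

Section GlobalRelations.
Variables (F : fieldType) (n : nat) (l r : F).
Local Notation V := (nu_space F n).
Variable (g : nat -> V -> V).
Hypotheses (n4 : (4 <= n)%N) (l0 : l != 0) (r0 : r != 0).
Hypothesis gP : nu_action n l r g (@wvec F n).
Local Notation m := (r^-1 - r).
Implicit Types u v : V.

Ltac by_basis u :=
  elim/nu_space_ind: u;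
  [ rewrite ?(act0 gP) //
  | move=> ? ?; rewrite ?(actD gP) => -> -> //
  | move=> ? ?; rewrite ?(actZ gP) => -> //
  | move=> h s t st tn ].

Lemma act_braidS u k : (0 < k)%N -> (k.+1 < n)%N ->
  g k.+1 (g k.+2 (g k.+1 u)) = g k.+2 (g k.+1 (g k.+2 u)).
Proof. by move=> k0 kn; by_basis u; apply: (act_braid_wvec n4 l0 r0 gP). Qed.

Lemma act_commS u k k' : (0 < k)%N -> (k.+1 < k')%N -> (k' < n)%N ->
  g k.+1 (g k'.+1 u) = g k'.+1 (g k.+1 u).
Proof. by move=> k0 kk' kn; by_basis u; apply: (act_comm_wvec n4 l0 r0 gP). Qed.

Lemma act1_commS u k : k = 1%N \/ (2 < k)%N -> (k < n)%N ->
  g 1%N (g k.+1 u) = g k.+1 (g 1%N u).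
Proof. by move=> k1 kn; by_basis u; apply: (act1_comm_wvec n4 l0 r0 gP). Qed.

Lemma act1_braid u : g 1%N (g 3%N (g 1%N u)) = g 3%N (g 1%N (g 3%N u)).
Proof. by by_basis u; apply: (act1_braid_wvec n4 l0 r0 gP). Qed.

Lemma act_braid i j u : D_edge i j -> (0 < i)%N -> (j <= n)%N ->
  g i (g j (g i u)) = g j (g i (g j u)).
Proof.
case/orP=> [/andP[/eqP-> /eqP->] _ _|]; first exact: act1_braid.
by case: i => [|[|i]] // /eqP-> _ jn; apply: act_braidS.
Qed.

Lemma act_comm i j u : (0 < i < j)%N -> (j <= n)%N -> ~~ D_edge i j ->
  g i (g j u) = g j (g i u).
Proof.
case: i => [|[|i]] // ij jn; rewrite /D_edge /= ?andbF ?orbF => edge.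
  case: j ij jn edge => // j ij jn edge; apply: act1_commS => //.
  by move: ij edge; case: j {jn} => [|[|[|j]]] // _ _; [left|right].
case: j ij jn edge => // j ij jn edge; apply: act_commS => //.
by rewrite eqSS in edge; nat_lia.
Qed.
End GlobalRelations.

(** * Eigenvectors of the generators on a subspace killed by all [quad k] *)

Section Irreducibility.
Variables (F : fieldType) (n : nat) (l r : F).
Local Notation V := (nu_space F n).
Variable (g : nat -> V -> V).
Hypotheses (n4 : (4 <= n)%N) (l0 : l != 0) (r0 : r != 0).
Hypothesis gP : nu_action n l r g (@wvec F n).
Hypothesis rN1 : forall k, (1 <= k <= n)%N -> r ^+ (2 * k) != 1.
Hypothesis rNm1 : forall k, (1 <= k <= n - 1)%N -> r ^+ (2 * k) != -1.
Local Notation m := (r^-1 - r).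
Implicit Types u v : V.

Variable P : V -> Prop.
Hypothesis PD : forall u v, P u -> P v -> P (u + v).
Hypothesis PZ : forall c u, P u -> P (c *: u).
Hypothesis Pg : forall k u, (0 < k <= n)%N -> P u -> P (g k u).
Hypothesis Pq : forall k u, (0 < k <= n)%N -> P u -> act_quad r g k u = 0.

Let PB u v : P u -> P v -> P (u - v).
Proof. by move=> Pu Pv; rewrite -scaleN1r; apply: PD => //; apply: PZ. Qed.

Let gg k u : (0 < k <= n)%N -> P u -> g k (g k u) = u - m *: g k u.
Proof.
move=> kn Pu; have /eqP := Pq kn Pu.
by rewrite /act_quad subr_eq0 => /eqP e; rewrite -[X in _ = X - _]e addrK.
Qed.

(* [g a g b] conjugates [g a] into [g b], and is invertible on [P].            *)
Lemma eigen_conj (X : V -> V) a b :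
  (0 < a <= n)%N -> (0 < b <= n)%N ->
  (forall u, g a (g b (g a u)) = g b (g a (g b u))) ->
  (forall u, X (g a u) = g a (X u)) -> (forall u, X (g b u) = g b (X u)) ->
  (forall u, P u -> g a (X u) = r *: X u) ->
  (forall c u, X (c *: u) = c *: X u) ->
  forall u, P u -> g b (X u) = r *: X u.
Proof.
move=> an bn br Xa Xb Xe XZ u Pu.
pose v := g a u + m *: u; pose u' := g b v + m *: v.
have Pv : P v by apply: PD; [apply: Pg | apply: PZ].
have Pu' : P u' by apply: PD; [apply: Pg | apply: PZ].
have ev : g b u' = v by rewrite (actD gP) (actZ gP) gg // subrK.
have eu : g a v = u by rewrite (actD gP) (actZ gP) gg // subrK.
have -> : X u = g a (g b (X u')) by rewrite -Xb -Xa ev eu.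
by rewrite -br Xe // !(actZ gP).
Qed.

Definition shift k u := g k u - r *: u.

Lemma shiftZ k c u : shift k (c *: u) = c *: shift k u.
Proof. by rewrite /shift (actZ gP) scalerBr !scalerA mulrC. Qed.

Lemma P_shift k u : (0 < k <= n)%N -> P u -> P (shift k u).
Proof. by move=> kn Pu; apply: PB; [apply: Pg | apply: PZ]. Qed.

(** Because [quad k = (g k + 1/r) (g k - r)] vanishes on [P]. *)
Lemma shift_eigen k u : (0 < k <= n)%N -> P u ->
  g k (shift k u) = - r^-1 *: shift k u.
Proof.
move=> kn Pu; rewrite /shift (actB gP) (actZ gP) gg //.
rewrite scalerBr scalerA mulNr mulVf // scaleN1r opprK.
by rewrite -addrA -opprD -scalerDl subrK addrC scaleNr.
Qed.

Lemma shift_comm k j u : (forall v, g j (g k v) = g k (g j v)) ->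
  shift k (g j u) = g j (shift k u).
Proof. by move=> c; rewrite /shift (actB gP) (actZ gP) c. Qed.

Lemma root_neq : r + r^-1 != 0.
Proof.
have /rNm1 : (1 <= 1 <= n - 1)%N by nat_lia.
rewrite muln1; apply: contra => /eqP e; apply/eqP.
by apply/eqP; rewrite -addr_eq0 expr2 -(mulfV r0) -mulrDr e mulr0.
Qed.

Let eig0 (x : F) : r * x = - r^-1 * x -> x = 0.
Proof.
move=> /eqP; rewrite mulNr -subr_eq0 opprK -mulrDl mulf_eq0.
by rewrite (negPf root_neq) /= => /eqP.
Qed.

Section AntiInvariant.
Variables (k : nat) (u : V).
Hypotheses (k0 : (0 < k)%N) (kn : (k < n)%N).
Hypothesis uk : g k.+1 u = - r^-1 *: u.

(** The generator multiplies this coordinate by [r], the eigenvalue demands [- 1/r], and [r + 1/r]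
    is nonzero. *)
Lemma anti_other h s t : (0 < s < t)%N -> (t <= n)%N ->
  s != k -> s != k.+1 -> t != k -> t != k.+1 -> nucoef u h s t = 0.
Proof.
move=> st tn sk sk1 tk tk1; apply: eig0.
by rewrite -(co_other n4 l0 r0 gP k0 kn) // uk nucoefZ.
Qed.

Lemma anti_left h t : (k.+1 < t)%N -> (t <= n)%N ->
  nucoef u h k t = - r * nucoef u h k.+1 t.
Proof.
move=> kt tn; have := co_left n4 l0 r0 gP k0 kn u h kt tn.
by rewrite uk nucoefZ => <-; field.
Qed.

Lemma anti_right h s : (0 < s < k)%N ->
  nucoef u h s k = - r * nucoef u h s k.+1.
Proof.
move=> sk; have := co_right n4 l0 r0 gP k0 kn u h sk.
by rewrite uk nucoefZ => <-; field.
Qed.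

Lemma anti_simple : nucoef u true k k.+1 = 0.
Proof.
by apply: eig0; rewrite -(co_simple n4 l0 r0 gP k0 kn) // uk nucoefZ.
Qed.
End AntiInvariant.

Section Invariant.
Variables (k : nat) (u : V).
Hypotheses (k0 : (0 < k)%N) (kn : (k < n)%N) (uk : g k.+1 u = r *: u).

Lemma inv_left h t : (k.+1 < t)%N -> (t <= n)%N ->
  nucoef u h k.+1 t = r * nucoef u h k t.
Proof.
move=> kt tn; have := co_left n4 l0 r0 gP k0 kn u h kt tn.
by rewrite uk nucoefZ => <-.
Qed.

Lemma inv_right h s : (0 < s < k)%N ->
  nucoef u h s k.+1 = r * nucoef u h s k.
Proof.
move=> sk; have := co_right n4 l0 r0 gP k0 kn u h sk.
by rewrite uk nucoefZ => <-.
Qed.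
End Invariant.

End Irreducibility.

Section QuadRelations.
Variables (F : fieldType) (n : nat) (l r : F).
Local Notation V := (nu_space F n).
Variable (g : nat -> V -> V).
Hypotheses (n4 : (4 <= n)%N) (l0 : l != 0) (r0 : r != 0).
Hypothesis gP : nu_action n l r g (@wvec F n).
Local Notation m := (r^-1 - r).
Local Notation quad := (act_quad r g).
Local Notation root := (act_root (@wvec F n)).

Lemma quad_rank1 k u : (0 < k <= n)%N -> exists c, quad k u = c *: root k.
Proof.
move=> kn; elim/nu_space_ind: u => [|u v [c ec] [d ed]|a u [c ec]|h s t st tn].
- by exists 0; rewrite -(scale0r 0) (act_quadZ gP) !scale0r.
- by exists (c + d); rewrite (act_quadD gP) ec ed scalerDl.
- by exists (a * c); rewrite (act_quadZ gP) ec scalerA.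
- exact: (act_quad_wvec n4 l0 r0 gP).
Qed.

Lemma quad_adjacent i j : (0 < i <= n)%N -> (0 < j <= n)%N ->
  D_edge i j || D_edge j i -> quad i (g j (root i)) = m *: root i.
Proof.
move=> iP jP; rewrite /D_edge.
case/orP => /orP[/andP[/eqP ? /eqP ?]|/andP[i2 /eqP ?]]; subst.
- by case: (act_quad13_root n4 l0 r0 gP).
- by case: (act_quad_left_root n4 l0 r0 gP (k := i)) => //; case/andP: jP.
- by case: (act_quad31_root n4 l0 r0 gP).
- by case: (act_quad_right_root n4 l0 r0 gP (k := j)) => //; case/andP: iP.
Qed.

End QuadRelations.


(** * Irreducibility *)

Lemma cramer2 (F : fieldType) (a b c d x y : F) :
  a * x + b * y = 0 -> c * x + d * y = 0 -> a * d - b * c != 0 ->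
  x = 0 /\ y = 0.
Proof.
move=> e1 e2 /negPf D0; split; apply/eqP.
  have : (a * d - b * c) * x == 0.
    have -> : (a * d - b * c) * x = d * (a * x + b * y) - b * (c * x + d * y) by ring.
    by rewrite e1 e2; apply/eqP; ring.
  by rewrite mulf_eq0 D0.
have : (a * d - b * c) * y == 0.
  have -> : (a * d - b * c) * y = a * (c * x + d * y) - c * (a * x + b * y) by ring.
  by rewrite e1 e2; apply/eqP; ring.
by rewrite mulf_eq0 D0.
Qed.

Lemma sum_nat_head (F : fieldType) a b (f : nat -> F) : (a < b)%N ->
  (forall i, (a < i < b)%N -> f i = 0) -> \sum_(a <= i < b) f i = f a.
Proof.
by move=> ab f0; rewrite big_ltn // big_nat big1 ?addr0.
Qed.

Lemma sum_nat_0 (F : fieldType) a b (f : nat -> F) :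
  (forall i, (a <= i < b)%N -> f i = 0) -> \sum_(a <= i < b) f i = 0.
Proof. by move=> f0; rewrite big_nat big1. Qed.

Section Irreducibility.
Variables (F : fieldType) (n : nat) (l r : F).
Local Notation V := (nu_space F n).
Variable (g : nat -> V -> V).
Hypotheses (n4 : (4 <= n)%N) (l0 : l != 0) (r0 : r != 0).
Hypothesis gP : nu_action n l r g (@wvec F n).
Hypothesis rN1 : forall k, (1 <= k <= n)%N -> r ^+ (2 * k) != 1.
Hypothesis rNm1 : forall k, (1 <= k <= n - 1)%N -> r ^+ (2 * k) != -1.
Local Notation m := (r^-1 - r).
Implicit Types u v : V.

Let m0 : m != 0.
Proof.
have /rN1 : (1 <= 1 <= n)%N by nat_lia.
apply: contra; rewrite muln1 subr_eq0 => /eqP e.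
by rewrite expr2 -{1}e mulVf.
Qed.

(** For a vector supported on pairs from [{1, 2} x {3, 4}] each of the sums attached to node 3 keeps
    a single index. *)
Lemma accum_node3 (z : V) :
  (forall h t, (3 < t <= n)%N -> nucoef z h 3 t = 0) ->
  (forall h s t, (0 < s < 3)%N -> (s < t <= n)%N -> t != 3%N -> t != 4%N ->
     nucoef z h s t = 0) ->
  accum l r 2 3 z = m / l * (nucoef z true 1 3 + nucoef z false 1 3) /\
  accum l r 2 2 z = r ^+ 2 * (m / l / r ^+ 3 * nucoef z true 2 4
                              + m / r ^+ 2 * nucoef z false 2 4).
Proof.
move=> z3 zlo; rewrite /accum; split.
  rewrite sum_nat_0; last by move=> i i3; rewrite !z3 ?mulr0 ?addr0 ?mulr0 //; nat_lia.
  by rewrite big_nat1; field; rewrite ?l0 ?r0.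
rewrite (@sum_nat_head _ 4%N); first last.
- by move=> i i3; rewrite !zlo ?mulr0 ?addr0 ?mulr0 //; nat_lia.
- by nat_lia.
rewrite big_nat1 !(zlo _ 1%N 2%N) //; try nat_lia.
by field; rewrite ?l0 ?r0.
Qed.

(** The two eigenvalues confine [y] to the pairs [{1, 2} x {3, 4}] and make every coordinate
    proportional to [p] or [q], those at [(2, 4)]. Node 3 gives one equation on [y]; the second
    comes from the same node applied to [g 1 y]. *)
Lemma anti24_eq0 y : g 2%N y = - r^-1 *: y -> g 4%N y = - r^-1 *: y ->
  act_quad r g 3%N y = 0 -> act_quad r g 3%N (g 1%N y) = 0 ->
  l != r ^+ 3 -> l != - r ^+ 3 -> l != r^-1 -> y = 0.
Proof.
move=> y2 y4 q3 q31 lr3 lNr3 lVr.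
have [k2 k4] : (1 < n)%N /\ (3 < n)%N by nat_lia.
have hi h s t : (2 < s < t)%N -> (t <= n)%N -> nucoef y h s t = 0.
  by move=> st tn; apply: (anti_other n4 l0 r0 gP rNm1 _ k2 y2); nat_lia.
have lo h s t : (0 < s < 3)%N -> (s < t)%N -> (t <= n)%N -> t != 3%N -> t != 4%N ->
    nucoef y h s t = 0.
  by move=> s3 st tn t3 t4; apply: (anti_other n4 l0 r0 gP rNm1 _ k4 y4); nat_lia.
have x1 h t : (2 < t)%N -> (t <= n)%N -> nucoef y h 1 t = - r * nucoef y h 2 t.
  by move=> t2 tn; apply: (anti_left n4 l0 r0 gP _ k2 y2); nat_lia.
have x3 h s : (0 < s < 3)%N -> nucoef y h s 3 = - r * nucoef y h s 4.
  by move=> s3; apply: (anti_right n4 l0 r0 gP _ k4 y4); nat_lia.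
pose p := nucoef y true 2 4; pose q := nucoef y false 2 4.
have tail0 j : (2 < j)%N -> (j <= n)%N -> tail1 r j y = 0.
  move=> j2 jn; rewrite /tail1 !sum_nat_0 ?addr0 // => i ij; rewrite hi ?mulr0 //; nat_lia.
pose y' := g 1%N y.
(* [g 1] commutes with [g 4] and scales the coordinates with both indices above 2, so [y'] has the
   same support as [y]. *)
have y4' : g 4%N y' = - r^-1 *: y'.
  rewrite /y' -(@act_comm _ _ _ _ _ n4 l0 r0 gP 1%N 4%N) //.
  by rewrite y4 (actZ gP).
have lo' h s t : (0 < s < 3)%N -> (s < t)%N -> (t <= n)%N -> t != 3%N -> t != 4%N ->
    nucoef y' h s t = 0.
  by move=> s3 st tn t3 t4; apply: (anti_other n4 l0 r0 gP rNm1 _ k4 y4'); nat_lia.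
have hi' h s t : (2 < s < t)%N -> (t <= n)%N -> nucoef y' h s t = 0.
  by move=> st tn; rewrite (co1_other n4 l0 r0 gP) // hi // mulr0.
have [k3 n3] : (2 < n)%N /\ (3 <= n)%N by nat_lia.
have E1 := act_quad_root_coef n4 l0 r0 gP (ltn0Sn 1) k3 q3.
have E2 := act_quad_root_coef n4 l0 r0 gP (ltn0Sn 1) k3 q31.
have [A3 A2] : accum l r 2 3 y = m / l * (r ^+ 2 * (p + q)) /\
    accum l r 2 2 y = r ^+ 2 * (m / l / r ^+ 3 * p + m / r ^+ 2 * q).
  have [|h s t s3 st|-> ->] := @accum_node3 y; first by move=> *; apply: hi; nat_lia.
    by apply: lo; nat_lia.
  by rewrite !x3 // !x1 // -/p -/q; split; ring.
have e1 : (m / l / r * (1 + r ^+ 3 / l)) * p + (1 + r ^+ 3 / l) * (1 - r / l) / r * q = 0.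
  rewrite -E1 A3 A2 x3 // -/q.
  by field; rewrite ?l0 ?r0.
have [A3' A2'] : accum l r 2 3 y' = - m / l * r * (p + q) /\
    accum l r 2 2 y' = r ^+ 2 * (m / l / r ^+ 3 * (- r * q) + m / r ^+ 2 * (- p / r - m * q)).
  have [|h s t s3 st|-> ->] := @accum_node3 y'; first by move=> *; apply: hi'; nat_lia.
    by apply: lo'; nat_lia.
  rewrite /y' (co1_w2 n4 l0 r0 gP) // (co1_w1 n4 l0 r0 gP) // (co1_h1 n4 l0 r0 gP) //.
  rewrite (co1_h2 n4 l0 r0 gP) // !tail0 //.
  by rewrite !x1 // !x3 // -/p -/q; split; field; rewrite ?l0 ?r0.
have e2 : (1 + r ^+ 3 / l) * (r / l - 1) / r ^+ 2 * p + (- m / r * (1 + r ^+ 3 / l)) * q = 0.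
  rewrite -E2 -/y' A3' A2' /y' (co1_w2 n4 l0 r0 gP) // !tail0 //.
  rewrite !x1 // !x3 // -/p -/q.
  by field; rewrite ?l0 ?r0.
have [|p0 q0] := cramer2 e1 e2.
  (* The determinant factors into the excluded values [- r^3], [1/r] and [r^3]. *)
  have -> : m / l / r * (1 + r ^+ 3 / l) * (- m / r * (1 + r ^+ 3 / l)) -
      (1 + r ^+ 3 / l) * (1 - r / l) / r * ((1 + r ^+ 3 / l) * (r / l - 1) / r ^+ 2)
    = (l + r ^+ 3) ^+ 2 * (l - r^-1) * (l - r ^+ 3) / (r ^+ 3 * l ^+ 4).
    by field; rewrite ?l0 ?r0.
  rewrite !mulf_neq0 ?invr_eq0 ?expf_neq0 ?subr_eq0 ?mulf_neq0 ?expf_neq0 //;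
    by rewrite addr_eq0.
apply: nucoefP => h s t st tn; rewrite nucoef0.
have [s2|s2] := ltnP 2 s; first by apply: hi; nat_lia.
have [t3|t3] := eqVneq t 3; last first.
  have [t4|t4] := eqVneq t 4; last by apply: lo => //; nat_lia.
  subst t; move: s2 st; case: s => [|[|[|s]]] // _ _; rewrite ?x1 //;
    by case: h; rewrite -?[nucoef _ _ _ _]/p -?[nucoef _ _ _ _]/q ?p0 ?q0 ?mulr0.
subst t; rewrite x3; last nat_lia.
move: s2 st; case: s => [|[|[|s]]] // _ _; rewrite ?x1 //;
  by case: h; rewrite -/p -/q ?p0 ?q0 ?mulr0.
Qed.

(** For [n = 4] node 3 does not commute with node [n], so properties of [g n - r] cannot be
    conjugated from node 3 to node 1. Instead, node 1 makes the hatted coordinates opposite to the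
    others, and node 3 gives an equation for the one remaining unknown [q]. *)
Lemma anti14_eq0 y : n = 4%N -> g 1%N y = - r^-1 *: y -> g 2%N y = r *: y ->
  g 4%N y = - r^-1 *: y -> act_quad r g 3%N y = 0 ->
  l != - r ^+ 3 -> l != r^-1 -> y = 0.
Proof.
move=> n_4 y1 y2 y4 q3 lNr3 lVr.
have [[k2 k3] k4] : ((1 < n)%N /\ (2 < n)%N) /\ (3 < n)%N by nat_lia.
have y12 h : nucoef y h 1 2 = 0.
  by apply: (anti_other n4 l0 r0 gP rNm1 _ k4 y4); nat_lia.
have x3 h s : (0 < s < 3)%N -> nucoef y h s 3 = - r * nucoef y h s 4.
  by move=> s3; apply: (anti_right n4 l0 r0 gP _ k4 y4); nat_lia.
have x2 h t : (2 < t <= 4)%N -> nucoef y h 2 t = r * nucoef y h 1 t.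
  by move=> t2; apply: (inv_left n4 l0 r0 gP _ k2 y2); nat_lia.
have y34 h : nucoef y h 3 4 = 0.
  have := co1_other n4 l0 r0 gP y h (i := 3) (j := 4) isT k4.
  rewrite y1 nucoefZ => /eqP; rewrite -subr_eq0 -mulrBl mulf_eq0.
  rewrite -opprD oppr_eq0 addrC (negPf (root_neq n4 r0 rNm1)) /= => /eqP //.
pose q := nucoef y false 1 4.
have pq : nucoef y true 1 4 = - q.
  have := co1_h2 n4 l0 r0 gP y (j := 4) isT k4.
  rewrite y1 nucoefZ x2 // /tail1 sum_nat_0; last by move=> i; nat_lia.
  by rewrite big_nat1 y34 mulr0 addr0 mulr0 addr0 -/q => <-; field.
have := act_quad_root_coef n4 l0 r0 gP (ltn0Sn 1) k3 q3.
have [||-> ->] := @accum_node3 y.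
- by move=> h t t3; have -> : t = 4%N by nat_lia.
- move=> h s t s3 st t3 t4; have [-> ->] : s = 1%N /\ t = 2%N by nat_lia.
  exact: y12.
rewrite !x2 // !x3 // pq -/q => e.
have : (1 - l * r) * (l + r ^+ 3) * q = 0.
  by rewrite -(mulr0 (- l ^+ 2 * r)) -e; field; rewrite ?l0 ?r0.
move=> /eqP; rewrite !mulf_eq0 subr_eq0 addr_eq0 (negPf lNr3) orbF => /orP[/eqP e1|/eqP q0].
  by case/eqP: lVr; apply: (mulIf r0); rewrite -e1 mulVf.
apply: nucoefP => h s t st tn; rewrite nucoef0.
have [s3|s3] := ltnP 2 s; first by have [-> ->] : s = 3%N /\ t = 4%N by nat_lia.
have [t2|t2] := ltnP t 3; first by have [-> ->] : s = 1%N /\ t = 2%N by nat_lia.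
have z1 : nucoef y h 1 4 = 0 by case: h; rewrite ?pq -/q q0 ?oppr0.
have z2 : nucoef y h 2 4 = 0 by rewrite x2 // z1 mulr0.
have z h' : (0 < h' < 3)%N -> nucoef y h h' 4 = 0.
  by case: h' => [|[|[|]]].
have [t3|t3] := eqVneq t 3%N; first by rewrite t3 x3 ?z ?mulr0 //; nat_lia.
have -> : t = 4%N by nat_lia.
by apply: z; nat_lia.
Qed.
End Irreducibility.

(** Telescoping of [m r^(2s) = (r^(2s) - r^(2s+2)) / r]. The factor [m] occurs in every sum met
    below, so no division by [1 - r^2] is needed. *)
Lemma geometric_sum (F : fieldType) (r : F) a b : r != 0 -> (a <= b)%N ->
  (r^-1 - r) * (\sum_(a <= s < b) r ^+ s * r ^+ s)
  = (r ^+ a * r ^+ a - r ^+ b * r ^+ b) / r.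
Proof.
move=> r0; elim: b => [|b IH] ab.
  by rewrite big_geq //; move: ab; case: a => // _; ring.
case: (ltngtP a b.+1) ab => // [ab|->] _; last by rewrite big_geq //; ring.
rewrite big_nat_recr //= mulrDr IH // !exprS; field; by rewrite ?r0.
Qed.

Section Irreducibility.
Variables (F : fieldType) (N : nat) (l r : F).
Local Notation n := N.+2.
Local Notation V := (nu_space F n).
Variable (g : nat -> V -> V).
Hypotheses (n4 : (4 <= n)%N) (l0 : l != 0) (r0 : r != 0).
Hypothesis gP : nu_action n l r g (@wvec F n).
Hypothesis rN1 : forall k, (1 <= k <= n)%N -> r ^+ (2 * k) != 1.
Hypothesis rNm1 : forall k, (1 <= k <= n - 1)%N -> r ^+ (2 * k) != -1.
Local Notation m := (r^-1 - r).
Implicit Types u v : V.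
Local Notation R := (r ^+ N).

Let R0 : R != 0. Proof. exact: expf_neq0. Qed.

Ltac fieldR :=
  rewrite ?exprS; move: R R0;
  let R := fresh in let R0 := fresh in intros R R0; field; rewrite ?R0 ?r0 ?l0.

Lemma chain_coef z h s t : (forall k, (1 < k <= s)%N -> g k z = r *: z) ->
  (0 < s < t)%N -> (t <= n)%N -> nucoef z h s t = r ^+ s / r * nucoef z h 1 t.
Proof.
elim: s => // s IH inv st tn; case: s IH inv st => [|s] IH inv st.
  by rewrite expr1 mulfV // mul1r.
rewrite (inv_left n4 l0 r0 gP (k := s.+1)) //; try nat_lia; last by apply: inv; nat_lia.
rewrite IH ?exprS; try nat_lia; last by move=> k ks; apply: inv; nat_lia.
by ring.
Qed.

(** Node [n] leaves the coordinates involving [n - 1] or [n], and nodes 2 to [N] reduce them to [a],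
    [b], [c]. Node 1 yields [a] from [b]; the eigenvector equation of [g n] at its root ([e1]) and
    the [quad] equation of node [n - 1] ([e2]) then form a system in [c] and [b]. *)
Lemma anti_last_eq0 z : g n z = - r^-1 *: z ->
  (forall j, (0 < j <= N)%N -> g j z = r *: z) -> act_quad r g N.+1 z = 0 ->
  l != - r ^+ 3 -> l * (R / r) ^+ 2 != r -> l * (R / r) ^+ 2 != - r^-1 -> z = 0.
Proof.
move=> zn zj qz lNr3 l1 l2.
have [N2 kn] : (1 < N)%N /\ (N.+1 < n)%N by nat_lia.
have xs h s : (0 < s < N.+1)%N -> nucoef z h s N.+1 = - r * nucoef z h s n.
  by move=> sN; apply: (anti_right n4 l0 r0 gP _ kn zn).
have lo h s t : (0 < s < t)%N -> (t <= N)%N -> nucoef z h s t = 0.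
  by move=> st tN; apply: (anti_other n4 l0 r0 gP rNm1 _ kn zn); nat_lia.
have hn : nucoef z true N.+1 n = 0.
  exact: (anti_simple n4 l0 r0 gP rNm1 _ kn zn).
have [b bE] : {b | nucoef z true 1 n = b} by eexists.
have [a aE] : {a | nucoef z false 1 n = a} by eexists.
have zs h s : (0 < s <= N)%N ->
    nucoef z h s n = r ^+ s / r * (if h then b else a).
  move=> sN; rewrite chain_coef; try nat_lia; last by move=> k ks; apply: zj; nat_lia.
  by case: h; rewrite ?bE ?aE.
have [c cE] : {c | nucoef z false N.+1 n = c} by eexists.
have ab : a = b * (R / r) ^+ 2.
  have := co1_h2 n4 l0 r0 gP z (j := n) (ltnW n4) (leqnn _).
  rewrite zj ?nucoefZ; last nat_lia.
  rewrite zs ?aE // /tail1 big_geq // big_nat_recr /=; last nat_lia.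
  rewrite hn mulr0 addr0 add0r.
  have -> : \sum_(3 <= s < N.+1) m / r ^+ 3 * r ^+ s * nucoef z true s n =
      (m * \sum_(3 <= s < N.+1) r ^+ s * r ^+ s) * (b / r ^+ 4).
    rewrite mulr_sumr mulr_suml; apply: eq_big_nat => s sN.
    by rewrite zs; [field; rewrite ?r0 | nat_lia].
  rewrite geometric_sum // => e.
  have -> : a = r * (r ^+ 2 / r * b) - r * ((r ^+ 3 * r ^+ 3 - r ^+ N.+1 * r ^+ N.+1) / r
      * (b / r ^+ 4)) by rewrite e; ring.
  by rewrite !exprS; field.
have e1 : (l^-1 + r^-1) * c
    + (1 + (R / r) ^+ 2) * (1 - R ^+ 2) / (l * R) * b = 0.
  have := co_root n4 l0 r0 gP (ltn0Sn N) kn z.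
  rewrite zn nucoefZ ?cE /accum big_geq // add0r.
  have -> : \sum_(1 <= s < N.+1) m / l * r * (r ^+ s / r ^+ N.+1) *
      (nucoef z true s n + nucoef z false s n) =
      (m * \sum_(1 <= s < N.+1) r ^+ s * r ^+ s) * ((a + b) / (l * r ^+ N.+1)).
    rewrite mulr_sumr mulr_suml; apply: eq_big_nat => s sN.
    rewrite !zs; try nat_lia.
    by fieldR.
  rewrite geometric_sum // ab => /eqP; rewrite -subr_eq0 => /eqP e.
  by rewrite -[RHS]oppr0 -e; fieldR.
have e2 : (m / l) * c
    + (- (l^-1 ^+ 2 + m * l^-1 - 1) * R ^+ 3 / r ^+ 2
       - (1 + (R / r) ^+ 2) * (r ^+ 2 - R ^+ 2) / (l ^+ 2 * R)
       + m * R / (l * r ^+ 2) + m * R ^+ 3 / r ^+ 3) * b = 0.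
  have kN : (N < n)%N by nat_lia.
  have N0 : (0 < N)%N by nat_lia.
  have := act_quad_root_coef n4 l0 r0 gP N0 kN qz.
  have -> : accum l r N N.+1 z = m * c
     + (m * \sum_(1 <= s < N) r ^+ s * r ^+ s) * (- ((a + b) * r / (l * R))).
    rewrite /accum big_nat1 hn; congr (_ + _).
      by rewrite ?cE; fieldR.
    rewrite mulr_sumr mulr_suml; apply: eq_big_nat => s sN.
    rewrite !xs ?zs; try nat_lia.
    by fieldR.
  have -> : accum l r N N z = (m / l / r ^+ 3 * b + m / r ^+ 2 * a) * R * r.
    rewrite /accum big_nat1 sum_nat_0 => [|s sN]; last first.
      by rewrite !lo ?addr0 ?mulr0 //; nat_lia.
    rewrite !zs; try nat_lia.
    by fieldR.
  rewrite geometric_sum // xs ?zs ?ab; try nat_lia.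
  by move=> <-; fieldR.
have [|c0 b0] := cramer2 e1 e2.
  (* Here [(R / r)^2 = r^(2n-6)], so the last two factors vanish at [l = r^(7-2n)] and
     [l = - r^(5-2n)]. *)
  have -> : (l^-1 + r^-1) * (- (l^-1 ^+ 2 + m * l^-1 - 1) * R ^+ 3 / r ^+ 2
       - (1 + (R / r) ^+ 2) * (r ^+ 2 - R ^+ 2) / (l ^+ 2 * R)
       + m * R / (l * r ^+ 2) + m * R ^+ 3 / r ^+ 3)
     - (1 + (R / r) ^+ 2) * (1 - R ^+ 2) / (l * R) * (m / l)
    = (l + r ^+ 3) * (l * (R / r) ^+ 2 - r) * (l * (R / r) ^+ 2 + r^-1)
       / (r * R * l ^+ 3).
    by fieldR.
  rewrite !mulf_neq0 ?invr_eq0 ?subr_eq0 ?mulf_neq0 ?expf_neq0 //;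
    by rewrite addr_eq0.
apply: nucoefP => h s t st tn; rewrite nucoef0.
have zn0 h' s' : (0 < s' <= N)%N -> nucoef z h' s' n = 0.
  by move=> sN; rewrite zs //; case: h'; rewrite ?ab b0 ?mul0r ?mulr0.
have [tN|tN] := leqP t N; first by apply: lo.
have [e|tn1] := eqVneq t n.
  subst t; have [sN|sN] := leqP s N; first by apply: zn0; nat_lia.
  have -> : s = N.+1 by nat_lia.
  by case: h; rewrite ?hn ?cE.
have e : t = N.+1 by nat_lia.
by subst t; rewrite xs ?zn0 ?mulr0 //; nat_lia.
Qed.

(** Raising an index by one multiplies a coordinate by [r], which leaves one constant for each flag,
    [p] and [q]. Node 1 gives [q = p R^2], and the root coordinate under [g n] leaves the factor
    [l r R^4 - 1], that is [l r^(4n-7) - 1]. *)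
Lemma all_fixed_eq0 u : (forall j, (0 < j <= n)%N -> g j u = r *: u) ->
  l * r * R ^+ 4 != 1 -> u = 0.
Proof.
move=> uj l1.
have [N2 kn] : (1 < N)%N /\ (N.+1 < n)%N by nat_lia.
have [p pE] : {p | nucoef u true 1 2 / r ^+ 3 = p} by eexists.
have [q qE] : {q | nucoef u false 1 2 / r ^+ 3 = q} by eexists.
have us h s t : (0 < s < t)%N -> (t <= n)%N ->
    nucoef u h s t = r ^+ s * r ^+ t * (if h then p else q).
  move=> st tn; rewrite chain_coef //; last by move=> k ks; apply: uj; nat_lia.
  have -> : nucoef u h 1 t = r ^+ t / r ^+ 2 * nucoef u h 1 2.
    have t2 : (1 < t)%N by nat_lia.
    elim: t t2 {s st} tn => // t IH; rewrite ltnS leq_eqVlt => /predU1P[<- _|t1 tn].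
      by rewrite mulfV ?mul1r // expf_neq0.
    rewrite (inv_right n4 l0 r0 gP (k := t)) ?IH //; try nat_lia; last by apply: uj; nat_lia.
    by rewrite (exprS r t); ring.
  by case: h; rewrite -?pE -?qE; field; rewrite ?r0.
have pq : q = p * R ^+ 2.
  have := co1_h2 n4 l0 r0 gP u (j := n) (ltnW n4) (leqnn _).
  rewrite uj // nucoefZ /tail1 big_geq // add0r.
  have -> : \sum_(3 <= s < n) m / r ^+ 3 * r ^+ s * nucoef u true s n =
      (m * \sum_(3 <= s < n) r ^+ s * r ^+ s) * (p * r ^+ n / r ^+ 3).
    rewrite mulr_sumr mulr_suml; apply: eq_big_nat => s sN.
    by rewrite us; [field; rewrite ?r0 | nat_lia | nat_lia].
  rewrite geometric_sum; [|by []|nat_lia].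
  rewrite !us; try nat_lia; move=> e.
  have -> : q = (r ^+ 1 * r ^+ n * q) / (r * r ^+ n) by field; rewrite ?r0 ?expf_neq0.
  have -> : r ^+ 1 * r ^+ n * q = r * (r ^+ 2 * r ^+ n * p) - r * ((r ^+ 3 * r ^+ 3
     - r ^+ n * r ^+ n) / r * (p * r ^+ n / r ^+ 3)) by rewrite e; ring.
  by fieldR.
have : p * (l * r * R ^+ 4 - 1) = 0.
  have := co_root n4 l0 r0 gP (ltn0Sn N) kn u.
  rewrite uj // nucoefZ /accum big_geq // add0r.
  have -> : \sum_(1 <= s < N.+1) m / l * r * (r ^+ s / r ^+ N.+1) *
      (nucoef u true s n + nucoef u false s n) =
      (m * \sum_(1 <= s < N.+1) r ^+ s * r ^+ s) * ((p + q) * r ^+ 2 / l).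
    rewrite mulr_sumr mulr_suml; apply: eq_big_nat => s sN.
    rewrite !us; try nat_lia.
    by fieldR.
  rewrite geometric_sum // us ?pq; try nat_lia.
  move=> /eqP; rewrite -subr_eq0 => /eqP e.
  by rewrite -(mulr0 (l / r ^+ 3)) -e; fieldR.
move/eqP; rewrite mulf_eq0 subr_eq0 (negPf l1) orbF => /eqP p0.
apply: nucoefP => h s t st tn; rewrite nucoef0 us //.
by case: h; rewrite ?pq p0 ?mul0r ?mulr0.
Qed.
End Irreducibility.

(** * Stable subspaces: all of [V] as soon as they contain a root, zero for generic [l] if proper *)

Section Invariant.
Variables (F : fieldType) (N : nat) (l r : F).
Local Notation n := N.+2.
Local Notation V := (nu_space F n).
Variable (g : nat -> V -> V).
Hypotheses (n4 : (4 <= n)%N) (l0 : l != 0) (r0 : r != 0).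
Hypothesis gP : nu_action n l r g (@wvec F n).
Hypothesis rN1 : forall k, (1 <= k <= n)%N -> r ^+ (2 * k) != 1.
Hypothesis rNm1 : forall k, (1 <= k <= n - 1)%N -> r ^+ (2 * k) != -1.
Local Notation m := (r^-1 - r).
Local Notation R := (r ^+ N).
Implicit Types u v : V.

Variable P : V -> Prop.
Hypothesis P0 : P 0.
Hypothesis PD : forall u v, P u -> P v -> P (u + v).
Hypothesis PZ : forall c u, P u -> P (c *: u).
Hypothesis Pg : forall k u, (0 < k <= n)%N -> P u -> P (g k u).

Let m0 : m != 0.
Proof.
have /rN1 : (1 <= 1 <= n)%N by [].
apply: contra; rewrite muln1 subr_eq0 => /eqP e.
by rewrite expr2 -{1}e mulVf.
Qed.

Local Notation root := (act_root (@wvec F n)).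
Local Notation quad := (act_quad r g).

Let PZV c u : c != 0 -> P (c *: u) -> P u.
Proof. by move=> c0 /(PZ c^-1); rewrite scalerA mulVf // scale1r. Qed.

Lemma P_quad k u : (0 < k <= n)%N -> P u -> P (quad k u).
Proof.
move=> kn Pu; rewrite /act_quad -[- u]scaleN1r; apply: PD; last exact: PZ.
by apply: PD; [do 2 apply: Pg => // | apply/PZ/Pg].
Qed.

Let ml0 : m / l != 0. Proof. by rewrite mulf_neq0 ?invr_eq0. Qed.

Lemma P_root_step k : (1 < k)%N -> (k < n)%N -> P (root k) <-> P (root k.+1).
Proof.
move=> k1 kn; split=> Pr; apply: (PZV ml0).
  have [<- _] := act_quad_right_root n4 l0 r0 gP k1 kn.
  by apply: P_quad => //; nat_lia.
have [<- _] := act_quad_left_root n4 l0 r0 gP k1 kn.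
by apply: P_quad => //; nat_lia.
Qed.

Lemma P_root13 : P (root 1) <-> P (root 3).
Proof.
split=> Pr; apply: (PZV ml0).
  by have [<- _] := act_quad31_root n4 l0 r0 gP; apply: P_quad => //; nat_lia.
by have [<- _] := act_quad13_root n4 l0 r0 gP; apply: P_quad => //; nat_lia.
Qed.

Lemma P_root2 k : (1 < k <= n)%N -> P (root k) <-> P (root 2).
Proof.
elim: k => // k IH kn; have [k1|k1] := leqP k 1; first by have -> : k = 1%N by nat_lia.
by rewrite -P_root_step; [apply: IH; nat_lia | nat_lia | nat_lia].
Qed.

Lemma P_roots k j : (0 < k <= n)%N -> (0 < j <= n)%N -> P (root k) -> P (root j).
Proof.
have r3 i : (0 < i <= n)%N -> P (root i) <-> P (root 2).
  move=> ik; have [->|i1] := eqVneq i 1%N; last by apply: P_root2; nat_lia.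
  by rewrite P_root13; apply: P_root2; nat_lia.
by move=> kn jn; rewrite !r3.
Qed.

Lemma P_full k : (0 < k <= n)%N -> P (root k) -> forall u, P u.
Proof.
move=> kn Pk; have Pr j : (0 < j <= n)%N -> P (root j).
  by move=> jn; apply: P_roots Pk.
apply: nu_space_ind => // h s t st tn.
have Pst h' s' : (0 < s')%N -> P (wvec F n h' s' s'.+1) ->
    forall t', (s' < t' <= n)%N -> P (wvec F n h' s' t').
  move=> s0 Ps; elim=> // t' IH st'.
  have [st1|st1] := leqP t' s'; first by have -> : t' = s' by nat_lia.
  rewrite -(act_right gP (k := t')); try nat_lia.
  by apply: Pg; [nat_lia | apply: IH; nat_lia].
case: h; last first.
  apply: Pst => //; try nat_lia.
  have := Pr s.+1; rewrite /act_root eqSS /=.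
  have -> : (s == 0)%N = false by nat_lia.
  by apply; nat_lia.
(* The hatted vectors start from the root of node 1, with label [(1, 2)]: generators raise the
   second index, then the first. *)
have := Pst true 1%N isT (Pr 1%N isT) => P1.
elim: s st => // s IH st; case: s IH st => [|s] IH st; first by apply: P1; nat_lia.
rewrite -(act_left gP (k := s.+1)); try nat_lia.
by apply: Pg; [nat_lia | apply: IH; nat_lia].
Qed.

(** A nonzero value of [quad k] on [P] is a multiple of the root, which would then lie in [P] and
    generate everything. *)
Lemma proper_quad0 v : ~ P v ->
  forall k u, (0 < k <= n)%N -> P u -> quad k u = 0.
Proof.
move=> nPv k u kn Pu; have [c cE] := quad_rank1 n4 l0 r0 gP u kn.
have [c0|c0] := eqVneq c 0; first by rewrite cE c0 scale0r.
by case: nPv; apply: (P_full kn); apply: (PZV c0); rewrite -cE; apply: P_quad.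
Qed.

Ltac n_lia := pose proof n4; nat_lia.

Section Irreducible.
Variable v0 : V.
Hypothesis nPv0 : ~ P v0.
Hypotheses (lr3 : l != r ^+ 3) (lNr3 : l != - r ^+ 3) (lVr : l != r^-1).
Hypotheses (lB1 : l * (R / r) ^+ 2 != r) (lB2 : l * (R / r) ^+ 2 != - r^-1).
Hypothesis lC : l * r * R ^+ 4 != 1.

Let Pq := proper_quad0 nPv0.
Local Notation sh := (shift r g).

Let Psh k u : (0 < k <= n)%N -> P u -> P (sh k u).
Proof. exact: P_shift. Qed.

Let she k u : (0 < k <= n)%N -> P u -> g k (sh k u) = - r^-1 *: sh k u.
Proof. exact: (shift_eigen r0 gP Pq). Qed.

Let shC i j u : (forall v, g i (g j v) = g j (g i v)) ->
  sh i (sh j u) = sh j (sh i u).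
Proof.
move=> c; rewrite /shift !(actB gP) !(actZ gP) c !scalerBr !opprB -!addrA.
by congr (_ + _); rewrite addrCA [in RHS]addrCA; congr (_ + _); apply: addrC.
Qed.

Let sh0 i u : (sh i u = 0) <-> (g i u = r *: u).
Proof. by rewrite /shift; split=> [/eqP|->]; rewrite ?subrr // subr_eq0 => /eqP. Qed.

Let comm i j u : (0 < i < j)%N -> (j <= n)%N -> ~~ D_edge i j ->
  g i (g j u) = g j (g i u).
Proof. exact: (act_comm n4 l0 r0 gP). Qed.

Let braid i j u : D_edge i j -> (0 < i)%N -> (j <= n)%N ->
  g i (g j (g i u)) = g j (g i (g j u)).
Proof. exact: (act_braid n4 l0 r0 gP). Qed.

Let shg k j u : (forall v, g j (g k v) = g k (g j v)) ->
  sh k (g j u) = g j (sh k u).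
Proof. exact: (shift_comm gP). Qed.

Let edgeS i : (1 < i)%N -> D_edge i i.+1.
Proof. by move=> i1; rewrite /D_edge i1 eqxx orbT. Qed.

Let noedge i j : (1 < i)%N -> (i.+1 < j)%N -> ~~ D_edge i j.
Proof. by move=> i1 ij; rewrite /D_edge; n_lia. Qed.

Lemma pair24 u : P u -> g 2%N (sh 4 u) = r *: sh 4 u.
Proof.
move=> Pu; apply/sh0.
have Py : P (sh 2 (sh 4 u)) by do 2 (apply: Psh; [n_lia|]).
have c24 v : g 2%N (g 4%N v) = g 4%N (g 2%N v) by apply: comm.
apply: (anti24_eq0 n4 l0 r0 gP rNm1) => //.
- by apply: she; [n_lia | apply: Psh].
- by rewrite shC //; apply: she => //; apply: Psh.
- by apply: Pq => //; n_lia.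
by apply: Pq; [n_lia | apply: Pg].
Qed.

(** The nodes from 4 on commute with node 2, so [eigen_conj] with [X = sh 2] carries the vanishing
    of [(g 2 - r) (g 4 - r)] along the tail of the diagram. *)
Lemma pair2 k u : (3 < k <= n)%N -> P u -> g 2%N (sh k u) = r *: sh k u.
Proof.
elim: k u => // k IH u; rewrite ltnS leq_eqVlt => /andP[/predU1P[<- _|k3 kn] Pu].
  exact: pair24.
apply/sh0; rewrite shC; last first.
  by move=> v; apply: comm; [| |apply: noedge]; n_lia.
apply/sh0; apply: (eigen_conj gP PD PZ Pg Pq (a := k) (b := k.+1)) => //.
- n_lia.
- by move=> v; apply: braid; [apply: edgeS | |]; n_lia.
- by move=> v; apply: shg => w; apply/esym/comm; [| |apply: noedge]; n_lia.
- by move=> v; apply: shg => w; apply/esym/comm; [| |apply: noedge]; n_lia.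
- move=> v Pv; apply/sh0; rewrite shC; last first.
    by move=> w; apply/esym/comm; [| |apply: noedge]; n_lia.
  by apply/sh0/IH => //; n_lia.
by move=> c v; rewrite (shiftZ gP).
Qed.

(** Now the other factor moves: with [X = sh n], from node 2 up to node [n - 2], the last one that
    commutes with node [n]. *)
Lemma pairn j u : (1 < j <= N)%N -> P u -> g j (sh n u) = r *: sh n u.
Proof.
elim: j u => // j IH u jN Pu; have [j1|j1] := leqP j 1.
  have -> : j = 1%N by n_lia.
  by apply: pair2 => //; n_lia.
apply: (eigen_conj gP PD PZ Pg Pq (a := j) (b := j.+1)) => //; try n_lia.
- by move=> v; apply: braid; [apply: edgeS | |]; n_lia.
- by move=> v; apply: shg => w; apply: comm; [| |apply: noedge]; n_lia.
- by move=> v; apply: shg => w; apply: comm; [| |apply: noedge]; n_lia.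
- by move=> v Pv; apply: IH => //; n_lia.
by move=> c v; rewrite (shiftZ gP).
Qed.

Let edge1 j : (3 < j)%N -> ~~ D_edge 1 j.
Proof. by rewrite /D_edge; n_lia. Qed.

(** For [n > 4] node 3 is covered by [pairn] and is conjugated to node 1; [n = 4] needs
    [anti14_eq0]. *)
Lemma pair1n u : P u -> g 1%N (sh n u) = r *: sh n u.
Proof.
move=> Pu; have [N2|N2] := eqVneq N 2%N; last first.
  apply: (eigen_conj gP PD PZ Pg Pq (a := 3%N) (b := 1%N)) => //; try n_lia.
  - by move=> v; apply/esym/braid => //; n_lia.
  - by move=> v; apply: shg => w; apply: comm; [| |apply: noedge]; n_lia.
  - by move=> v; apply: shg => w; apply: comm; [| |apply: edge1]; n_lia.
  - by move=> v Pv; apply: pairn => //; n_lia.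
  by move=> c v; rewrite (shiftZ gP).
have n_4 : n = 4%N by rewrite N2.
have c14 v : g 1%N (g n v) = g n (g 1%N v) by apply: comm; [| |apply: edge1]; n_lia.
have Pz : P (sh n u) by apply: Psh => //; n_lia.
have Py : P (sh 1 (sh n u)) by apply: Psh => //; n_lia.
apply/sh0; apply: (anti14_eq0 n4 l0 r0 gP rNm1) => //.
- by apply: she => //; n_lia.
- rewrite -shg; last by move=> v; apply/esym/comm.
  by rewrite pairn ?(shiftZ gP) //; n_lia.
- by rewrite shC // -n_4; apply: she; [n_lia | apply: Psh].
by apply: Pq => //; n_lia.
Qed.

Lemma fixed_n u : P u -> g n u = r *: u.
Proof.
move=> Pu; apply/sh0; apply: (anti_last_eq0 n4 l0 r0 gP rNm1) => //.
- by apply: she => //; n_lia.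
- move=> j jN; have [->|j1] := eqVneq j 1%N; first exact: pair1n.
  by apply: pairn => //; n_lia.
by apply: Pq; [n_lia | apply: Psh => //; n_lia].
Qed.

Lemma fixed_all j u : (0 < j <= n)%N -> P u -> g j u = r *: u.
Proof.
have down i v : (i < n.-1)%N -> P v -> g (n - i)%N v = r *: v.
  elim: i v => [|i IH] v iN Pv; first by rewrite subn0 fixed_n.
  have e : (n - i = (n - i.+1).+1)%N by n_lia.
  apply: (eigen_conj gP PD PZ Pg Pq (X := id) (a := (n - i)%N) (b := (n - i.+1)%N))
    => //; try n_lia.
    by move=> w; rewrite e -braid //; [apply: edgeS | |]; n_lia.
  by move=> w Pw; apply: IH => //; n_lia.
have big i v : (1 < i <= n)%N -> P v -> g i v = r *: v.
  move=> iN Pv; have e : (n - (n - i) = i)%N by n_lia.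
  by have := down (n - i)%N v; rewrite e; apply; [n_lia|].
move=> jn Pu; have [->|j1] := eqVneq j 1%N; last by apply: big => //; n_lia.
apply: (eigen_conj gP PD PZ Pg Pq (X := id) (a := 3%N) (b := 1%N)) => //; try n_lia.
  by move=> v; apply/esym/braid => //; n_lia.
by move=> v Pv; apply: big => //; n_lia.
Qed.

Lemma proper_invariant0 u : P u -> u = 0.
Proof.
by move=> Pu; apply: (all_fixed_eq0 n4 l0 r0 gP) => // j jn; apply: fixed_all.
Qed.

End Irreducible.
End Invariant.

(** * Reducibility at the special values *)

Ltac nat_cond :=
  repeat match goal with |- context [@eq_op _ ?a ?b] =>
    let T := type of a in unify T nat;
    first [ have -> : (a == b) = true by nat_lia
          | have -> : (a == b) = false by nat_lia ] end.

Section Reducible.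
Variables (F : fieldType) (n : nat).
Local Notation V := (nu_space F n).
Implicit Types u v : V.

Definition stable (g : nat -> V -> V) (P : V -> Prop) : Prop :=
  [/\ P 0, forall u v, P u -> P v -> P (u + v), forall c u, P u -> P (c *: u)
    & forall k u, (0 < k <= n)%N -> P u -> P (g k u)].

Definition has_stable g : Prop :=
  exists P, [/\ stable g P, exists2 u, P u & u != 0 & exists v, ~ P v].

Section Functionals.
Variables (I : Type) (phi : I -> bool -> nat -> nat -> F).

Definition nufun i u : F := lin_ext (W := F^o) (phi i) u.

Lemma nufunD i u v : nufun i (u + v) = nufun i u + nufun i v.
Proof. by rewrite /nufun linearD. Qed.
Lemma nufunZ i c u : nufun i (c *: u) = c * nufun i u.
Proof. by rewrite /nufun linearZ. Qed.
Lemma nufunN i u : nufun i (- u) = - nufun i u.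
Proof. by rewrite /nufun linearN. Qed.
Lemma nufun0 i : nufun i 0 = 0.
Proof. by rewrite /nufun linear0. Qed.
Lemma nufun_wvec i h s t : (0 < s < t)%N -> (t <= n)%N ->
  nufun i (wvec F n h s t) = phi i h s t.
Proof. by move=> ? ?; rewrite /nufun lin_ext_wvec. Qed.

(** The transpose of each generator permutes the functionals up to the scalar [c], so their common
    kernel is stable. *)
Lemma nufun_stable l r g c (act : nat -> I -> I) : nu_action n l r g (@wvec F n) ->
  (forall k i h s t, (0 < k <= n)%N -> (0 < s < t)%N -> (t <= n)%N ->
    nufun i (g k (wvec F n h s t)) = c * phi (act k i) h s t) ->
  stable g (fun u => forall i, nufun i u = 0).
Proof.
move=> gP actE; split=> [i|u v Pu Pv i|a u Pu i|k u kn Pu i].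
- exact: nufun0.
- by rewrite nufunD Pu Pv addr0.
- by rewrite nufunZ Pu mulr0.
have -> : nufun i (g k u) = c * nufun (act k i) u; last by rewrite Pu mulr0.
elim/nu_space_ind: u {Pu} => [|u v eu ev|a u eu|h s t st tn].
- by rewrite (act0 gP) !nufun0 mulr0.
- by rewrite (actD gP) !nufunD eu ev mulrDr.
- by rewrite (actZ gP) !nufunZ eu mulrCA.
by rewrite actE // nufun_wvec.
Qed.
End Functionals.

Opaque nufun.

Ltac nufun_eval :=
  rewrite ?(nufunD, nufunN, nufunZ);
  repeat match goal with |- context [nufun ?p ?i (wvec ?F ?n ?h ?s ?t)] =>
    rewrite (@nufun_wvec _ p i h s t); [|nat_lia|nat_lia] end.

Ltac field_goal :=
  rewrite ?exprS ?expr0 ?invrK; field; repeat (apply/andP; split);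
  first [done | assumption | apply: expf_neq0; assumption].

Variables (r : F) (g : nat -> V -> V).
Hypotheses (n4 : (4 <= n)%N) (r0 : r != 0).
Local Notation m := (r^-1 - r).
Local Notation w := (@wvec F n false).
Local Notation wh := (@wvec F n true).

Section Cube.
Hypothesis gP : nu_action n (r ^+ 3) r g (@wvec F n).

(* Squares of linear forms permuted by a Burau representation.                 *)
Definition cube_form (x : nat -> F) (h : bool) (s t : nat) : F :=
  if h then r ^+ s * r ^+ t / r ^+ 4 * (x s + r ^+ 2 * x t) ^+ 2
  else r ^+ s * r ^+ t * (x t - x s) ^+ 2.

Definition cube_act (k : nat) (x : nat -> F) (i : nat) : F :=
  if k == 1%N then
    let b := x 1%N + r ^+ 2 * x 2%N in
    if (i == 1%N) || (i == 2%N) then x i - b / r ^+ 2 else x i + m / r ^+ 3 * b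
  else if i == k.-1 then x k
  else if i == k then x k.-1 / r ^+ 2 + (1 - r ^- 2) * x k
  else x i.

Lemma cube_actE k x h s t : (0 < k <= n)%N -> (0 < s < t)%N -> (t <= n)%N ->
  nufun cube_form x (g k (wvec F n h s t)) = r * cube_form (cube_act k x) h s t.
Proof.
have l0 : r ^+ 3 != 0 by apply: expf_neq0.
case: k => // -[_|k kn] st tn.
  split_at s 1%N; last split_at s 2%N; first split_at t 2%N; case: h;
  nu_act gP; nufun_eval; rewrite /cube_form /cube_act /=; nat_cond; rewrite /=;
  field_goal.
split_at s k.+1; try split_at s k.+2; try split_at t k.+1; try split_at t k.+2;
  case: h; try (exfalso; nat_lia);
  nu_act gP; nufun_eval; rewrite /cube_form /cube_act /=; nat_cond; rewrite /=;
  field_goal.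
Qed.

Lemma cube_reducible : has_stable g.
Proof.
exists (fun u => forall x, nufun cube_form x u = 0).
split; first by apply: (nufun_stable gP) cube_actE.
  (* A mixed second difference: the squares cancel and the first half gives
     [- 2 r^6 (x 4 - x 3) (x 2 - x 1)], while the hatted half gives the opposite. *)
  exists (w 2 4 - r *: w 1 4 - r *: w 2 3 + r ^+ 2 *: w 1 3
    + r ^+ 2 *: (wh 2 4 - r *: wh 1 4 - r *: wh 2 3 + r ^+ 2 *: wh 1 3)).
    by move=> x; nufun_eval; rewrite /cube_form; field_goal.
  apply/eqP => /(congr1 (fun u => nucoef u false 2 4)).
  rewrite !(nucoefD, nucoefN, nucoefZ, nucoef0) !nucoef_wvec //=; try nat_lia.
  by move/eqP; rewrite !(mulr0, oppr0, addr0) oner_eq0.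
exists (w 1 2) => /(_ (fun i => (i == 2%N)%:R)).
rewrite nufun_wvec ?/cube_form //=; last by nat_lia.
move/eqP; rewrite subr0 expr1n mulr1 mulf_eq0.
by rewrite expr1 (negPf r0) (negPf (expf_neq0 _ r0)).
Qed.
End Cube.

Section NegCube.
Hypothesis gP : nu_action n (- r ^+ 3) r g (@wvec F n).

(* Linear forms, twisted by powers of [r], permuted by a Burau representation. *)
Definition ncube_form (x : nat -> F) (h : bool) (s t : nat) : F :=
  if h then r ^+ t / r ^+ 4 * x s + r ^+ s * x t
  else r ^+ s * x t - r ^+ t * x s.

Definition ncube_act (k : nat) (x : nat -> F) (i : nat) : F :=
  let mu := r ^- 3 - r in
  if k == 1%N then
    if i == 1%N then - x 2%N - mu * x 1%N
    else if i == 2%N then - x 1%N / r ^+ 2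
    else r * x i + mu * (r ^+ i / r ^+ 5) * x 1%N + mu * (r ^+ i / r ^+ 2) * x 2%N
  else if i == k.-1 then x k
  else if i == k then x k.-1 / r ^+ 2 - mu * x k
  else r * x i.

Lemma ncube_actE k x h s t : (0 < k <= n)%N -> (0 < s < t)%N -> (t <= n)%N ->
  nufun ncube_form x (g k (wvec F n h s t)) = 1 * ncube_form (ncube_act k x) h s t.
Proof.
have l0 : - r ^+ 3 != 0 by rewrite oppr_eq0; apply: expf_neq0.
case: k => // -[_|k kn] st tn.
  split_at s 1%N; last split_at s 2%N; first split_at t 2%N; case: h;
  nu_act gP; nufun_eval; rewrite /ncube_form /ncube_act /=; nat_cond; rewrite /=;
  field_goal.
split_at s k.+1; try split_at s k.+2; try split_at t k.+1; try split_at t k.+2;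
  case: h; try (exfalso; nat_lia);
  nu_act gP; nufun_eval; rewrite /ncube_form /ncube_act /=; nat_cond; rewrite /=;
  field_goal.
Qed.

Lemma ncube_reducible : has_stable g.
Proof.
exists (fun u => forall x, nufun ncube_form x u = 0).
split; first by apply: (nufun_stable gP) ncube_actE.
  (* The same second difference without hatted part: the forms are linear in [x], so it already
     cancels. *)
  exists (w 2 4 - r *: w 1 4 - r *: w 2 3 + r ^+ 2 *: w 1 3).
    by move=> x; nufun_eval; rewrite /ncube_form; field_goal.
  apply/eqP => /(congr1 (fun u => nucoef u false 2 4)).
  rewrite !(nucoefD, nucoefN, nucoefZ, nucoef0) !nucoef_wvec //=; try nat_lia.
  by move/eqP; rewrite !(mulr0, oppr0, addr0) oner_eq0.
exists (w 1 2) => /(_ (fun i => (i == 2%N)%:R)).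
rewrite nufun_wvec ?/ncube_form //=; last by nat_lia.
by move/eqP; rewrite mulr0 subr0 mulr1 expr1 (negPf r0).
Qed.
End NegCube.

Section Inverse.
Hypothesis gP : nu_action n (r^-1) r g (@wvec F n).

(* Identifying w_ij with its hatted version gives a quotient, on which the     *)
(* nodes 1 and 2 act in the same way.                                          *)
Definition fold_form (X : nat -> nat -> F) (h : bool) (s t : nat) : F := X s t.

Definition fold_act (k : nat) (X : nat -> nat -> F) (s t : nat) : F :=
  let j := if k == 1%N then 1%N else k.-1 in
  if s == j then if t == j.+1 then r * X s t else X j.+1 t
  else if t == j then X s j.+1
  else if s == j.+1 then
    X j t + m / r ^+ 2 * (r ^+ t / r ^+ j) * X j j.+1 - m * X s t
  else if t == j.+1 then
    X s j + m * r ^+ 2 * (r ^+ s / r ^+ j) * X j j.+1 - m * X s t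
  else r * X s t.

Lemma fold_actE k X h s t : (0 < k <= n)%N -> (0 < s < t)%N -> (t <= n)%N ->
  nufun fold_form X (g k (wvec F n h s t)) = 1 * fold_form (fold_act k X) h s t.
Proof.
have l0 : r^-1 != 0 by rewrite invr_eq0.
case: k => // -[_|k kn] st tn.
  split_at s 1%N; last split_at s 2%N; first split_at t 2%N; case: h;
  nu_act gP; nufun_eval; rewrite /fold_form /fold_act /=; nat_cond; rewrite /=;
  field_goal.
split_at s k.+1; try split_at s k.+2; try split_at t k.+1; try split_at t k.+2;
  case: h; try (exfalso; nat_lia);
  nu_act gP; nufun_eval; rewrite /fold_form /fold_act /=; nat_cond; rewrite /=;
  field_goal.
Qed.

Lemma inverse_reducible : has_stable g.
Proof.
exists (fun u => forall x, nufun fold_form x u = 0).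
split; first by apply: (nufun_stable gP) fold_actE.
  exists (w 1 2 - wh 1 2).
    by move=> x; nufun_eval; rewrite /fold_form; field_goal.
  apply/eqP => /(congr1 (fun u => nucoef u false 1 2)).
  rewrite !(nucoefD, nucoefN, nucoef0) !nucoef_wvec //=; try nat_lia.
  by move/eqP; rewrite oppr0 addr0 oner_eq0.
exists (w 1 2) => /(_ (fun i j => 1)).
rewrite nufun_wvec ?/fold_form //=; last by nat_lia.
by move/eqP; rewrite oner_eq0.
Qed.
End Inverse.

End Reducible.

Section CoefVector.
Variables (F : fieldType) (n : nat).

Definition nuvec (f : bool -> nat -> nat -> F) : nu_space F n :=
  [ffun b : nu_label n => f b.2 (val b.1).1.+1 (val b.1).2.+1 : F^o].

Lemma nucoef_nuvec f h i j : (0 < i < j)%N -> (j <= n)%N ->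
  nucoef (nuvec f) h i j = f h i j.
Proof.
case: i => [|i] //; case: j => [|j] //; rewrite ltnS => /andP[_ ij] jn.
have i_n : (i < n)%N by apply: leq_trans jn; apply: ltnW.
pose p : {p : 'I_n * 'I_n | (p.1 < p.2)%N} :=
  exist _ (Ordinal i_n, Ordinal jn) ij.
by have := nucoefE (nuvec f) (p, h); rewrite ffunE.
Qed.
End CoefVector.

(** * The stable line *)

Section Submodules.
Variables (F : fieldType) (N : nat) (l r : F).
Local Notation n := N.+2.
Local Notation V := (nu_space F n).
Variable (g : nat -> V -> V).
Hypotheses (n4 : (4 <= n)%N) (l0 : l != 0) (r0 : r != 0).
Hypothesis gP : nu_action n l r g (@wvec F n).
Hypothesis rN1 : forall k, (1 <= k <= n)%N -> r ^+ (2 * k) != 1.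
Hypothesis rNm1 : forall k, (1 <= k <= n - 1)%N -> r ^+ (2 * k) != -1.
Local Notation m := (r^-1 - r).
Local Notation R := (r ^+ N).
Local Notation quad := (act_quad r g).
Implicit Types u v d : V.

Let rX i : r ^+ i != 0. Proof. exact: expf_neq0. Qed.

Let m0 : m != 0.
Proof.
have /rN1 : (1 <= 1 <= n)%N by [].
apply: contra; rewrite muln1 subr_eq0 => /eqP e.
by rewrite expr2 -{1}e mulVf.
Qed.

(** This shows properness: the line and the reflection submodule are killed by [quad n], which is
    not zero on [V]. *)
Lemma quad_nonzero : exists v, quad n v <> 0.
Proof.
have [k1 kn] : (1 < N.+1)%N /\ (N.+1 < n)%N by nat_lia.
exists (act_root (@wvec F n) N.+1); have [-> _] := act_quad_right_root n4 l0 r0 gP k1 kn.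
move=> /(congr1 (fun u => nucoef u false N.+1 n)).
rewrite nucoefZ nucoef0 /act_root /= nucoef_wvec // !eqxx mulr1 => /eqP.
by rewrite mulf_eq0 invr_eq0 (negPf m0) (negPf l0).
Qed.

Lemma quad_eigen k u : g k u = r *: u -> quad k u = 0.
Proof.
move=> e; rewrite /act_quad e (actZ gP) e !scalerA -scalerDl -[X in _ - X]scale1r.
have c0 : r * r + m * r - 1 = 0 by field.
by rewrite -scalerBl c0 scale0r.
Qed.

Lemma quad_anti k u : g k u = - r^-1 *: u -> quad k u = 0.
Proof.
move=> e; rewrite /act_quad e (actZ gP) e !scalerA -scalerDl -[X in _ - X]scale1r.
have c0 : - r^-1 * - r^-1 + m * - r^-1 - 1 = 0 by field.
by rewrite -scalerBl c0 scale0r.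
Qed.

Lemma quad_step k u v : g k u = r *: u + v -> g k v = - r^-1 *: v -> quad k u = 0.
Proof.
move=> eu ev; rewrite /act_quad eu (actD gP) (actZ gP) eu ev.
apply/ffunP=> b; apply: (ev_inj (b := b)); rewrite !(evD, evN, evZ) [RHS]ffunE.
by field.
Qed.

Section Supported12.
Variable d : V.
Hypothesis d12 : forall h s t, (0 < s < t)%N -> (t <= n)%N -> t != 2%N ->
  nucoef d h s t = 0.

(** The coordinate formulas for [g 1] omit the pair [(1, 2)]. An identity for [g 1] is therefore
    checked at the other pairs, and the difference of its sides, supported on [(1, 2)], is killed
    with the help of another generator. *)
Lemma supported12E : d = nucoef d true 1 2 *: wvec F n true 1 2
  + nucoef d false 1 2 *: wvec F n false 1 2.
Proof.
apply: nucoefP => h s t st tn.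
rewrite nucoefD !nucoefZ !nucoef_wvec //.
have [t2|t2] := eqVneq t 2%N; last first.
  by rewrite d12 // !andbF !mulr0 addr0.
subst t; have -> : s = 1%N by nat_lia.
by case: h; rewrite /= ?mulr1 ?mulr0 ?addr0 ?add0r.
Qed.

Lemma supported12_fixed : g 3%N d = r *: d -> d = 0.
Proof.
move=> d3; rewrite supported12E.
suff z h : nucoef d h 1 2 = 0 by rewrite !z !scale0r addr0.
have [k1 k3] : (2 < n)%N /\ (0 < 1 < 2)%N by nat_lia.
have := co_rightV n4 l0 r0 gP (ltn0Sn 1) k1 d h k3.
by rewrite d3 nucoefZ d12 // !mulr0 subr0 => <-.
Qed.

(** The hypothesis is what the braid relation of nodes 1 and 3 gives for [d = g 1 u - r u] when
    [g 3 u = r u]. It is compared at the pair [(1, 3)]. *)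
Lemma supported12_braid : r *: g 3%N d = r ^+ 2 *: d + g 1%N (g 3%N d) -> d = 0.
Proof.
rewrite supported12E; move: (nucoef d true 1 2) (nucoef d false 1 2) => x y.
nu_act gP => e.
have e1 := congr1 (fun u => nucoef u false 1 3) e.
have e2 := congr1 (fun u => nucoef u true 1 3) e.
move: e1 e2; rewrite !(nucoefD, nucoefN, nucoefZ) !nucoef_wvec //=; try nat_lia.
move=> e1 e2.
have y0 : y = 0.
  have -> : y = r * ((r * (x * 0 + y * 1)) - (- m * y)) by field.
  by rewrite e1; ring.
move: e2; rewrite y0 => e2.
have -> : x = 0.
  apply: (mulfI r0); rewrite mulr0.
  have -> : r * x = r * (x * 1 + 0 * 0) by ring.
  by rewrite e2; ring.
by rewrite !scale0r addr0.
Qed.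
End Supported12.

Section Line.
Hypothesis lE : l = (r * R ^+ 4)^-1.

(** The coefficients are those forced in [all_fixed_eq0], with [p = 1] and [q = R^2]. *)
Definition line_vec : V :=
  nuvec n (fun h s t => r ^+ s * r ^+ t * (if h then 1 else R ^+ 2)).

Let uE h s t : (0 < s < t)%N -> (t <= n)%N ->
  nucoef line_vec h s t = r ^+ s * r ^+ t * (if h then 1 else R ^+ 2).
Proof. by move=> st tn; rewrite nucoef_nuvec. Qed.

Lemma line_fixedS k : (0 < k)%N -> (k < n)%N -> g k.+1 line_vec = r *: line_vec.
Proof.
move=> k0 kn; apply: nucoefP => h s t st tn; rewrite nucoefZ.
split_at s k.
  split_at t k.+1.
    case: h; first by rewrite (co_simple n4 l0 r0 gP).
    rewrite (co_root n4 l0 r0 gP) // /accum.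
    have -> : \sum_(k.+2 <= t < n.+1) r ^+ t / r ^+ k *
        (m / l / r ^+ 3 * nucoef line_vec true k.+1 t
         + m / r ^+ 2 * nucoef line_vec false k.+1 t)
      = (m * \sum_(k.+2 <= t < n.+1) r ^+ t * r ^+ t)
        * (r * (l^-1 / r ^+ 3 + R ^+ 2 / r ^+ 2)).
      rewrite mulr_sumr mulr_suml; apply: eq_big_nat => t tk.
      rewrite !uE; try nat_lia.
      by rewrite !exprS; field; rewrite ?rX ?l0 ?r0.
    have -> : \sum_(1 <= s < k) m / l * r * (r ^+ s / r ^+ k) *
        (nucoef line_vec true s k.+1 + nucoef line_vec false s k.+1)
      = (m * \sum_(1 <= s < k) r ^+ s * r ^+ s) * (r ^+ 2 / l * (1 + R ^+ 2)).
      rewrite mulr_sumr mulr_suml; apply: eq_big_nat => s sk.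
      rewrite !uE; try nat_lia.
      by rewrite !exprS; field; rewrite ?rX ?l0 ?r0.
    rewrite !geometric_sum // uE // lE !exprS expr0.
    move: (r ^+ k) (rX k) (r ^+ N) (rX N) => a a0 b b0.
    by field; rewrite ?a0 ?b0 ?r0 ?oner_eq0.
  rewrite (co_left n4 l0 r0 gP) //; try nat_lia.
  by rewrite !uE ?exprS; [ring | nat_lia..].
split_at s k.+1.
  rewrite (co_leftV n4 l0 r0 gP) //; try nat_lia.
  by rewrite !uE ?exprS; [field; rewrite ?r0 | nat_lia..].
split_at t k.
  rewrite (co_right n4 l0 r0 gP) //; try nat_lia.
  by rewrite !uE ?exprS; [ring | nat_lia..].
split_at t k.+1.
  rewrite (co_rightV n4 l0 r0 gP) //; try nat_lia.
  by rewrite !uE ?exprS; [field; rewrite ?r0 | nat_lia..].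
by rewrite (co_other n4 l0 r0 gP) //; nat_lia.
Qed.

Lemma line_fixed1 : g 1%N line_vec = r *: line_vec.
Proof.
have tailE j : (2 < j)%N -> (j <= n)%N ->
    tail1 r j line_vec = r ^+ j * (r ^+ 2 - R ^+ 2).
  move=> j2 jn; rewrite /tail1.
  have -> : \sum_(j.+1 <= t < n.+1) m / r ^+ 5 * r ^+ t * nucoef line_vec true j t
      = (m * \sum_(j.+1 <= t < n.+1) r ^+ t * r ^+ t) * (r ^+ j / r ^+ 5).
    rewrite mulr_sumr mulr_suml; apply: eq_big_nat => t tk.
    by rewrite !uE; [field; rewrite ?r0 | nat_lia..].
  have -> : \sum_(3 <= s < j) m / r ^+ 3 * r ^+ s * nucoef line_vec true s j
      = (m * \sum_(3 <= s < j) r ^+ s * r ^+ s) * (r ^+ j / r ^+ 3).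
    rewrite mulr_sumr mulr_suml; apply: eq_big_nat => t tk.
    by rewrite !uE; [field; rewrite ?r0 | nat_lia..].
  rewrite !geometric_sum // !exprS expr0.
  by move: (r ^+ j) (rX j) (r ^+ N) => a a0 b; field; rewrite ?a0 ?r0.
have off h s t : (0 < s < t)%N -> (t <= n)%N -> t != 2%N ->
    nucoef (g 1%N line_vec - r *: line_vec) h s t = 0.
  move=> st tn t2; rewrite nucoefB nucoefZ; apply/eqP; rewrite subr_eq0; apply/eqP.
  have [s2|s2] := ltnP 2 s; first by rewrite (co1_other n4 l0 r0 gP) //; nat_lia.
  have t3 : (2 < t)%N by nat_lia.
  have [s1|s1] := eqVneq s 1%N; [subst s | (have s1' : s = 2%N by nat_lia); subst s];
    case: h; rewrite ?(co1_h1 n4 l0 r0 gP) ?(co1_w1 n4 l0 r0 gP)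
      ?(co1_h2 n4 l0 r0 gP) ?(co1_w2 n4 l0 r0 gP) // ?tailE // ?uE //;
    try nat_lia; by rewrite !exprS expr0; field; rewrite ?r0.
have d0 : g 1%N line_vec - r *: line_vec = 0.
  apply: supported12_braid; first exact: off.
  have k3 : (2 < n)%N by nat_lia.
  have f3 := line_fixedS (isT : (0 < 2)%N) k3.
  rewrite !(actB gP, actZ gP) (act1_braid n4 l0 r0 gP) f3 !(actB gP, actZ gP).
  apply/ffunP=> b; apply: (ev_inj (b := b)).
  by rewrite !(evD, evN, evZ); ring.
by apply/eqP; rewrite -subr_eq0 d0.
Qed.

Lemma line_reducible : has_stable g.
Proof.
have fx k : (0 < k <= n)%N -> g k line_vec = r *: line_vec.
  by case: k => [|[|k]] // kn; [apply: line_fixed1 | apply: line_fixedS].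
exists (fun v => exists c, v = c *: line_vec); split.
- split=> [|u v [c ->] [c' ->]|a u [c ->]|k u kn [c ->]].
  + by exists 0; rewrite scale0r.
  + by exists (c + c'); rewrite scalerDl.
  + by exists (a * c); rewrite scalerA.
  + by exists (c * r); rewrite (actZ gP) fx // scalerA.
- exists line_vec; first by exists 1; rewrite scale1r.
  apply/eqP => /(congr1 (fun u => nucoef u true 1 2)); rewrite uE // nucoef0.
  by move/eqP; rewrite mulr1 mulf_eq0 !(negPf (rX _)).
have [v qv] := quad_nonzero; exists v => -[c vE]; apply: qv.
by rewrite vE (act_quadZ gP) quad_eigen ?scaler0 // fx //; nat_lia.
Qed.
End Line.
End Submodules.

Lemma sum_nat_two (F : fieldType) a b x (f : nat -> F) :
  (forall i, (a <= i < b)%N -> i != x -> i != x.+1 -> f i = 0) ->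
  (a <= x)%N -> (x.+1 < b)%N -> \sum_(a <= i < b) f i = f x + f x.+1.
Proof.
move=> f0 ax xb; rewrite (big_cat_nat _ (n := x)) //=; last by nat_lia.
rewrite sum_nat_0 ?add0r => [|i ix]; last by apply: f0; nat_lia.
rewrite big_ltn; last by nat_lia.
rewrite big_ltn // sum_nat_0 ?addr0 // => i ix; apply: f0; nat_lia.
Qed.

(** * The reflection submodule *)

Section Reflection.
Variables (F : fieldType) (N : nat) (l r : F).
Local Notation n := N.+2.
Local Notation V := (nu_space F n).
Variable (g : nat -> V -> V).
Hypotheses (n4 : (4 <= n)%N) (l0 : l != 0) (r0 : r != 0).
Hypothesis gP : nu_action n l r g (@wvec F n).
Hypothesis rN1 : forall k, (1 <= k <= n)%N -> r ^+ (2 * k) != 1.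
Hypothesis rNm1 : forall k, (1 <= k <= n - 1)%N -> r ^+ (2 * k) != -1.
Local Notation m := (r^-1 - r).
Local Notation R := (r ^+ N).
Local Notation quad := (act_quad r g).
Implicit Types u v d : V.

Let rX i : r ^+ i != 0. Proof. exact: expf_neq0. Qed.

Variable B : F.
Local Notation A := (R ^+ 2 / r ^+ 2).
(** Requiring [g K.+1 (refl K) = - r^-1 *: refl K] at the root coordinate, for the powers [r^K] and
    [r^-K] separately, gives [l = r / (R^2 B)] and [A l = r (B + 1) - 1/r]. Together they read
    [(r^2 B - 1) (B + 1) = 0], hence the two cases. *)
Hypothesis lB : (l = r ^+ 3 / R ^+ 2 /\ B = r ^- 2) \/ (l = - r / R ^+ 2 /\ B = -1).

(** Eigenvalue [- 1/r] at node [K.+1] makes each coordinate at index [K] equal to [- r] times the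
    one at [K.+1]. The ratio of unhatted to hatted coordinates is [B] when the other index is larger
    and [A] when it is smaller; [A] is the ratio [(R / r)^2] met in [anti_last_eq0]. *)
Definition refl_coef K (h : bool) (s t : nat) : F :=
  if s == K then
    if t == K.+1 then if h then 0 else r ^+ K * r * (A - B)
    else - (if h then 1 else B) * r ^+ t
  else if t == K then - (if h then 1 else A) * (r ^+ s * r ^+ 2)
  else if s == K.+1 then (if h then 1 else B) * (r ^+ t / r)
  else if t == K.+1 then (if h then 1 else A) * (r ^+ s * r)
  else 0.

(* For [l = r^(7-2n)] ([B = r^-2]) and [l = - r^(5-2n)] ([B = -1]): the analogue *)
(* of a simple root for the node K.+1 in a reflection representation.          *)
Definition refl K : V := nuvec n (refl_coef K).

Let zE K h s t : (0 < s < t)%N -> (t <= n)%N ->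
  nucoef (refl K) h s t = refl_coef K h s t.
Proof. by move=> st tn; rewrite nucoef_nuvec. Qed.

Ltac z_eval := rewrite ?zE; try nat_lia; rewrite /refl_coef ?eqxx /=; nat_cond;
  rewrite /=.

Ltac z_field :=
  rewrite ?exprS ?expr0 ?mulr1;
  repeat match goal with |- context [r ^+ ?i] =>
    move: (r ^+ i) (rX i);
    let a := fresh "a" in let a0 := fresh "a0" in intros a a0 end;
  field; repeat (apply/andP; split);
  first [done | assumption | by rewrite ?oppr_eq0 ?oner_eq0].

Lemma refl_root_far j K : (0 < j)%N -> (j < n)%N -> (0 < K < n)%N ->
  (j.+1 < K)%N \/ (K.+1 < j)%N -> accum l r j j.+1 (refl K) = 0.
Proof.
move=> j0 jn Kn [jK|Kj]; rewrite /accum.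
  rewrite [X in _ + X]sum_nat_0 => [|s sj]; last first.
    by z_eval; rewrite addr0 mulr0.
  rewrite (@sum_nat_two _ _ _ K); try nat_lia.
    by z_eval; z_field.
  by move=> t tj tK tK1; z_eval; rewrite !mulr0 addr0 mulr0.
rewrite sum_nat_0 => [|t tj]; last by z_eval; rewrite !mulr0 addr0 mulr0.
rewrite (@sum_nat_two _ _ _ K); try nat_lia.
  by z_eval; z_field.
by move=> s sj sK sK1; z_eval; rewrite addr0 mulr0.
Qed.

Lemma refl_root_up K : (0 < K)%N -> (K.+1 < n)%N ->
  accum l r K.+1 K.+2 (refl K) = - m / l * r ^+ K * r ^+ 2 * (1 + B).
Proof.
move=> K0 Kn; rewrite /accum sum_nat_0 => [|t tj]; last first.
  by z_eval; rewrite !mulr0 addr0 mulr0.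
rewrite big_nat_recr //= sum_nat_0 => [|s sj]; last first.
  by z_eval; rewrite addr0 mulr0.
by z_eval; z_field.
Qed.

Lemma refl_root_anti K : (0 < K < n)%N ->
  accum l r K K.+1 (refl K) =
    (r ^+ K * r ^+ K * r ^+ 4 - r ^+ 6 * R ^+ 2) / r * (l^-1 / r ^+ 4 + B / r ^+ 3) / r ^+ K
    + (r ^+ 2 - r ^+ K * r ^+ K) / r * (1 + A) * r ^+ 2 / l / r ^+ K.
Proof.
move=> Kn; rewrite /accum.
have -> : \sum_(K.+2 <= t < n.+1) r ^+ t / r ^+ K *
     (m / l / r ^+ 3 * nucoef (refl K) true K.+1 t
      + m / r ^+ 2 * nucoef (refl K) false K.+1 t)
  = (m * \sum_(K.+2 <= t < n.+1) r ^+ t * r ^+ t)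
    * ((l^-1 / r ^+ 4 + B / r ^+ 3) / r ^+ K).
  rewrite mulr_sumr mulr_suml; apply: eq_big_nat => t tK.
  by z_eval; z_field.
have -> : \sum_(1 <= s < K) m / l * r * (r ^+ s / r ^+ K) *
     (nucoef (refl K) true s K.+1 + nucoef (refl K) false s K.+1)
  = (m * \sum_(1 <= s < K) r ^+ s * r ^+ s) * ((1 + A) * r ^+ 2 / l / r ^+ K).
  rewrite mulr_sumr mulr_suml; apply: eq_big_nat => s sK.
  by z_eval; z_field.
rewrite !geometric_sum //; try nat_lia.
by z_field.
Qed.

Lemma refl_root_down K : (0 < K)%N -> (K.+1 < n)%N ->
  accum l r K K.+1 (refl K.+1) =
    m * r ^+ K * r ^+ 2 * (A - B)
    - (r ^+ K * r ^+ K * r ^+ 6 - r ^+ 6 * R ^+ 2) / r * (l^-1 / r ^+ 3 + B / r ^+ 2) / r ^+ K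
    - (r ^+ 2 - r ^+ K * r ^+ K) / r * (1 + A) * r ^+ 3 / l / r ^+ K.
Proof.
move=> K0 Kn; rewrite /accum big_ltn; last by nat_lia.
have -> : \sum_(K.+3 <= t < n.+1) r ^+ t / r ^+ K *
     (m / l / r ^+ 3 * nucoef (refl K.+1) true K.+1 t
      + m / r ^+ 2 * nucoef (refl K.+1) false K.+1 t)
  = (m * \sum_(K.+3 <= t < n.+1) r ^+ t * r ^+ t)
    * (- (l^-1 / r ^+ 3 + B / r ^+ 2) / r ^+ K).
  rewrite mulr_sumr mulr_suml; apply: eq_big_nat => t tK.
  by z_eval; z_field.
have -> : \sum_(1 <= s < K) m / l * r * (r ^+ s / r ^+ K) *
     (nucoef (refl K.+1) true s K.+1 + nucoef (refl K.+1) false s K.+1)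
  = (m * \sum_(1 <= s < K) r ^+ s * r ^+ s) * (- (1 + A) * r ^+ 3 / l / r ^+ K).
  rewrite mulr_sumr mulr_suml; apply: eq_big_nat => s sK.
  by z_eval; z_field.
rewrite !geometric_sum //; try nat_lia.
by z_eval; z_field.
Qed.

Lemma refl_far j K : (0 < j)%N -> (j < n)%N -> (0 < K < n)%N ->
  (j.+1 < K)%N \/ (K.+1 < j)%N -> g j.+1 (refl K) = r *: refl K.
Proof.
move=> j0 jn Kn jK; have jK' : (j != K) && (j.+1 != K) && (j != K.+1).
  by case: jK => ?; nat_lia.
apply: nucoefP => h s t st tn; rewrite nucoefZ.
split_at s j; [split_at t j.+1 |].
- case: h; first by rewrite (co_simple n4 l0 r0 gP).
  rewrite (co_root n4 l0 r0 gP) // refl_root_far //.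
  by case: jK => jK; z_eval; rewrite !mulr0 addr0.
- rewrite (co_left n4 l0 r0 gP) //; try nat_lia.
  case: jK => jK; split_at t K; try split_at t K.+1; z_eval; z_field.
split_at s j.+1.
  rewrite (co_leftV n4 l0 r0 gP) //; try nat_lia.
  case: jK => jK; split_at t K; try split_at t K.+1; z_eval; z_field.
split_at t j.
  rewrite (co_right n4 l0 r0 gP) //; try nat_lia.
  case: jK => jK; split_at s K; try split_at s K.+1; z_eval; z_field.
split_at t j.+1.
  rewrite (co_rightV n4 l0 r0 gP) //; try nat_lia.
  case: jK => jK; split_at s K; try split_at s K.+1; z_eval; z_field.
by rewrite (co_other n4 l0 r0 gP).
Qed.

Lemma refl_anti K : (0 < K)%N -> (K < n)%N ->
  g K.+1 (refl K) = - r^-1 *: refl K.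
Proof.
move=> K0 Kn; apply: nucoefP => h s t st tn; rewrite nucoefZ.
split_at s K; [split_at t K.+1 |].
- case: h; first by rewrite (co_simple n4 l0 r0 gP) // !zE // /refl_coef !eqxx !mulr0.
  rewrite (co_root n4 l0 r0 gP) // refl_root_anti; last by nat_lia.
  by z_eval; case: lB => -[-> ->]; z_field.
- rewrite (co_left n4 l0 r0 gP) //; try nat_lia.
  by z_eval; z_field.
split_at s K.+1.
  rewrite (co_leftV n4 l0 r0 gP) //; try nat_lia.
  by z_eval; z_field.
split_at t K.
  rewrite (co_right n4 l0 r0 gP) //; try nat_lia.
  by z_eval; z_field.
split_at t K.+1.
  rewrite (co_rightV n4 l0 r0 gP) //; try nat_lia.
  by z_eval; z_field.
rewrite (co_other n4 l0 r0 gP) //.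
by z_eval; rewrite !mulr0.
Qed.

Lemma refl_down K : (0 < K)%N -> (K.+1 < n)%N ->
  g K.+1 (refl K.+1) = r *: refl K.+1 + refl K.
Proof.
move=> K0 Kn; apply: nucoefP => h s t st tn; rewrite nucoefD nucoefZ.
split_at s K; [split_at t K.+1 |].
- case: h; first by rewrite (co_simple n4 l0 r0 gP) //; z_eval; z_field.
  rewrite (co_root n4 l0 r0 gP) // refl_root_down //.
  by z_eval; case: lB => -[-> ->]; z_field.
- rewrite (co_left n4 l0 r0 gP) //; try nat_lia.
  by split_at t K.+2; case: h; z_eval; z_field.
split_at s K.+1.
  rewrite (co_leftV n4 l0 r0 gP) //; try nat_lia.
  by split_at t K.+2; case: h; z_eval; z_field.
split_at t K.
  rewrite (co_right n4 l0 r0 gP) //; try nat_lia.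
  by case: h; z_eval; z_field.
split_at t K.+1.
  rewrite (co_rightV n4 l0 r0 gP) //; try nat_lia.
  by case: h; z_eval; z_field.
rewrite (co_other n4 l0 r0 gP) //; try nat_lia.
by split_at s K.+2; try split_at t K.+2; case: h; z_eval; z_field.
Qed.

Lemma refl_up K : (0 < K)%N -> (K.+1 < n)%N ->
  g K.+2 (refl K) = r *: refl K + refl K.+1.
Proof.
move=> K0 Kn; apply: nucoefP => h s t st tn; rewrite nucoefD nucoefZ.
split_at s K.+1; [split_at t K.+2 |].
- case: h; first by rewrite (co_simple n4 l0 r0 gP) //; z_eval; z_field.
  rewrite (co_root n4 l0 r0 gP) // refl_root_up //.
  by z_eval; case: lB => -[-> ->]; z_field.
- rewrite (co_left n4 l0 r0 gP) //; try nat_lia.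
  by case: h; z_eval; z_field.
split_at s K.+2.
  rewrite (co_leftV n4 l0 r0 gP) //; try nat_lia.
  by case: h; z_eval; z_field.
split_at t K.+1.
  rewrite (co_right n4 l0 r0 gP) //; try nat_lia.
  by split_at s K; case: h; z_eval; z_field.
split_at t K.+2.
  rewrite (co_rightV n4 l0 r0 gP) //; try nat_lia.
  by split_at s K; case: h; z_eval; z_field.
rewrite (co_other n4 l0 r0 gP) //.
by split_at s K; try split_at t K; case: h; z_eval; z_field.
Qed.

Lemma refl_tail j K : (2 < j)%N -> (j <= n)%N -> (0 < K < n)%N ->
  tail1 r j (refl K) =
    if (K < 3)%N then if K.+1 == j then r - A * r
                      else if K == 2 then m * (r ^+ j / r) else 0
    else if j == K then A * r ^+ 2 - r ^+ 4
    else if j == K.+1 then r ^+ 3 - A * r else 0.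
Proof.
move=> j2 jn Kn; rewrite /tail1.
have [K3|K3] := ltnP K 3.
  have [Kj|Kj] := eqVneq K.+1 j.
    subst j; have K2 : K = 2%N by nat_lia.
    subst K; rewrite [X in _ + X]big_geq // addr0.
    have -> : \sum_(4 <= t < n.+1) m / r ^+ 5 * r ^+ t * nucoef (refl 2) true 3 t
        = (m * \sum_(4 <= t < n.+1) r ^+ t * r ^+ t) / r ^+ 6.
      rewrite mulr_sumr mulr_suml; apply: eq_big_nat => t tK.
      by z_eval; z_field.
    by rewrite geometric_sum //; z_field.
  rewrite sum_nat_0 => [|t tj]; last by z_eval; rewrite mulr0.
  rewrite add0r; have [K2|K2] := eqVneq K 2%N.
    subst K; rewrite sum_nat_head; first last.
    - by move=> s sj; z_eval; rewrite mulr0.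
    - by nat_lia.
    by z_eval; z_field.
  by rewrite sum_nat_0 // => s sj; z_eval; rewrite mulr0.
split_at j K.
  have -> : \sum_(K.+1 <= t < n.+1) m / r ^+ 5 * r ^+ t * nucoef (refl K) true K t
      = (m * \sum_(K.+2 <= t < n.+1) r ^+ t * r ^+ t) * (- 1 / r ^+ 5).
    rewrite big_ltn; last by nat_lia.
    rewrite [in RHS]mulr_sumr [in RHS]mulr_suml; z_eval; rewrite mulr0 add0r.
    by apply: eq_big_nat => t tK; z_eval; z_field.
  have -> : \sum_(3 <= s < K) m / r ^+ 3 * r ^+ s * nucoef (refl K) true s K
      = (m * \sum_(3 <= s < K) r ^+ s * r ^+ s) * (- 1 / r).
    rewrite mulr_sumr mulr_suml; apply: eq_big_nat => t tK.
    by z_eval; z_field.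
  by rewrite !geometric_sum //; try nat_lia; rewrite ?eqxx; z_field.
split_at j K.+1.
  have -> : \sum_(K.+2 <= t < n.+1) m / r ^+ 5 * r ^+ t * nucoef (refl K) true K.+1 t
      = (m * \sum_(K.+2 <= t < n.+1) r ^+ t * r ^+ t) * (1 / r ^+ 6).
    rewrite mulr_sumr mulr_suml; apply: eq_big_nat => t tK.
    by z_eval; z_field.
  have -> : \sum_(3 <= s < K.+1) m / r ^+ 3 * r ^+ s * nucoef (refl K) true s K.+1
      = (m * \sum_(3 <= s < K) r ^+ s * r ^+ s) * (1 / r ^+ 2).
    rewrite big_nat_recr //= [in RHS]mulr_sumr [in RHS]mulr_suml; z_eval; rewrite mulr0 addr0.
    by apply: eq_big_nat => t tK; z_eval; z_field.
  by rewrite !geometric_sum //; try nat_lia; rewrite ?eqxx; nat_cond; z_field.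
nat_cond; have [jK|jK] := ltnP j K.
  rewrite [X in _ + X]sum_nat_0 => [|s sj]; last by z_eval; rewrite mulr0.
  rewrite (@sum_nat_two _ _ _ K); try nat_lia; first by z_eval; z_field.
  by move=> t tj tK tK1; z_eval; rewrite !mulr0.
rewrite sum_nat_0 => [|t tj]; last by z_eval; rewrite mulr0.
rewrite (@sum_nat_two _ _ _ K); try nat_lia; first by z_eval; z_field.
by move=> s sj sK sK1; z_eval; rewrite mulr0.
Qed.
Ltac co1_eval := rewrite ?(co1_h1 n4 l0 r0 gP) ?(co1_w1 n4 l0 r0 gP)
  ?(co1_h2 n4 l0 r0 gP) ?(co1_w2 n4 l0 r0 gP) //.

Lemma off12 u v : (forall h s t, (2 < s < t)%N -> (t <= n)%N ->
    nucoef u h s t = nucoef v h s t) ->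
  (forall h t, (2 < t <= n)%N -> nucoef u h 1 t = nucoef v h 1 t) ->
  (forall h t, (2 < t <= n)%N -> nucoef u h 2 t = nucoef v h 2 t) ->
  forall h s t, (0 < s < t)%N -> (t <= n)%N -> t != 2%N -> nucoef (u - v) h s t = 0.
Proof.
move=> e3 e1 e2 h s t st tn t2; rewrite nucoefB; apply/eqP; rewrite subr_eq0.
apply/eqP; have [s2|s2] := ltnP 2 s; first by apply: e3; nat_lia.
have [s1|s1] := eqVneq s 1%N; first by subst s; apply: e1; nat_lia.
have s2' : s = 2%N by nat_lia.
by subst s; apply: e2; nat_lia.
Qed.

Lemma refl_fixed1 K : (2 < K)%N -> (K < n)%N -> g 1%N (refl K) = r *: refl K.
Proof.
move=> K2 Kn; apply/eqP; rewrite -subr_eq0; apply/eqP.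
have K3 : (K < 3)%N = false by nat_lia.
set d := _ - _.
have off h s t : (0 < s < t)%N -> (t <= n)%N -> t != 2%N -> nucoef d h s t = 0.
  apply: off12 => {}h {}s.
  - by move=> t' st tn; rewrite nucoefZ (co1_other n4 l0 r0 gP).
  - move=> /andP[s2 sn]; rewrite nucoefZ.
    by split_at s K; try split_at s K.+1; case: h; co1_eval;
      rewrite ?refl_tail ?K3 ?eqxx //; try nat_lia; z_eval; z_field.
  - move=> /andP[s2 sn]; rewrite nucoefZ.
    by split_at s K; try split_at s K.+1; case: h; co1_eval;
      rewrite ?refl_tail ?K3 ?eqxx //; try nat_lia; z_eval; z_field.
(* Since [g 1] commutes with [g K.+1], the difference is again an eigenvector there, and as [K > 2]
   this kills the pair [(1, 2)]. *)
have dK : g K.+1 d = - r^-1 *: d.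
  have K0 : (0 < K)%N by nat_lia.
  have c v : g 1%N (g K.+1 v) = g K.+1 (g 1%N v).
    by apply: (act1_commS n4 l0 r0 gP) => //; right.
  rewrite /d (actB gP) (actZ gP) -c refl_anti // (actZ gP).
  by rewrite scalerBr !scalerA [r * _]mulrC.
rewrite (supported12E n4 off) !(anti_other n4 l0 r0 gP rNm1 _ Kn dK) ?scale0r ?addr0 //;
  nat_lia.
Qed.

Let n2 : (2 < n)%N. Proof. exact: ltnW. Qed.
Let down2 : g 2%N (refl 2) = r *: refl 2 + refl 1.
Proof. exact: refl_down. Qed.
Let up1 : g 3%N (refl 1) = r *: refl 1 + refl 2.
Proof. exact: refl_up. Qed.
Let anti2 : g 3%N (refl 2) = - r^-1 *: refl 2.
Proof. exact: refl_anti. Qed.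
Let down3 : g 3%N (refl 3) = r *: refl 3 + refl 2.
Proof. exact: refl_down. Qed.
Let fixed3 : g 1%N (refl 3) = r *: refl 3.
Proof. by apply: refl_fixed1. Qed.

(* The vector of the node 1. It equals [refl 1] when [B = r^-2].               *)
Definition refl_fork : V := g 1%N (refl 2) - r *: refl 2.

Let vec_inj u v : (forall b, ev b u = ev b v) -> u = v.
Proof. by move=> e; apply/ffunP=> b; apply: (ev_inj (e b)). Qed.

Ltac vec_ring := apply: vec_inj => ?;
  rewrite !(evD, evN, evZ); field; rewrite ?r0 //.

(** No coordinates of [g 1] are needed: [refl 2 = (g 3 - r) (refl 3)] where [g 1] multiplies
    [refl 3] by [r], and the braid relation does the rest. *)
Let g31_2 : g 3%N (g 1%N (refl 2)) = r *: g 1%N (refl 2) - r ^+ 2 *: refl 2.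
Proof.
have e2 : refl 2 = g 3%N (refl 3) - r *: refl 3 by rewrite down3 addrC addKr.
have e1 : g 1%N (refl 2) = g 1%N (g 3%N (refl 3)) - r ^+ 2 *: refl 3.
  by rewrite e2 (actB gP) (actZ gP) fixed3 scalerA.
have e3 : g 3%N (g 1%N (g 3%N (refl 3))) = r *: g 1%N (g 3%N (refl 3)).
  by rewrite -(act1_braid n4 l0 r0 gP) fixed3 !(actZ gP).
rewrite e1 (actB gP) (actZ gP) e3 e2.
move: (g 1%N (g 3%N (refl 3))) (g 3%N (refl 3)) => x y.
by vec_ring.
Qed.

Lemma refl_fork3 : g 3%N refl_fork = r *: refl_fork + refl 2.
Proof.
by rewrite /refl_fork (actB gP) (actZ gP) g31_2 anti2; move: (g 1%N _) => x; vec_ring.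
Qed.

(** As [r *: refl_fork] is [g 3 (g 1 (refl 2))], the braid relation moves the eigenvalue of [g 3] on
    [refl 2] over to [g 1]. *)
Lemma refl_fork1 : g 1%N refl_fork = - r^-1 *: refl_fork.
Proof.
have e : g 3%N (g 1%N (refl 2)) = r *: refl_fork.
  by rewrite g31_2 /refl_fork scalerBr scalerA.
apply: (scalerI r0); rewrite -(actZ gP) -e (act1_braid n4 l0 r0 gP) anti2.
by rewrite !(actZ gP) e !scalerA mulrC.
Qed.

Lemma refl_fork_far k : (2 < k)%N -> (k < n)%N -> g k.+1 refl_fork = r *: refl_fork.
Proof.
move=> k2 kn; have c v : g 1%N (g k.+1 v) = g k.+1 (g 1%N v).
  by apply: (act1_commS n4 l0 r0 gP) => //; right.
rewrite /refl_fork (actB gP) (actZ gP) -c; have [k3|k3] := eqVneq k 3%N.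
  subst k; have -> : g 4%N (refl 2) = r *: refl 2 + refl 3.
    exact: refl_up.
  by rewrite (actD gP) (actZ gP) fixed3; move: (g 1%N _) => x; vec_ring.
have k4 : (3 < k)%N by nat_lia.
rewrite (refl_far _ _ _ (or_intror k4)) //; last by nat_lia.
by rewrite (actZ gP) scalerBr.
Qed.

Lemma refl_fork_fold : B = r ^- 2 -> g 1%N (refl 2) = g 2%N (refl 2).
Proof.
move=> BE; apply/eqP; rewrite -subr_eq0; apply/eqP.
apply: (supported12_fixed n4 l0 r0 gP).
  rewrite down2; apply: off12 => {}h {}s.
  - move=> t' st tn; rewrite nucoefD nucoefZ (co1_other n4 l0 r0 gP) //.
    by rewrite [X in _ + X]zE /refl_coef; try nat_lia; nat_cond; rewrite addr0.
  - move=> /andP[s2 sn]; rewrite nucoefD nucoefZ.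
    by split_at s 3%N; case: h; co1_eval; rewrite ?refl_tail ?eqxx //;
      try nat_lia; z_eval; rewrite ?BE; z_field.
  - move=> /andP[s2 sn]; rewrite nucoefD nucoefZ.
    by split_at s 3%N; case: h; co1_eval; rewrite ?refl_tail ?eqxx //;
      try nat_lia; z_eval; rewrite ?BE; z_field.
rewrite (actB gP) g31_2 down2 (actD gP) (actZ gP) anti2 up1.
by move: (g 1%N _) => x; vec_ring.
Qed.

Lemma refl_fork_fixed : B = -1 -> g 1%N (refl 1) = r *: refl 1.
Proof.
move=> BE; apply/eqP; rewrite -subr_eq0; apply/eqP.
apply: (supported12_braid n4 r0 gP).
  apply: off12 => {}h {}s.
  - by move=> t' st tn; rewrite nucoefZ (co1_other n4 l0 r0 gP).
  - move=> /andP[s2 sn]; rewrite nucoefZ.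
    by case: h; co1_eval; rewrite ?refl_tail ?eqxx //;
      try nat_lia; z_eval; rewrite ?BE; z_field.
  - move=> /andP[s2 sn]; rewrite nucoefZ.
    by case: h; co1_eval; rewrite ?refl_tail ?eqxx //;
      try nat_lia; z_eval; rewrite ?BE; z_field.
have e2 : g 1%N (refl 2) = r *: refl 2 + refl_fork by rewrite /refl_fork addrC subrK.
rewrite !(actB gP, actZ gP) (act1_braid n4 l0 r0 gP) !(up1, actD gP, actZ gP) e2.
rewrite !(up1, anti2, refl_fork3, actD gP, actZ gP).
by move: (g 1%N _) (g 3%N (g 1%N _)) refl_fork => x y z; vec_ring.
Qed.

Section Closure.
Variable X : V -> Prop.

Definition linear_pred (Q : V -> Prop) :=
  [/\ Q 0, forall u v, Q u -> Q v -> Q (u + v) & forall c u, Q u -> Q (c *: u)].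

(** The span of [X] is encoded as the intersection of the linear predicates containing it. Stability
    then only concerns generators, by pulling such a predicate back along [g k]. *)
Lemma closure_reducible :
  (forall k x Q, (0 < k <= n)%N -> linear_pred Q -> (forall y, X y -> Q y) ->
    X x -> Q (g k x)) ->
  (exists2 x, X x & x != 0) -> (forall x, X x -> quad n x = 0) -> has_stable g.
Proof.
move=> gX [x Xx x0] qX.
exists (fun u => forall Q, linear_pred Q -> (forall y, X y -> Q y) -> Q u); split.
- split=> [Q []//|u v Pu Pv Q QP QX|c u Pu Q QP QX|k u kn Pu Q QP QX].
  + by case: (QP) => _ QD _; apply: QD; [apply: Pu | apply: Pv].
  + by case: (QP) => _ _ QZ; apply: QZ; apply: Pu.
  apply: (Pu (fun v => Q (g k v))) => [|y Xy]; last exact: (gX k y).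
  case: QP => Q0 QD QZ; split=> [|u' v' Qu Qv|c u' Qu].
  + by rewrite (act0 gP).
  + by rewrite (actD gP); apply: QD.
  + by rewrite (actZ gP); apply: QZ.
- by exists x => // Q _; apply.
have [v qv] := quad_nonzero n4 l0 r0 gP rN1; exists v => Pv; apply: qv.
apply: (Pv (fun u => quad n u = 0)) => //; split=> [|u u' qu qu'|c u qu].
- by rewrite -(scale0r v) (act_quadZ gP) !scale0r.
- by rewrite (act_quadD gP) qu qu' addr0.
- by rewrite (act_quadZ gP) qu scaler0.
Qed.
End Closure.

Lemma refl_reducible : has_stable g.
Proof.
pose X u := u = refl_fork \/ exists2 K, (0 < K < n)%N & u = refl K.
have Xr K : (0 < K < n)%N -> X (refl K) by right; exists K.
(* For [B = -1] the vectors of nodes 1 and 2 behave as for two non-adjacent nodes; for [B = r^-2]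
   the fork is folded and the two vectors coincide. *)
have f12 : (g 2%N refl_fork = r *: refl_fork /\ g 1%N (refl 1) = r *: refl 1)
    \/ (g 2%N refl_fork = - r^-1 *: refl_fork /\ g 1%N (refl 1) = - r^-1 *: refl 1).
  case: lB => -[_ BE]; [right | left; split].
  - have e : refl_fork = refl 1 by rewrite /refl_fork refl_fork_fold // down2 addrC addKr.
    split; last by rewrite -e refl_fork1.
    by rewrite e; apply: refl_anti.
  - have c v : g 1%N (g 2%N v) = g 2%N (g 1%N v).
      by apply: (act1_commS n4 l0 r0 gP) => //; left.
    rewrite {1}/refl_fork (actB gP) (actZ gP) -c down2 (actD gP) (actZ gP) refl_fork_fixed //.
    by rewrite /refl_fork; move: (g 1%N _) => x; vec_ring.
  - exact: refl_fork_fixed.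
apply: (@closure_reducible X).
- move=> k x Q kn [Q0 QD QZ] QX [->|[K Kn ->]].
    case: k kn => [|[|[|[|k]]]] // kn.
    + by rewrite refl_fork1; apply/QZ/QX; left.
    + by case: f12 => -[-> _]; apply/QZ/QX; left.
    + by rewrite refl_fork3; apply: QD; [apply/QZ/QX; left | apply/QX/Xr].
    + by rewrite refl_fork_far //; apply/QZ/QX; left.
  case: k kn => [|[|k]] // kn.
    have [K2|K2] := ltnP 2 K.
      by rewrite refl_fixed1 //; [apply/QZ/QX/Xr | case/andP: Kn].
    have [K1|K1] := eqVneq K 1%N; first subst K.
      by case: f12 => -[_ ->]; apply/QZ/QX/Xr.
    have -> : K = 2%N by nat_lia.
    have -> : g 1%N (refl 2) = r *: refl 2 + refl_fork by rewrite /refl_fork addrC subrK.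
    by apply: QD; [apply/QZ/QX/Xr | apply: QX; left].
  have [e|e] := eqVneq K k.+1; first subst K.
    by rewrite refl_anti //; apply/QZ/QX/Xr.
  have [e1|e1] := eqVneq K k.+2; first subst K.
    by rewrite refl_down //; apply: QD;
      [apply/QZ/QX/Xr | apply/QX/Xr; nat_lia].
  have [e2|e2] := eqVneq K k; first subst K.
    by rewrite refl_up; try nat_lia; apply: QD;
      [apply/QZ/QX/Xr | apply/QX/Xr; nat_lia].
  rewrite refl_far //; first exact/QZ/QX/Xr.
  by have [?|?] := ltnP k K; [left | right]; nat_lia.
- exists (refl 1); first exact: Xr.
  apply/eqP => /(congr1 (fun u => nucoef u true 1 3)); rewrite zE //.
  rewrite /refl_coef /= nucoef0 => /eqP.
  by rewrite mulNr mul1r oppr_eq0 (negPf (rX _)).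
move=> x [->|[K Kn ->]].
  by apply: (quad_eigen r0 gP); apply: refl_fork_far; nat_lia.
have [e|e] := eqVneq K N.+1; first subst K.
  by apply: (quad_anti r0 gP); apply: refl_anti.
have [e1|e1] := eqVneq K N; first subst K.
  apply: (quad_step r0 gP (v := refl N.+1)).
    by apply: refl_up; nat_lia.
  exact: refl_anti.
by apply: (quad_eigen r0 gP); apply: refl_far => //; nat_lia.
Qed.
End Reflection.

Lemma special_valuesE (F : fieldType) N (r : F) : (2 <= N)%N -> r != 0 ->
  special_values N.+2 r =
    [:: (r * (r ^+ N) ^+ 4)^-1; r ^+ 3 / (r ^+ N) ^+ 2; - r / (r ^+ N) ^+ 2;
        r ^+ 3; r^-1; - r ^+ 3].
Proof.
move=> N2 r0; rewrite /special_values.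
have -> : (4 * N.+2 - 7 = 1 + N * 4)%N by nat_lia.
have e7 : (N * 2 = 2 * N.+2 - 7 + 3)%N by nat_lia.
have e5 : (N * 2 = 2 * N.+2 - 5 + 1)%N by nat_lia.
have rX i : r ^+ i != 0 by exact: expf_neq0.
rewrite -!exprM {1}e7 e5 !exprD expr1.
by congr [:: _; _; _; _; _; _]; field; rewrite ?rX ?r0.
Qed.

Section SpecialValues.
Variables (F : fieldType) (N : nat) (l r : F).
Local Notation n := N.+2.
Local Notation V := (nu_space F n).
Variable (g : nat -> V -> V).
Hypotheses (n4 : (4 <= n)%N) (l0 : l != 0) (r0 : r != 0).
Hypothesis gP : nu_action n l r g (@wvec F n).
Hypothesis rN1 : forall k, (1 <= k <= n)%N -> r ^+ (2 * k) != 1.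
Hypothesis rNm1 : forall k, (1 <= k <= n - 1)%N -> r ^+ (2 * k) != -1.

Lemma special_reducible : l \in special_values n r -> has_stable g.
Proof.
rewrite special_valuesE // !inE => /or4P[/eqP e|/eqP e|/eqP e|/or3P[]/eqP e].
- exact: (line_reducible n4 l0 r0 gP).
- by apply: (refl_reducible n4 l0 r0 gP rN1 rNm1 (B := r ^- 2)); left.
- by apply: (refl_reducible n4 l0 r0 gP rN1 rNm1 (B := -1)); right.
- by move: gP; rewrite e; apply: cube_reducible.
- by move: gP; rewrite e; apply: inverse_reducible.
- by move: gP; rewrite e; apply: ncube_reducible.
Qed.

Lemma generic_irreducible P u v : l \notin special_values n r -> stable g P ->
  ~ P v -> P u -> u = 0.
Proof.
move=> ls [P0 PD PZ Pg] nPv Pu; move: ls; rewrite special_valuesE // !inE.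
rewrite !negb_or => /and5P[lC lB1 lB2 lr3 /andP[lVr lNr3]].
have R0 : r ^+ N != 0 by exact: expf_neq0.
apply: (proper_invariant0 n4 l0 r0 gP rN1 rNm1 P0 PD PZ Pg nPv) => //.
- apply: contraNneq lB1 => e; apply/eqP.
  have -> : l = l * (r ^+ N / r) ^+ 2 * (r ^+ 2 / (r ^+ N) ^+ 2).
    by move: (r ^+ N) R0 => a a0; field; rewrite a0 r0.
  by rewrite e exprS; ring.
- apply: contraNneq lB2 => e; apply/eqP.
  have -> : l = l * (r ^+ N / r) ^+ 2 * (r ^+ 2 / (r ^+ N) ^+ 2).
    by move: (r ^+ N) R0 => a a0; field; rewrite a0 r0.
  by rewrite e; move: (r ^+ N) R0 => a a0; field; rewrite a0 r0.
- apply: contraNneq lC => e; apply/eqP.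
  have -> : l = (l * r * (r ^+ N) ^+ 4) / (r * (r ^+ N) ^+ 4).
    by move: (r ^+ N) R0 => a a0; field; rewrite a0 r0.
  by rewrite e mul1r.
Qed.
End SpecialValues.
About proper_quad0.

(** * Representations of the CGW algebra *)

Section FreeEval.
Variables (K : fieldType) (X : choiceType) (S : nzRingType).
Variables (f : {rmorphism K -> S}) (G : X -> S).
Hypothesis fG : forall c x, GRing.comm (f c) (G x).

Definition word_eval (w : {fmonom X}) : S := \prod_(x <- (w : seq X)) G x.

Lemma word_eval_is_mmorphism : mmorphism word_eval.
Proof.
split=> [x y|]; last by rewrite /word_eval fm1 big_nil.
by rewrite /word_eval fmM big_cat.
Qed.
HB.instance Definition _ :=
  isMultiplicative.Build _ _ word_eval word_eval_is_mmorphism.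

Definition free_eval (a : free_algebra K X) : S := mmap f word_eval a.

Lemma free_evalB a b : free_eval (a - b) = free_eval a - free_eval b.
Proof. exact: raddfB. Qed.

Lemma free_evalZ c a : free_eval (c *: a) = f c * free_eval a.
Proof. exact: mmapZ. Qed.

Let free_eval_comm (a : free_algebra K X) x y : GRing.comm (f a@_x) (word_eval y).
Proof.
rewrite /word_eval /=.
by apply: big_ind => [|u v cu cv|i _]; [apply: commr1 | apply: commrM | apply: fG].
Qed.

Lemma free_evalM a b : free_eval (a * b) = free_eval a * free_eval b.
Proof. exact: (commr_mmap_is_multiplicative free_eval_comm).1. Qed.

Lemma free_eval1 : free_eval 1 = 1.
Proof. exact: mmap1. Qed.

Lemma free_eval_gen x : free_eval (free_gen K x) = G x.
Proof. by rewrite /free_eval mmapU /= rmorph1 mul1r /word_eval fmU big_seq1. Qed.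

End FreeEval.

Section QuotientLift.
Variables (K : fieldType) (A : lalgType K) (Rel : A -> Prop) (S : nzRingType).
Variables (f : K -> S) (ev : A -> S).
Hypothesis evB : forall a b, ev (a - b) = ev a - ev b.
Hypothesis evM : forall a b, ev (a * b) = ev a * ev b.
Hypothesis ev1 : ev 1 = 1.
Hypothesis evZ : forall c a, ev (c *: a) = f c * ev a.
Hypothesis ev_rel : forall a, Rel a -> ev a = 0.

Local Notation Q := (ideal_quotient Rel).

Definition quotient_lift (x : Q) : S := ev (repr x).

Let ev0 : ev 0 = 0.
Proof. by rewrite -(subrr 0) evB subrr. Qed.

Let evD a b : ev (a + b) = ev a + ev b.
Proof. by rewrite -{1}[b]opprK -[- b]sub0r !evB ev0 sub0r opprK. Qed.

Lemma relator_braid x y :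
  ev (x * y * x - y * x * y) = ev x * ev y * ev x - ev y * ev x * ev y.
Proof. by rewrite evB !evM. Qed.

Lemma relator_comm x y : ev (x * y - y * x) = ev x * ev y - ev y * ev x.
Proof. by rewrite evB !evM. Qed.

Lemma relator_quad l m x y : ev (m *: y - l *: (x ^+ 2 + m *: x - 1)) =
    f m * ev y - f l * (ev x * ev x + f m * ev x - 1).
Proof. by rewrite evB !evZ evB evD evZ expr2 evM ev1. Qed.

Lemma relator_ge x y c : ev (x * y - c *: y) = ev x * ev y - f c * ev y.
Proof. by rewrite evB evM evZ. Qed.

Lemma relator_ege x y c : ev (y * x * y - c *: y) = ev y * ev x * ev y - f c * ev y.
Proof. by rewrite evB !evM evZ. Qed.

Lemma quotient_lift_pi a : quotient_lift (iq_pi Rel a) = ev a.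
Proof.
apply/eqP; rewrite -subr_eq0 -evB; apply/eqP.
have : ideal_gen Rel (repr (iq_pi Rel a) - a) by exact: iq_repr.
elim=> [|b s c Ss|x y _ ex _ ey]; first exact: ev0.
  by rewrite !evM (ev_rel Ss) mulr0 mul0r.
by rewrite evD ex ey addr0.
Qed.

Lemma iq_piW (P : Q -> Prop) : (forall a, P (iq_pi Rel a)) -> forall x, P x.
Proof. exact: ideal_quotientW. Qed.

Lemma quotient_liftD x y :
  quotient_lift (x + y) = quotient_lift x + quotient_lift y.
Proof.
elim/iq_piW: x => x; elim/iq_piW: y => y.
by rewrite -raddfD !quotient_lift_pi evD.
Qed.

Lemma quotient_liftM x y :
  quotient_lift (x * y) = quotient_lift x * quotient_lift y.
Proof.
elim/iq_piW: x => x; elim/iq_piW: y => y.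
by rewrite -rmorphM !quotient_lift_pi evM.
Qed.

Lemma quotient_lift1 : quotient_lift 1 = 1.
Proof. by rewrite -(rmorph1 (iq_pi Rel)) quotient_lift_pi. Qed.

Lemma quotient_liftZ c x : quotient_lift (c *: x) = f c * quotient_lift x.
Proof. by elim/iq_piW: x => x; rewrite -linearZ !quotient_lift_pi evZ. Qed.

End QuotientLift.

Section CGWLift.
Variables (K : fieldType) (n : nat) (l m : K) (S : nzRingType).
Variables (f : {rmorphism K -> S}) (G E : 'I_n -> S).
Hypothesis fG : forall c i, GRing.comm (f c) (G i).
Hypothesis fE : forall c i, GRing.comm (f c) (E i).
Hypothesis G_braid : forall i j, D_adj i j -> G i * G j * G i = G j * G i * G j.
Hypothesis G_comm : forall i j, i != j -> ~~ D_adj i j -> G i * G j = G j * G i.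
Hypothesis GE_quad : forall i, f m * E i = f l * (G i * G i + f m * G i - 1).
Hypothesis GE_root : forall i, G i * E i = f l^-1 * E i.
Hypothesis EGE : forall i j, D_adj i j -> E i * G j * E i = f l * E i.

(** [S] is not assumed to be an algebra over [K]: a morphism [f] whose values commute with the
    images of the generators is enough. This covers scalars in [K = F] as well as in a proper
    subfield of [F]. *)
Lemma cgw_lift : exists rho : cgw n l m -> S,
  [/\ forall a b, rho (a + b) = rho a + rho b,
      forall c a, rho (c *: a) = f c * rho a,
      rho 1 = 1, forall a b, rho (a * b) = rho a * rho b
    & forall i, rho (cgw_g l m i) = G i].
Proof.
pose GE x := match x with inl i => G i | inr i => E i end.
have fGE c x : GRing.comm (f c) (GE x) by case: x => i; [apply: fG | apply: fE].
pose ev := free_eval f GE.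
have evB a b : ev (a - b) = ev a - ev b by exact: free_evalB.
have evM a b : ev (a * b) = ev a * ev b by exact: free_evalM.
have ev1 : ev 1 = 1 by exact: free_eval1.
have evZ c a : ev (c *: a) = f c * ev a by exact: free_evalZ.
have evG i : ev (free_gen K (inl i)) = G i by exact: free_eval_gen.
have evE i : ev (free_gen K (inr i)) = E i by exact: free_eval_gen.
have ev_braid := relator_braid evB evM.
have ev_comm := relator_comm evB evM.
have ev_quad := relator_quad evB evM ev1 evZ.
have ev_ge := relator_ge evB evM evZ.
have ev_ege := relator_ege evB evM evZ.
have ev_rel a : cgw_relator l m a -> ev a = 0.
  case=> [_ [i j ij|i j ij nij]|i|i|i j ij].
  - by rewrite ev_braid !evG G_braid // subrr.
  - by rewrite ev_comm !evG G_comm // subrr.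
  - by rewrite ev_quad evE !evG GE_quad subrr.
  - by rewrite ev_ge evE evG GE_root subrr.
  - by rewrite ev_ege evE evG EGE // subrr.
exists (quotient_lift ev); split.
- exact: quotient_liftD.
- exact: quotient_liftZ.
- exact: quotient_lift1.
- exact: quotient_liftM.
- by move=> i; rewrite quotient_lift_pi.
Qed.

End CGWLift.

Section Existence.
Variables (K F : fieldType) (iota : {rmorphism K -> F}) (n : nat).
Variables (lK mK : K) (l r : F).
Hypotheses (n4 : (4 <= n)%N) (l0 : l != 0) (r0 : r != 0).
Local Notation m := (r^-1 - r).
Hypotheses (m0 : m != 0) (lE : iota lK = l) (mE : iota mK = m).
Local Notation V := (nu_space F n).
Variable g : nat -> 'End(V).
Hypothesis gP : nu_action n l r (fun k u => g k u) (@wvec F n).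

Lemma nu_extension : exists rho : cgw n lK mK -> 'End(V),
  [/\ forall a b, rho (a + b) = rho a + rho b,
      forall c a, rho (c *: a) = iota c *: rho a,
      rho 1 = \1%VF, forall a b, rho (a * b) = (rho a \o rho b)%VF
    & forall i, rho (cgw_g lK mK i) = g i.+1].
Proof.
(* Only endomorphisms of a nonzero space form a ring with [1 != 0], as [cgw_lift] requires. *)
have Vp : (0 < dim V)%N.
  rewrite lt0n; apply/eqP=> d0.
  have /(congr1 (fun u => nucoef u true 1 2)) : wvec F n true 1 2 = 0.
    apply/eqP; rewrite -memv0; move: (dimvf V); rewrite d0 => /eqP.
    by rewrite dimv_eq0 => /eqP <-; rewrite memvf.
  rewrite nucoef_wvec // ?nucoef0; last exact: leq_trans n4.
  by move/eqP; rewrite oner_eq0.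
pose S := lfun_comp_nzRingType Vp.
pose f c : S := (iota c *: \1%VF : 'End(V)).
have fB : additive f by move=> a b; rewrite /f rmorphB scalerBl.
have fM : multiplicative f.
  split=> [a b|]; last by rewrite /f rmorph1 scale1r.
  rewrite /f rmorphM; apply/lfunP => u.
  by rewrite [RHS]comp_lfunE !scale_lfunE !id_lfunE scalerA.
pose fA := GRing.isAdditive.Build K S f fB.
pose fR := GRing.isMultiplicative.Build K S f fM.
pose fr : {rmorphism K -> S} := HB.pack f fA fR.
pose G (i : 'I_n) : S := g i.+1.
(* The relation [m e_i = l (g_i^2 + m g_i - 1)] leaves no other choice. The relations for [e_i] then
   follow from [quad] having the line of the root as image. *)
pose E (i : 'I_n) : S :=
  ((l / m) *: (g i.+1 \o g i.+1 + m *: g i.+1 - \1)%VF : 'End(V)).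
have appM (a b : S) u : (a * b : S) u = a (b u) by exact: comp_lfunE.
have appD (a b : S) u : (a + b : S) u = a u + b u by exact: add_lfunE.
have appB (a b : S) u : (a - b : S) u = a u - b u.
  by rewrite appD; congr (_ + _); apply: opp_lfunE.
have app1 u : (1 : S) u = u by exact: id_lfunE.
have appf c u : (fr c : S) u = iota c *: u by rewrite scale_lfunE id_lfunE.
have fC c (a : S) : GRing.comm (fr c) a.
  by apply/lfunP => u; rewrite !appM !appf linearZ.
have GE i u : G i u = g i.+1 u by [].
have EE i u : E i u = (l / m) *: act_quad r (fun k v => g k v) i.+1 u.
  rewrite /act_quad /E scale_lfunE !add_lfunE opp_lfunE scale_lfunE.
  by rewrite comp_lfunE id_lfunE.
have [] := @cgw_lift K n lK mK S fr G E.
- by move=> c i; apply: fC.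
- by move=> c i; apply: fC.
- move=> i j ij; apply/lfunP => u; rewrite !appM !GE; case/orP: ij => ij.
    exact: (act_braid n4 l0 r0 gP).
  by apply/esym; apply: (act_braid n4 l0 r0 gP).
- move=> i j ij nij; apply/lfunP => u; rewrite !appM !GE.
  move: nij; rewrite negb_or => /andP[nij nji].
  have [ltij|leji] := ltnP i j; first exact: (act_comm n4 l0 r0 gP).
  have ltji : (j < i)%N by rewrite ltn_neqAle eq_sym ij.
  by apply/esym; apply: (act_comm n4 l0 r0 gP).
- move=> i; apply/lfunP => u; rewrite appM appf EE appM appf appB appD !appM appf app1.
  by rewrite !GE lE mE scalerA mulrCA divff // mulr1.
- move=> i; apply/lfunP => u; rewrite !appM appf EE GE fmorphV lE.
  have [c ->] := quad_rank1 n4 l0 r0 gP u (ltn_ord i : (0 < i.+1 <= n)%N).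
  rewrite linearZ /= linearZ /= (act_rootE n4 gP) //; last exact: ltn_ord.
  by rewrite !scalerA; congr (_ *: _); move: (r^-1 - r) m0 => a a0; field; rewrite a0 l0.
- move=> i j ij; apply/lfunP => u; rewrite !appM appf !EE GE lE.
  have [c ->] := quad_rank1 n4 l0 r0 gP u (ltn_ord i : (0 < i.+1 <= n)%N).
  rewrite scalerA linearZ (act_quadZ gP).
  rewrite (quad_adjacent n4 l0 r0 gP) //; try exact: ltn_ord.
  by rewrite !scalerA; congr (_ *: _); move: (r^-1 - r) m0 => a a0; field.
move=> rho [rD rZ r1 rM rg]; exists rho; split => //.
move=> c a; rewrite rZ; apply/lfunP => u.
by rewrite appM appf scale_lfunE.
Qed.

End Existence.

Section FreeInduction.
Variables (K : fieldType) (X : choiceType).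
Local Notation A := (free_algebra K X).

Let malg_scale (c : K) (w : {fmonom X}) : << c *g w >> = c *: (<< w >> : A).
Proof. by apply/malgP => v; rewrite mcoeffZ !mcoeffU mulrnAr mulr1. Qed.

Let malg_cons x (s : seq X) :
  << FMonom (x :: s) >> = free_gen K x * << FMonom s >> :> A.
Proof.
rewrite malgM_def fgmulUU mulr1; congr << _ >>.
by apply: val_inj; rewrite /= fmM fmU.
Qed.

Lemma free_ind (P : A -> Prop) :
  (forall a b, P a -> P b -> P (a + b)) -> (forall c a, P a -> P (c *: a)) ->
  P 1 -> (forall x a, P a -> P (free_gen K x * a)) -> forall a, P a.
Proof.
move=> PD PZ P1 Pg a; rewrite [a]monalgE; apply: big_ind => [|//|w _].
  by have := PZ 0 _ P1; rewrite scale0r.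
rewrite malg_scale; apply: PZ; case: w => s.
by elim: s => [|x s IHs]; [rewrite -fmoneE | rewrite malg_cons; apply: Pg].
Qed.
End FreeInduction.

Section QuotientProjection.
Variables (K : fieldType) (B : lalgType K) (Rel : B -> Prop).
Local Notation pi := (iq_pi Rel).

Lemma iq_pi_scale c x : pi (c *: x) = c *: pi x.
Proof. exact: (esym (iq_piZ Rel c x)). Qed.

Lemma iq_pi_add x y : pi (x + y) = pi x + pi y.
Proof. exact: (esym (iq_piD Rel x y)). Qed.

Lemma iq_pi_sub x y : pi (x - y) = pi x - pi y.
Proof. by rewrite iq_pi_add; congr (_ + _); exact: (esym (iq_piN Rel y)). Qed.

Lemma iq_pi_mul x y : pi (x * y) = pi x * pi y.
Proof. exact: (esym (iq_piM Rel x y)). Qed.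

Lemma iq_pi_quad l m x y : pi (m *: x - l *: (y ^+ 2 + m *: y - 1)) =
  m *: pi x - l *: (pi y * pi y + m *: pi y - 1).
Proof.
by rewrite iq_pi_sub !iq_pi_scale iq_pi_sub iq_pi_add iq_pi_scale expr2 iq_pi_mul.
Qed.

Lemma quotient_scaleAl c (x y : ideal_quotient Rel) : c *: (x * y) = (c *: x) * y.
Proof.
elim/iq_piW: x => x; elim/iq_piW: y => y.
by rewrite -iq_pi_mul -!iq_pi_scale -iq_pi_mul scalerAl.
Qed.

Lemma quotient_mul_quad m (x y : ideal_quotient Rel) :
  (x * x + m *: x - 1) * y = x * (x * y) + m *: (x * y) - y.
Proof. by rewrite mulrBl mulrDl mul1r -quotient_scaleAl mulrA. Qed.
End QuotientProjection.

Section CGWInduction.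
Variables (K : fieldType) (n : nat) (l m : K).
Hypothesis m0 : m != 0.
Local Notation A := (cgw n l m).

Lemma cgw_eE (i : 'I_n) : cgw_e l m i = (l / m) *:
  (cgw_g l m i * cgw_g l m i + m *: cgw_g l m i - 1).
Proof.
have mE : m *: cgw_e l m i = l *: (cgw_g l m i * cgw_g l m i + m *: cgw_g l m i - 1).
  apply/eqP; rewrite -subr_eq0 -iq_pi_quad; apply/eqP.
  exact: (iq_pi_eq0 (cgw_rel_quad l m i)).
have ->: l / m = m^-1 * l by rewrite mulrC.
by rewrite -scalerA -mE scalerA (mulVf m0) scale1r.
Qed.

(** As [m] is invertible, each [e_i] is a polynomial in [g_i], so the [g_i] alone generate the
    algebra. *)
Lemma cgw_ind (P : A -> Prop) :
  (forall a b, P a -> P b -> P (a + b)) -> (forall c a, P a -> P (c *: a)) ->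
  P 1 -> (forall i a, P a -> P (cgw_g l m i * a)) -> forall a, P a.
Proof.
move=> PD PZ P1 Pg.
have Pe i a : P a -> P (cgw_e l m i * a).
  move=> Pa; rewrite cgw_eE -quotient_scaleAl quotient_mul_quad -scaleN1r.
  apply/PZ/PD; last exact: PZ.
  by apply: PD; [apply/Pg/Pg | apply/PZ/Pg].
elim/iq_piW => a; elim/free_ind: a => [a b Pa Pb|c a Pa||x a Pa].
- by rewrite iq_pi_add; apply: PD.
- by rewrite iq_pi_scale; apply: PZ.
- exact: P1.
by rewrite iq_pi_mul; case: x => i; [apply: Pg | apply: Pe].
Qed.
End CGWInduction.

Section SubspacePredicate.
Variables (F : fieldType) (V : vectType F).

(** A subspace of maximal dimension inside [P] is all of [P]: adjoining a vector of [P] stays inside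
    [P] and cannot raise the dimension. *)
Lemma subspace_predP (P : V -> Prop) :
  P 0 -> (forall u v, P u -> P v -> P (u + v)) -> (forall c u, P u -> P (c *: u)) ->
  exists U : {vspace V}, forall u, P u <-> u \in U.
Proof.
move=> P0 PD PZ; pose S (U : {vspace V}) := forall u, u \in U -> P u.
pose Q d := `[< exists2 U, S U & \dim U = d >].
have Q0 : exists d, Q d.
  by exists (\dim (0%VS : {vspace V})); apply/asboolP; exists 0%VS => // u /[!memv0]/eqP->.
have Qmax d : Q d -> (d <= \dim {:V})%N.
  by move=> /asboolP[U _ <-]; apply/dimvS/subvf.
case: (ex_maxnP Q0 Qmax) => _ /asboolP[U SU <-] Umax; exists U => u; split; last exact: SU.
move=> Pu; have SUu : S (U + <[u]>)%VS.
  by move=> v /memv_addP[x xU [y /vlineP[c ->] ->]]; apply: PD; [apply: SU | apply: PZ].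
have dE : \dim U = \dim (U + <[u]>).
  apply/eqP; rewrite eqn_leq dimvS ?addvSl //=.
  by apply: Umax; apply/asboolP; exists (U + <[u]>)%VS.
have /eqP -> : U == (U + <[u]>)%VS by rewrite eqEdim addvSl dE /=.
by apply: (subvP (addvSr _ _)); apply: memv_line.
Qed.
End SubspacePredicate.

Section NuRepresentation.
Variables (F : fieldType) (n : nat) (l r : F).
Hypotheses (n4 : (4 <= n)%N) (l0 : l != 0) (r0 : r != 0).
Local Notation m := (r^-1 - r).
Hypothesis m0 : m != 0.
Local Notation V := (nu_space F n).
Local Notation g := (fun k (u : V) => nuop n l r k u).

Lemma nu_exists : exists rho, @is_nu F n l r rho.
Proof.
have [rho [rD rZ r1 rM rg]] :=
  @nu_extension F F idfun n l m l r n4 l0 r0 m0 erefl erefl _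
    (nuop_action n4 l0 r0).
have rl : linear rho by move=> c a b; rewrite rD rZ.
pose rhoL := HB.pack_for {linear cgw n l m -> 'End(V)} rho
  (GRing.isLinear.Build F (cgw n l m) 'End(V) _ rho rl).
exists rhoL; split=> [|k h i j ij jn]; first by split.
by rewrite /= rg nuop_wvec.
Qed.

Section Invariance.
Variable rho : {linear cgw n l m -> 'End(V)}.
Hypothesis rhoP : is_nu rho.

Lemma is_nu_gen k u : rho (cgw_g l m k) u = nuop n l r k.+1 u.
Proof.
case: rhoP => _ rg.
have -> // : rho (cgw_g l m k) = nuop n l r k.+1.
by apply: lfun_nuP => h i j ij jn; rewrite rg // nuop_wvec.
Qed.

Lemma invariant_stable (U : {vspace V}) : Defs.invariant rho U -> stable g (fun u => u \in U).
Proof.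
move=> inv; split=> [|u v|c u|k u kn uU]; [exact: mem0v|exact: memvD|exact: memvZ|].
case: k kn => // k kn; rewrite -[k]/(val (Ordinal kn)) -is_nu_gen.
exact: (subvP (inv _)) (memv_img _ uU).
Qed.

Lemma stable_invariant (U : {vspace V}) : stable g (fun u => u \in U) -> Defs.invariant rho U.
Proof.
case=> _ UD UZ Ug a; apply/subvP => _ /memv_imgP[u uU ->].
case: rhoP => -[r1 rM] _; move: a u uU.
apply: (@cgw_ind F n l m m0 (fun a => forall u, u \in U -> rho a u \in U))
  => [a b IHa IHb|c a IHa||i a IHa] u uU.
- by rewrite linearD add_lfunE; apply: UD; [apply: IHa | apply: IHb].
- by rewrite linearZ scale_lfunE; apply/UZ/IHa.
- by rewrite r1 id_lfunE.
- by rewrite rM comp_lfunE is_nu_gen; apply: Ug; [apply: ltn_ord | apply: IHa].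
Qed.
End Invariance.
End NuRepresentation.

Section Reducibility.
Variables (F : fieldType) (N : nat) (l r : F).
Local Notation n := N.+2.
Hypotheses (n4 : (4 <= n)%N) (l0 : l != 0) (r0 : r != 0).
Hypothesis rN1 : forall k, (1 <= k <= n)%N -> r ^+ (2 * k) != 1.
Hypothesis rNm1 : forall k, (1 <= k <= n - 1)%N -> r ^+ (2 * k) != -1.
Local Notation m := (r^-1 - r).
Hypothesis m0 : m != 0.
Local Notation V := (nu_space F n).
Variable rho : {linear cgw n l m -> 'End(V)}.
Hypothesis rhoP : is_nu rho.
Let gP := nuop_action n4 l0 r0.

Lemma nu_irreducible : l \notin special_values n r -> irreducible_rep rho.
Proof.
move=> ls; split.
  apply/eqP => V0; have : wvec F n true 1 2 \in (0 : {vspace V})%VS by rewrite -V0 memvf.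
  rewrite memv0 => /eqP /(congr1 (fun u => nucoef u true 1 2)).
  by rewrite nucoef_wvec // nucoef0 => /eqP; rewrite oner_eq0.
move=> U /(invariant_stable rhoP) Ust.
have [[v vU]|Uf] := pselect (exists v, ~ v \in U); [left | right].
  apply/eqP; rewrite -subv0; apply/subvP => u uU; rewrite memv0; apply/eqP.
  exact: (generic_irreducible n4 l0 r0 gP rN1 rNm1 ls Ust vU uU).
apply/eqP; rewrite eqEsubv subvf; apply/subvP => v _.
by apply: contrapT => vU; apply: Uf; exists v.
Qed.

Lemma nu_reducible : l \in special_values n r -> reducible_rep rho.
Proof.
move=> /(special_reducible n4 l0 r0 gP rN1 rNm1)[P [[P0 PD PZ Pg] [u Pu u0] [v nPv]]].
have [U UP] := subspace_predP P0 PD PZ; exists U; split.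
- apply: (stable_invariant m0 rhoP); split=> [|x y|c x|k x kn].
  + exact: mem0v.
  + exact: memvD.
  + exact: memvZ.
  by rewrite -!UP; apply: Pg.
- by move=> U0; move: u0; rewrite -memv0 -U0; move/UP: Pu => ->.
- by move=> Uf; apply/nPv/UP; rewrite Uf memvf.
Qed.
End Reducibility.

(** * Semisimplicity *)

Section Complement.
Variable A : pzRingType.
Hypothesis ssA : semisimple A.
Variable I : A -> Prop.
Hypothesis Iideal : left_ideal I.

Lemma semisimple_complement : exists J, [/\ left_ideal J,
    forall x, I x -> J x -> x = 0 & forall a, exists2 x, I x & J (a - x)].
Proof.
case: ssA => k [M [Mmin Msum]].
have M0 i : M i 0 by case: (Mmin i) => -[].
have MD i x y : M i x -> M i y -> M i (x + y) by case: (Mmin i) => -[_ D _] _ _; apply: D.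
have MM i a x : M i x -> M i (a * x) by case: (Mmin i) => -[_ _ D] _ _; apply: D.
have [I0 ID IM] := Iideal.
pose Ms (s : {set 'I_k}) x := exists2 f : 'I_k -> A, forall i, M i (f i)
  & x = \sum_(i in s) f i.
have Msid s : left_ideal (Ms s).
  split=> [|x y [f fM ->] [h hM ->]|a x [f fM ->]].
  - by exists (fun=> 0) => //; rewrite big1.
  - exists (fun i => f i + h i); last by rewrite big_split.
    by move=> i; apply: MD.
  - exists (fun i => a * f i); last by rewrite mulr_sumr.
    by move=> i; apply: MM.
(* The complement is a maximal partial sum of simple summands meeting [I]      *)
(* trivially: any other summand [M i] meets [I + Ms s], hence lies in it.      *)
pose Q s := `[< forall x, I x -> Ms s x -> x = 0 >].
have Q0 : Q set0 by apply/asboolP => x _ [f _ ->]; rewrite big_set0.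
have [s /maxsetP[Qs smax] _] := maxset_exists Q0.
have MN x : (- x : A) = -1 * x by rewrite mulN1r.
have [S0 SD SM] := Msid s.
exists (Ms s); split=> //; first exact/asboolP.
pose T a := exists2 x, I x & Ms s (a - x).
have T0 : T 0 by exists 0; rewrite ?subr0.
have TD x y : T x -> T y -> T (x + y).
  move=> [x1 Ix Mx] [y1 Iy My]; exists (x1 + y1); first exact: ID.
  by rewrite opprD addrACA; apply: SD.
have TM a x : T x -> T (a * x).
  move=> [x1 Ix Mx]; exists (a * x1); first exact: IM.
  by rewrite -mulrBr; apply: SM.
suff TMi i x : M i x -> T x.
  move=> a; have [f [[fM ->] _]] := Msum a.
  by apply: (big_ind T) => // i _; apply: (TMi i).
have [si|si] := boolP (i \in s).
  move=> Mx; exists 0 => //; rewrite subr0.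
  exists (fun j => if j == i then x else 0); last first.
    rewrite (bigD1 i) //= eqxx big1 ?addr0 // => j /andP[_ /negPf ->] //.
  by move=> j; case: eqP => [->|].
have [y [Iy [f fM yE] y0]] : exists y, [/\ I y, Ms (i |: s) y & y <> 0].
  apply: contrapT => nex; have : s = i |: s; last first.
    by move=> sE; move: si; rewrite sE setU11.
  apply/esym/smax; last exact: subsetUr.
  apply/asboolP => y Iy My; apply: contrapT => y0; apply: nex.
  by exists y; split.
suff MT z : M i z -> M i z /\ T z by move=> /MT[].
move: z; have [_ _ Mi] := Mmin i; apply: (Mi (fun z => M i z /\ T z)).
- split=> [|u v [Mu Tu] [Mv Tv]|a u [Mu Tu]]; split; auto.
- by move=> z [].
exists (f i).
  split=> //; exists y => //; rewrite yE big_setU1 //= opprD addrA subrr sub0r MN.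
  by apply: SM; exists f.
apply/eqP => fi0; apply: y0; move/asboolP: Qs; apply => //.
by exists f => //; rewrite yE big_setU1 //= fi0 add0r.
Qed.
End Complement.

Section NotSemisimple.
Variables (K F : fieldType) (iota : {rmorphism K -> F}) (N : nat).
Local Notation n := N.+2.
Variables (lK mK : K) (l r : F).
Hypotheses (n4 : (4 <= n)%N) (l0 : l != 0) (r0 : r != 0).
Local Notation m := (r^-1 - r).
Hypotheses (m0 : m != 0) (lE : iota lK = l) (mE : iota mK = m).
Hypothesis FE : forall c : F, exists x y, c = iota x + iota y * r.
Hypothesis rN1 : forall k, (1 <= k <= n)%N -> r ^+ (2 * k) != 1.
Local Notation V := (nu_space F n).
Variable g : nat -> 'End(V).
Hypothesis gP : nu_action n l r (fun k u => g k u) (@wvec F n).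
Hypothesis g_stable : has_stable (fun k (u : V) => g k u).
Local Notation A := (cgw n lK mK).

Lemma cgw_not_semisimple : ~ semisimple A.
Proof.
move=> ssA.
have [rho [rD rZ r1 rM rg]] := nu_extension n4 l0 r0 m0 lE mE gP.
have [P [[P0 PD PZ Pg] [p Pp p0] [v nPv]]] := g_stable.
have Pq := proper_quad0 n4 l0 r0 gP rN1 P0 PD PZ Pg nPv.
pose root := act_root (@wvec F n); pose w := root 1%N.
have mK0 : mK != 0 by rewrite -(fmorph_eq0 iota) mE.
have [G rG] : exists G : nat -> A, forall k u, (0 < k <= n)%N -> rho (G k) u = g k u.
  exists (fun k => cgw_g lK mK (inord k.-1)) => k u kn.
  by case: k kn => // k kn; rewrite rg inordK.
have rMu a b u : rho (a * b) u = rho a (rho b u) by rewrite rM comp_lfunE.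
have rDu a b u : rho (a + b) u = rho a u + rho b u by rewrite rD add_lfunE.
have rZu c a u : rho (c *: a) u = iota c *: rho a u by rewrite rZ scale_lfunE.
have r1u u : rho 1 u = u by rewrite r1 id_lfunE.
have r0u u : rho 0 u = 0.
  by apply: (@addrI _ (rho 0 u)); rewrite addr0 -rDu addr0.
have rNu a u : rho (- a) u = - rho a u.
  by rewrite -scaleN1r rZu rmorphN rmorph1 scaleN1r.
pose W u := exists a, u = rho a w.
have w1 : W w by exists 1; rewrite r1u.
have Wfull u : W u.
  apply: (P_full n4 l0 r0 gP rN1 (P := W) _ _ _ _ (isT : (0 < 1 <= n)%N) w1 u).
  - by exists 0; rewrite r0u.
  - by move=> _ _ [a ->] [b ->]; exists (a + b); rewrite rDu.
  - move=> c _ [a ->]; have [x [y ->]] := FE c.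
    (* [rho] respects scalars of [K] only, but each [rho a] is linear over [F]: multiplying
       [rho a w] by [r] amounts to multiplying [a] by [g_2] on the right. *)
    exists (x *: a + y *: (a * G 2%N)).
    have g2w : g 2%N w = r *: w by exact: (act_simple gP true (isT : (0 < 1)%N)).
    have aZ : rho a (r *: w) = r *: rho a w by rewrite linearZ.
    rewrite rDu scalerDl; congr (_ + _); first by rewrite rZu.
    by rewrite rZu rMu rG // g2w aZ scalerA.
  - by move=> k _ kn [a ->]; exists (G k * a); rewrite rMu rG.
(* This is [e_1 g_3 / l]. It fixes [w] by [e_1 g_3 e_1 = l e_1], and it kills [P] because [quad 1]
   does. *)
pose b := mK^-1 *: ((G 1%N * G 1%N + mK *: G 1%N - 1) * G 3%N).
have n3 : (0 < 3 <= n)%N by exact: ltnW.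
have bE u : rho b u = m^-1 *: act_quad r (fun k v => g k v) 1%N (g 3%N u).
  rewrite /b rZu rMu !rDu rNu rMu rZu r1u !rG // fmorphV mE.
  by [].
have bw : rho b w = w.
  rewrite bE (act_quad13_root n4 l0 r0 gP).2 scalerA mulVf //.
  by rewrite scale1r.
have bP u : P u -> rho b u = 0.
  by move=> Pu; rewrite bE Pq ?scaler0 //; apply: Pg.
pose I a := P (rho a w).
have Pa a u : P u -> P (rho a u).
  move: u; apply: (@cgw_ind K n lK mK mK0 (fun a => forall u, P u -> P (rho a u)))
    => [a1 a2 IH1 IH2|c a1 IH||i a1 IH] u Pu.
  - by rewrite rDu; apply: PD; [apply: IH1 | apply: IH2].
  - by rewrite rZu; apply/PZ/IH.
  - by rewrite r1u.
  - by rewrite rMu rg; apply: Pg; [apply: ltn_ord | apply: IH].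
have Ii : left_ideal I.
  split=> [|x y Ix Iy|a x Ix]; rewrite /I.
  - by rewrite r0u.
  - by rewrite rDu; apply: PD.
  - by rewrite rMu; apply: Pa.
have [J [[_ _ JM] IJ IJ1]] := semisimple_complement ssA Ii.
have [i Ii1 Ji] := IJ1 1.
have cw : rho (b * (1 - i)) w = w.
  by rewrite rMu rDu rNu r1u linearB /= bw bP // subr0.
have [a pE] := Wfull p.
move: p0; rewrite pE -cw -rMu; case/eqP.
have -> : a * (b * (1 - i)) = 0.
  by apply: IJ; [rewrite /I rMu cw -pE | apply/JM/JM].
by rewrite r0u.
Qed.
End NotSemisimple.

Lemma special_values_morph (F C : fieldType) (f : {rmorphism F -> C}) n r :
  special_values n (f r) = [seq f x | x <- special_values n r].
Proof. by rewrite /special_values /= !rmorphN !fmorphV !rmorphXn. Qed.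

(** * Descent from the complex numbers to [Q(l, r)] and [Q(l, m)] *)

Section Subfields.
Variables (C : fieldType) (a b c d : C).

Hypotheses (ha : a \in subfield_gen c d) (hb : b \in subfield_gen c d).

Let sub x : x \in subfield_gen a b -> x \in subfield_gen c d.
Proof. by move=> /asboolP; apply=> //; apply: subfield_gen_closed. Qed.

Definition Qadj_incl (x : Qadj a b) : Qadj c d :=
  MkQadj (sub (Qadj_mem x)).

Let incl_additive : additive Qadj_incl.
Proof. by move=> x y; apply: val_inj. Qed.
Let incl_multiplicative : multiplicative Qadj_incl.
Proof. by split=> [x y|]; apply: val_inj. Qed.
HB.instance Definition _ := GRing.isAdditive.Build _ _ Qadj_incl incl_additive.
HB.instance Definition _ :=
  GRing.isMultiplicative.Build _ _ Qadj_incl incl_multiplicative.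
End Subfields.

Section QuadraticExtension.
Variables (C : fieldType) (l m r : C).
Hypotheses (r0 : r != 0) (mE : m = r^-1 - r).
Local Notation k := (subfield_gen l m).

Definition quadratic_span : {pred C} :=
  fun x => `[< exists a b, [/\ a \in k, b \in k & x = a + b * r] >].

(* [y] and its conjugate [a + b * (- m - r)] have product [N] in the base field. *)
Let span_closed : GRing.divring_closed quadratic_span.
Proof.
have kD x y : x \in k -> y \in k -> x + y \in k by apply: rpredD.
have kB x y : x \in k -> y \in k -> x - y \in k by apply: rpredB.
have kM x y : x \in k -> y \in k -> x * y \in k by apply: rpredM.
have kd x y : x \in k -> y \in k -> x / y \in k by apply: rpred_div.
have k0 : 0 \in k by apply: rpred0.
have k1 : 1 \in k by apply: rpred1.
have mk : m \in k by apply: subfield_gen2.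
have spanM x y : x \in quadratic_span -> y \in quadratic_span -> x * y \in quadratic_span.
  move=> /asboolP[a [b [ak bk ->]]] /asboolP[a' [b' [ak' bk' ->]]].
  apply/asboolP; exists (a * a' + b * b'), (a * b' + b * a' - m * (b * b')).
  split; [by apply: (kD _ _); apply: (kM _ _) | |].
    by apply: (kB _ _); [apply: (kD _ _) | ]; apply: (kM _ _) => //; apply: (kM _ _).
  by rewrite mE; field.
split.
- by apply/asboolP; exists 1, 0; rewrite mul0r addr0.
- move=> x y /asboolP[a [b [ak bk ->]]] /asboolP[a' [b' [ak' bk' ->]]].
  apply/asboolP; exists (a - a'), (b - b'); split; [exact: kB | exact: kB |].
  by rewrite mulrBl opprD addrACA.
- move=> x y xS yS; apply: spanM => //.
  have [->|y0] := eqVneq y 0.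
    by rewrite invr0; apply/asboolP; exists 0, 0; rewrite mul0r addr0.
  move/asboolP: yS y0 => [a [b [ak bk yE]]] y0.
  pose N := a * a - m * (a * b) - b * b.
  have Nk : N \in k by rewrite /N; apply: (kB _ _); [apply: (kB _ _) | ]; do ?apply: (kM _ _).
  have NE : y * (a - m * b - b * r) = N.
    by rewrite /N yE mE; field.
  have [N0|N0] := eqVneq N 0; last first.
    have -> : y^-1 = (a - m * b) / N + (- b / N) * r.
      have c0 : a - m * b - b * r != 0.
        by apply: contra N0 => /eqP c0; rewrite -NE c0 mulr0.
      have -> : y^-1 = (a - m * b - b * r) / N.
        by rewrite -NE invfM mulrCA divff ?mulr1.
      by move: N^-1 => z; ring.
    apply/asboolP; exists ((a - m * b) / N), (- b / N); split=> //.
      by apply: (kd _ _) => //; apply: (kB _ _) => //; apply: (kM _ _).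
    by apply: (kd _ _) => //; rewrite -sub0r; apply: (kB _ _).
  (* If the norm vanishes, so does the conjugate of [y]. Then [r] already lies in the base field,
     and so does the inverse of [y]. *)
  have cE : a - m * b = b * r.
    apply/eqP; rewrite -subr_eq0; move/eqP: NE.
    by rewrite N0 mulf_eq0 (negPf y0).
  have b0 : b != 0.
    apply: contra y0 => /eqP b0; move: cE; rewrite yE b0 !mul0r mulr0 subr0 addr0.
    by move=> ->.
  have rk : r \in k.
    have -> : r = (a - m * b) / b by rewrite cE mulrAC divff ?mul1r.
    by apply: (kd _ _) => //; apply: (kB _ _) => //; apply: (kM _ _).
  apply/asboolP; exists y^-1, 0; rewrite mul0r addr0; split=> //.
  by rewrite -[y^-1]mul1r yE; apply: (kd _ _) => //; apply: (kD _ _) => //; apply: (kM _ _).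
Qed.

Lemma quadratic_spanP (F := Qadj l r) (hm : m \in subfield_gen l r) (x : F)
    (iota := Qadj_incl (subfield_gen1 l r) hm) :
  exists a b, x = iota a + iota b * Qgen2 l r.
Proof.
have /asboolP[a [b [ak bk xE]]] : Qadj_val x \in quadratic_span.
  have /asboolP := Qadj_mem x; apply; first exact: span_closed.
    apply/asboolP; exists l, 0; rewrite subfield_gen1 rpred0 mul0r addr0.
    by split.
  by apply/asboolP; exists 0, 1; rewrite rpred0 rpred1 mul1r add0r.
by exists (MkQadj ak), (MkQadj bk); apply: val_inj.
Qed.
End QuadraticExtension.

Section Descent.
Variables (C : fieldType) (N : nat) (l r : C).
Local Notation n := N.+2.
Hypotheses (n4 : (4 <= n)%N) (l0 : l != 0) (r0 : r != 0).
Hypothesis rN1 : forall k, (1 <= k <= n)%N -> r ^+ (2 * k) != 1.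
Hypothesis rNm1 : forall k, (1 <= k <= n - 1)%N -> r ^+ (2 * k) != -1.
Local Notation F := (Qadj l r).
Local Notation lF := (Qgen1 l r).
Local Notation rF := (Qgen2 l r).
Let f : {rmorphism F -> C} := \val.

Lemma Qadj_l_neq0 : lF != 0.
Proof. by rewrite -(fmorph_eq0 f). Qed.

Lemma Qadj_r_neq0 : rF != 0.
Proof. by rewrite -(fmorph_eq0 f). Qed.

Lemma Qadj_rN1 k : (1 <= k <= n)%N -> rF ^+ (2 * k) != 1.
Proof. by move=> /rN1; apply: contraNneq => /(congr1 f); rewrite rmorphXn rmorph1 => /= ->. Qed.

Lemma Qadj_rNm1 k : (1 <= k <= n - 1)%N -> rF ^+ (2 * k) != -1.
Proof.
move=> /rNm1; apply: contraNneq => /(congr1 f).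
by rewrite rmorphXn rmorphN rmorph1 => /= ->.
Qed.

Lemma Qadj_special : (lF \in special_values n rF) = (l \in special_values n r).
Proof.
by rewrite -(mem_map (fmorph_inj f)) -[map _ _](special_values_morph f n rF).
Qed.

Lemma special_not_semisimple m : m != 0 -> m = r^-1 - r ->
  l \in special_values n r ->
  ~ semisimple (@cgw (Qadj l m) n (Qgen1 l m) (Qgen2 l m)).
Proof.
move=> m0 mE; rewrite -Qadj_special => ls.
have mk : m \in subfield_gen l r.
  by rewrite mE rpredB ?rpredV ?subfield_gen2.
pose iota : {rmorphism Qadj l m -> F} := Qadj_incl (subfield_gen1 l r) mk.
have iE : iota (Qgen1 l m) = lF by apply: val_inj.
have mF : iota (Qgen2 l m) = rF^-1 - rF by apply: val_inj.
have mF0 : rF^-1 - rF != 0 by rewrite -mF fmorph_eq0 -(fmorph_eq0 \val).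
have gP := nuop_action n4 Qadj_l_neq0 Qadj_r_neq0.
have gs := special_reducible n4 Qadj_l_neq0 Qadj_r_neq0 gP Qadj_rN1 Qadj_rNm1 ls.
have FE c : exists x y, c = iota x + iota y * rF.
  exact: (quadratic_spanP r0 mE).
exact: (cgw_not_semisimple n4 Qadj_l_neq0 Qadj_r_neq0 mF0 iE mF FE Qadj_rN1 gP gs).
Qed.
End Descent.

Theorem theorem2 (R : realType) (n : nat) (l m r : R[i])
  (hn : (4 <= n)%N) (hl : l != 0) (hm : m != 0) (hr : r != 0)
  (hmr : m = r^-1 - r)
  (F := Qadj l r) (lF := Qgen1 l r : F) (rF := Qgen2 l r : F)
  (hHD : semisimple (heckeD n (rF^-1 - rF)))
  (hHA : semisimple (heckeSym n (rF ^+ 2)))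
  (hr1 : forall k : nat, (1 <= k <= n)%N -> r ^+ (2 * k) != 1)
  (hr2 : forall k : nat, (1 <= k <= n - 1)%N -> r ^+ (2 * k) != -1) :
  [/\ exists rho, @is_nu F n lF rF rho,
      forall rho, @is_nu F n lF rF rho ->
        (l \notin special_values n r -> irreducible_rep rho) /\
        (l \in special_values n r -> reducible_rep rho)
    & l \in special_values n r \/ l \in special_values n (- r^-1) ->
        ~ semisimple (@cgw (Qadj l m) n (Qgen1 l m) (Qgen2 l m))].
Proof.
rewrite {}/lF {}/rF {}/F in hHD hHA *; clear hHD hHA.
case: n hn hr1 hr2 => [|[|N]] // n4 rN1 rNm1.
have l0 := Qadj_l_neq0 r hl; have r0 := Qadj_r_neq0 l hr.
have m0 : (Qgen2 l r)^-1 - Qgen2 l r != 0.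
  by rewrite -(fmorph_eq0 \val) /= -hmr.
split.
- exact: (nu_exists n4 l0 r0 m0).
- move=> rho rhoP; rewrite -Qadj_special; split.
    exact: (nu_irreducible n4 l0 r0 (Qadj_rN1 l rN1) (Qadj_rNm1 l rNm1) rhoP).
  exact: (nu_reducible n4 l0 r0 (Qadj_rN1 l rN1) (Qadj_rNm1 l rNm1) m0 rhoP).
have sN k : (- r^-1) ^+ (2 * k) = (r ^+ (2 * k))^-1.
  by rewrite exprM sqrrN -exprM exprVn.
case; first exact: (special_not_semisimple n4 hl hr rN1 rNm1).
(* Replacing [r] by [- 1/r] leaves [m] unchanged and inverts the even powers of [r], so the
   hypotheses carry over and the algebra over [Q(l, m)] is the same. *)
apply: (special_not_semisimple n4) => // [|k kn|k kn|].
- by rewrite oppr_eq0 invr_eq0.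
- by rewrite sN invr_eq1 rN1.
- by rewrite sN -(inj_eq (can_inj invrK)) invrK invrN invr1 rNm1.
- by rewrite hmr invrN invrK opprK addrC.
Qed.
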